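(* Let $d\ge 2$ and $a>0$. Suppose that $K\subset\mathbb{R}^d$ is a compact convex set such that $\partial K$ is a smooth closed manifold (a hypersurface in $\mathbb{R}^d$) with nowhere vanishing Gaussian curvature. Then $$\lim_{R\to\infty}\frac{\mathrm{Var}\big(\mathbf{n}(K_R)\big)}{R^{d-1}}=\sqrt{\frac{a}{2\pi}}\cdot\sigma_{d-1}(\partial K),$$ where $\sigma_{d-1}(\partial K)$ is the surface area of $\partial K$.
   Context: For a fixed $a>0$, $\{\xi_n\}_{n\in\mathbb{Z}^d}$ are independent identically distributed random vectors in $\mathbb{R}^d$ with density $\phi_a(x)=(a\pi)^{-d/2}e^{-|x|^2/a}$ with respect to Lebesgue measure. The point process is $W=\{n+\xi_n: n\in\mathbb{Z}^d\}$, with counting measure $\mathbf{n}=\sum_{w\in W}\delta_w=\sum_{n\in\mathbb{Z}^d}\delta_{n+\xi_n}$. For $R>0$, $K_R=\{Rx: x\in K\}$, so $\mathbf{n}(K_R)$ is the number of $n\in\mathbb{Z}^d$ with $n+\xi_n\in K_R$. The variance is $\mathrm{Var}(X)=\mathbb{E}[(X-\mathbb{E}X)^2]$. $\sigma_{d-1}$ is the surface measure on $\partial K$ induced by Lebesgue measure. *)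

(* Defs.v *)
From HB Require Import structures.
From mathcomp Require Import all_boot all_order all_algebra finmap.
From mathcomp Require Import all_classical all_reals all_analysis.

Set Implicit Arguments.
Unset Strict Implicit.
Unset Printing Implicit Defensive.
Import Order.TTheory GRing.Theory Num.Theory.
Import numFieldNormedType.Exports.

Local Open Scope classical_set_scope.
Local Open Scope ring_scope.

(* 'rV[T]_n carries the product sigma-algebra, as n.-tuple T does in the
   library; for T := R this is the Borel sigma-algebra of R^n. *)
Definition measure_rV_display : measure_display -> measure_display.
Proof. exact. Qed.

Section measurable_rV.
Context {d} {T : sigmaRingType d}.
Variable n : nat.

Let coors : 'I_n -> 'rV[T]_n -> T := fun i v => v ord0 i.

Let rV_set0 : g_sigma_preimage coors set0.
Proof. exact: sigma_algebra0. Qed.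

Let rV_setC A : g_sigma_preimage coors A -> g_sigma_preimage coors (~` A).
Proof. exact: sigma_algebraC. Qed.

Let rV_bigcup (F : _^nat) : (forall i, g_sigma_preimage coors (F i)) ->
  g_sigma_preimage coors (\bigcup_i (F i)).
Proof. exact: sigma_algebra_bigcup. Qed.

HB.instance Definition _ := @isMeasurable.Build (measure_rV_display d)
  'rV[T]_n (g_sigma_preimage coors) rV_set0 rV_setC rV_bigcup.

End measurable_rV.

Lemma measurable_coord d (T : sigmaRingType d) n (i : 'I_n) :
  measurable_fun [set: 'rV[T]_n] (fun v => v ord0 i).
Proof.
move=> _ Y mY; rewrite setTI; apply: sub_sigma_algebra => /=.
rewrite -bigcup_seq/=; exists i => /=; first by rewrite mem_index_enum.
by exists Y => //; rewrite setTI.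
Qed.

Lemma measurable_fun_coordP d1 d2 (T1 : measurableType d1)
    (T2 : measurableType d2) n (f : T1 -> 'rV[T2]_n) :
  (forall i, measurable_fun [set: T1] (fun x => f x ord0 i)) ->
  measurable_fun [set: T1] f.
Proof.
move=> mf _ A mA; rewrite setTI.
suff : g_sigma_preimage (fun (i : 'I_n) x => f x ord0 i) `<=` measurable.
  apply; rewrite (g_sigma_preimage_comp (fun (i : 'I_n) (v : 'rV[T2]_n) => v ord0 i) f).
  by exists A => //; rewrite setTI.
apply: smallest_sub; first exact: sigma_algebra_measurable.
case: n f mf {A mA} => [|n] f mf; first by rewrite big_ord0.
by rewrite -bigcup_mkord_ord; apply: bigcup_sub => i Ii A [B mB <-]; exact: mf.
Qed.

Section lebesgue_rV.
Context {R : realType}.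

Definition rV_cons n (p : R * 'rV[R]_n) : 'rV[R]_n.+1 :=
  row_mx (p.1%:M : 'rV[R]_1) p.2.

Definition rV_uncons n (v : 'rV[R]_n.+1) : R * 'rV[R]_n :=
  (v ord0 ord0, \row_i v ord0 (lift ord0 i)).

Lemma rV_cons0 n (p : R * 'rV[R]_n) : rV_cons p ord0 ord0 = p.1.
Proof.
have e : ord0 = lshift n (ord0 : 'I_1) :> 'I_(1 + n) by apply: val_inj.
apply: etrans (congr1 (rV_cons p ord0) e) _.
by rewrite /rV_cons (row_mxEl (p.1%:M : 'rV[R]_1)) mxE eqxx mulr1n.
Qed.

Lemma rV_consS n (p : R * 'rV[R]_n) i :
  rV_cons p ord0 (lift ord0 i) = p.2 ord0 i.
Proof.
have e : lift ord0 i = rshift 1 i :> 'I_(1 + n) by apply: val_inj.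
apply: etrans (congr1 (rV_cons p ord0) e) _.
by rewrite /rV_cons (row_mxEr (p.1%:M : 'rV[R]_1)).
Qed.

Lemma rV_consK n : cancel (@rV_cons n) (@rV_uncons n).
Proof.
move=> p; rewrite /rV_uncons rV_cons0 [p in RHS]surjective_pairing.
by congr pair; apply/rowP => i; rewrite mxE rV_consS.
Qed.

Lemma measurable_rV_cons n : measurable_fun [set: R * 'rV[R]_n] (@rV_cons n).
Proof.
apply: measurable_fun_coordP => i.
case: (unliftP ord0 i) => [j ->|->].
- apply: (eq_measurable_fun ((fun v : 'rV[R]_n => v ord0 j) \o snd)).
    by move=> p _ /=; rewrite rV_consS.
  exact: measurableT_comp (measurable_coord _) measurable_snd.
- by apply: (eq_measurable_fun fst) => // p _; rewrite rV_cons0.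
Qed.

Lemma measurable_rV_uncons n :
  measurable_fun [set: 'rV[R]_n.+1] (@rV_uncons n).
Proof.
apply: measurable_fun_pair; first exact: measurable_coord.
apply: measurable_fun_coordP => i.
apply: (eq_measurable_fun (fun v : 'rV[R]_n.+1 => v ord0 (lift ord0 i))).
  by move=> v _; rewrite mxE.
exact: measurable_coord.
Qed.

Section succ.
Local Open Scope ereal_scope.
Variables (n : nat) (mu : {sigma_finite_measure set 'rV[R]_n -> \bar R}).

Definition lebesgue_rV_succ : set 'rV[R]_n.+1 -> \bar R :=
  pushforward (@lebesgue_measure R \x mu) (@rV_cons n).

Let succ0 : lebesgue_rV_succ set0 = 0.
Proof. by rewrite /lebesgue_rV_succ /pushforward preimage_set0 measure0. Qed.

Let succ_ge0 A : 0 <= lebesgue_rV_succ A.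
Proof. by rewrite /lebesgue_rV_succ /pushforward measure_ge0. Qed.

Let succ_sigma_additive : semi_sigma_additive lebesgue_rV_succ.
Proof.
move=> F mF tF mUF; rewrite /lebesgue_rV_succ /pushforward preimage_bigcup.
have mc A : measurable A -> measurable (@rV_cons n @^-1` A).
  by move=> mA; rewrite -[X in measurable X]setTI; exact: measurable_rV_cons.
apply: measure_semi_sigma_additive => //.
- by move=> k; exact: mc.
- apply/trivIsetP => /= i j _ _ ij; rewrite -preimage_setI.
  by move/trivIsetP : tF => /(_ _ _ _ _ ij) ->//; rewrite preimage_set0.
- by rewrite -preimage_bigcup; exact: mc.
Qed.

HB.instance Definition _ := isMeasure.Build _ _ _
  lebesgue_rV_succ succ0 succ_ge0 succ_sigma_additive.

Let succ_sigma_finite : sigma_finite setT lebesgue_rV_succ.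
Proof.
have /sigma_finiteP[F [FT ndF Foo]] := sigma_finiteT (@lebesgue_measure R).
have /sigma_finiteP[G [GT ndG Goo]] := sigma_finiteT mu.
exists (fun k => @rV_uncons n @^-1` (F k `*` G k)).
  apply/esym/seteqP; split => // v _; set p := rV_uncons v.
  have [i _ Fi] : (\bigcup_i F i) p.1 by rewrite -FT.
  have [j _ Gj] : (\bigcup_i G i) p.2 by rewrite -GT.
  exists (maxn i j) => //; split => /=.
  - by move: Fi; apply/subsetPset/ndF/leq_maxl.
  - by move: Gj; apply/subsetPset/ndG/leq_maxr.
move=> k; have [mF Fk] := Foo k; have [mG Gk] := Goo k; split.
  rewrite -[X in measurable X]setTI; apply: measurable_rV_uncons => //.
  exact: measurableX.
rewrite /lebesgue_rV_succ /pushforward -comp_preimage.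
rewrite (_ : _ \o _ = id); last by apply/funext => p /=; rewrite rV_consK.
by rewrite preimage_id product_measure1E// lte_mul_pinfty// ge0_fin_numE.
Qed.

HB.instance Definition _ := Measure_isSigmaFinite.Build _ _ _
  lebesgue_rV_succ succ_sigma_finite.

End succ.

(* Lebesgue measure on R^n: the n-fold product of one-dimensional Lebesgue
   measure, R^0 being a point of mass 1. *)
Fixpoint lebesgue_rV n : {sigma_finite_measure set 'rV[R]_n -> \bar R} :=
  if n is n'.+1 then lebesgue_rV_succ (lebesgue_rV n')
  else \d_(0 : 'rV[R]_0).

End lebesgue_rV.

Section euclidean.
Context {R : realType}.

(* The library norm on 'rV[R]_n is the sup norm (same topology); Euclidean
   lengths go through dotv. *)
Definition dotv n (x y : 'rV[R]_n) : R := \sum_i x ord0 i * y ord0 i.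

Definition frontier (T : topologicalType) (A : set T) : set T :=
  closure A `\` A^°.

Definition dilate n (r : R) (A : set 'rV[R]_n) : set 'rV[R]_n :=
  [set r *: x | x in A].

End euclidean.

Section hypersurfaces.
Context {R : realType}.

Definition partial m n (i : 'I_m) (f : 'rV[R]_m -> 'rV[R]_n)
    : 'rV[R]_m -> 'rV[R]_n :=
  'D_(delta_mx ord0 i) f.

Definition iter_partial m n (s : seq 'I_m) (f : 'rV[R]_m -> 'rV[R]_n) :=
  foldr (@partial m n) f s.

(* C^oo on an open set U: partial derivatives of all orders exist and are
   continuous at every point of U. *)
Definition smooth_on m n (U : set 'rV[R]_m) (f : 'rV[R]_m -> 'rV[R]_n) :=
  forall (s : seq 'I_m) (u : 'rV[R]_m), U u ->
    {for u, continuous (iter_partial s f)} /\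
    forall i : 'I_m, derivable (iter_partial s f) u (delta_mx ord0 i).

Definition tangent_frame m n (X : 'rV[R]_m -> 'rV[R]_n) (u : 'rV[R]_m)
    : 'M[R]_(m, n) :=
  \matrix_(i < m) partial i X u.

(* Local parametrization of M, a subset of R^d, by an open subset U of
   R^(d-1): a smooth injective immersion of U which is a homeomorphism onto an
   open subset of M. Only the values of X on U matter. *)
Definition local_parametrization d (M : set 'rV[R]_d) (U : set 'rV[R]_d.-1)
    (X : 'rV[R]_d.-1 -> 'rV[R]_d) :=
  [/\ open U,
      smooth_on U X,
      forall u, U u -> row_free (tangent_frame X u),
      {in U &, injective X} &
      forall W, open W -> W `<=` U ->
        exists2 V : set 'rV[R]_d, open V & X @` W = M `&` V].

Definition smooth_hypersurface d (M : set 'rV[R]_d) :=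
  forall p, M p -> exists U X, local_parametrization M U X /\ (X @` U) p.

Definition smooth_closed_hypersurface d (M : set 'rV[R]_d) :=
  compact M /\ smooth_hypersurface M.

Definition first_form m n (X : 'rV[R]_m -> 'rV[R]_n) (u : 'rV[R]_m)
    : 'M[R]_m :=
  \matrix_(i, j) dotv (partial i X u) (partial j X u).

Definition second_form m n (X : 'rV[R]_m -> 'rV[R]_n) (nu : 'rV[R]_n)
    (u : 'rV[R]_m) : 'M[R]_m :=
  \matrix_(i, j) dotv (partial i (partial j X) u) nu.

Definition unit_normal m n (X : 'rV[R]_m -> 'rV[R]_n) (u : 'rV[R]_m)
    (nu : 'rV[R]_n) :=
  dotv nu nu = 1 /\ forall i, dotv (partial i X u) nu = 0.

(* det II / det I is the product of the principal curvatures, with respect to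
   the unit normal nu, at the point X u. *)
Definition gaussian_curvature m n (X : 'rV[R]_m -> 'rV[R]_n) (nu : 'rV[R]_n)
    (u : 'rV[R]_m) : R :=
  \det (second_form X nu u) / \det (first_form X u).

(* The curvature at a point does not depend on the parametrization, and
   replacing nu by - nu can only change its sign. *)
Definition nonvanishing_curvature d (M : set 'rV[R]_d) :=
  forall U X, local_parametrization M U X ->
  forall u nu, U u -> unit_normal X u nu -> gaussian_curvature X nu u != 0.

(* sigma is the surface measure induced on M by Lebesgue measure, seen as a
   Borel measure on R^d carried by M: in every local parametrization it is
   sqrt (det I) times Lebesgue measure on R^(d-1). Since countably many
   parametrized pieces cover a smooth hypersurface, these conditions determine
   sigma; it exists because the integrals agree on overlaps. *)
Definition is_surface_measure d (M : set 'rV[R]_d)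
    (sigma : {measure set 'rV[R]_d -> \bar R}) :=
  sigma (~` M) = 0%E /\
  forall U X, local_parametrization M U X ->
  forall A, measurable A -> A `<=` X @` U ->
    sigma A = (\int[lebesgue_rV d.-1]_(u in U `&` X @^-1` A)
                 (Num.sqrt (\det (first_form X u)))%:E)%E.

End hypersurfaces.

Section perturbed_lattice.
Context {R : realType}.

Definition gaussian_density n (a : R) (x : 'rV[R]_n) : R :=
  (a * pi) `^ (- (n%:R / 2)) * expR (- (dotv x x / a)).

Context {disp disp' : measure_display} {T : measurableType disp}
  {S : measurableType disp'} {P : probability T R}.

Definition mutually_independent (I : choiceType) (X : I -> {RV P >-> S}) :=
  forall (J : {fset I}) (A : I -> set S), (forall i, measurable (A i)) ->
    P (\bigcap_(i in [set` J]) (X i @^-1` A i)) =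
    (\big[mule/1]_(i <- J) P (X i @^-1` A i))%E.

Definition has_density n (X : {RV P >-> 'rV[R]_n}) (f : 'rV[R]_n -> R) :=
  forall A, measurable A ->
    distribution P X A = (\int[lebesgue_rV n]_(x in A) (f x)%:E)%E.

Definition point_process n (xi : 'rV[int]_n -> {RV P >-> 'rV[R]_n}) (w : T)
    (A : set 'rV[R]_n) : \bar R :=
  (\esum_(k in [set: 'rV[int]_n]) \d_(map_mx intr k + xi k w)%R A)%E.

(* The total count is almost surely finite on bounded sets; fine sends the
   value +oo, taken on a null set, to 0. *)
Definition number_of_points n (xi : 'rV[int]_n -> {RV P >-> 'rV[R]_n})
    (A : set 'rV[R]_n) (w : T) : R :=
  fine (point_process xi w A).

End perturbed_lattice.

(* Main.v *)
(* The events that the perturbed points fall in K_R are independent, so the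
   variance is the sum of p_k (1 - p_k) over lattice points k, where p_k is the
   Gaussian mass of K_R - k. Writing p_k and 1 - p_k as integrals at points z and
   z + v and completing squares turns the sum into
     \int kappa(v) \int_(z in K_R, z + v notin K_R) Theta(z + v/2) dz dv,
   with kappa Gaussian and Theta a Z^d-periodic product of theta functions.
   As the curvature does not vanish, the boundary of K contains no segment and K
   is uniformly round. Concavity of chord lengths then bounds the integral over
   K_R of a nonconstant character by o(R^(d-1)), so that Theta, a uniform limit of
   trigonometric polynomials, may be replaced by its mean. The volume of
   K_R \ (K_R - v) is asymptotic to R^(d-1) |v_0| times the volume of the shadow of
   K along v, which by Cauchy's projection formula is the integral of the positive
   part of v.nu over the boundary, nu being the outer unit normal. Integrating
   against the Gaussian in v, every unit normal contributes sqrt (a / (2 pi)). *)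
Require Import Defs.
From HB Require Import structures.
From mathcomp Require Import all_boot all_order all_algebra finmap.
From mathcomp Require Import all_classical all_reals all_analysis.
From mathcomp Require Import measurable_realfun ring lra.
Set Implicit Arguments.
Unset Strict Implicit.
Unset Printing Implicit Defensive.
Import Order.TTheory GRing.Theory Num.Theory.
Import numFieldNormedType.Exports.
Local Open Scope classical_set_scope.
Local Open Scope ring_scope.


(** * Lebesgue measure on row vectors *)

(** The limit only asks that nonconstant characters contribute o(R^(d-1)), so no rate of Fourier
    decay is established: uniform roundness of K replaces stationary phase, and the curvature acts
    solely through the absence of boundary segments. The region of z in K_R with z + v outside K_R
    is not convex, but it is K_R minus the intersection of K_R with K_R - v; both sets are convex
    and equally round, so one estimate for convex sets is applied twice. The displacement v stays
    fixed while R grows. Since Theta is bounded and the volume of the region is at most R^(d-1)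
    times the flux of v through the boundary, dominated convergence in v follows. Shadows are cast
    along v on the hyperplane of the last d - 1 coordinates, which asks for v_0 <> 0 and discards a
    null set of displacements. As for the constant: kappa times the mean of Theta is the density of
    the difference of two independent perturbations, with variance a/2 + a/2 = a in each direction,
    and the positive part of a centred Gaussian variable of variance a has mean sqrt (a / (2
    pi)). *)

Section integrable_real.
Context d (T : measurableType d) (R : realType) (mu : {measure set T -> \bar R}).
Variables (D : set T) (mD : measurable D).
Local Notation integ f := (mu.-integrable D (EFin \o f)).

Lemma integrable_scale (r : R) (f : T -> R) : integ f -> integ (fun x => r * f x).
Proof.
move=> intf; apply: (eq_integrable mD (fun x => r%:E * (EFin \o f) x)%E) => //.
exact: integrableZl.
Qed.

Lemma integrable_add (f g : T -> R) : integ f -> integ g -> integ (fun x => f x + g x).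
Proof.
move=> intf intg; apply: (eq_integrable mD ((EFin \o f) \+ (EFin \o g))%E) => //.
exact: integrableD.
Qed.

Lemma integrable_sub (f g : T -> R) : integ f -> integ g -> integ (fun x => f x - g x).
Proof.
move=> intf intg; apply: (eq_integrable mD ((EFin \o f) \- (EFin \o g))%E) => //.
exact: integrableB.
Qed.

Lemma measure_integral_indic (A : set T) : measurable A ->
  mu A = (\int[mu]_x (\1_A x)%:E)%E.
Proof. by move=> mA; rewrite integral_indic// setIT. Qed.

End integrable_real.

Section lebesgue_line.
Context {R : realType}.
Local Open Scope ereal_scope.
Local Notation mu := (@lebesgue_measure R).

(** Both sides are measures in [A] that agree on half-open intervals, and these determine Lebesgue
    measure. *)
Lemma lebesgue_measure_affine (r c : R) (r0 : (0 < r)%R) (A : set R) :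
  measurable A -> mu A = r%:E * mu ((fun x => r * x + c)%R @^-1` A).
Proof.
pose phi : measurableTypeR R -> measurableTypeR R := fun x => (r * x + c)%R.
have mphi : measurable_fun setT phi.
  by apply: measurable_funD => //; exact: measurable_funM.
pose rn : {nonneg R} := NngNum (ltW r0).
move=> mA.
pose nu : {measure set (measurableTypeR R) -> \bar R} :=
  mscale rn (measure_function_pushforward__canonical__measure_function_Measure mu mphi).
rewrite [RHS](_ : _ = nu A)//.
apply: lebesgue_measure_unique => // _ [[a b]] _ <-.
rewrite [RHS](_ : _ = r%:E * mu (phi @^-1` `]a, b]))//.
rewrite (_ : phi @^-1` _ = `]((a - c) / r)%R, ((b - c) / r)%R]%classic); last first.
  apply/seteqP; split => x /=; rewrite !in_itv/= /phi;
   by rewrite ltr_pdivrMr// ler_pdivlMr// ltrBlDr lerBrDr (mulrC x).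
rewrite !lebesgue_measure_itv/= !lte_fin ltr_pM2r ?invr_gt0// ltrD2r.
case: ifPn => _; last by rewrite mule0.
rewrite -!EFinB -EFinM; congr EFin.
by rewrite -mulrBl mulrCA mulfV ?gt_eqF// mulr1; lra.
Qed.

Lemma ge0_integral_affine (r c : R) (r0 : (0 < r)%R) (f : R -> \bar R) :
  measurable_fun setT f -> (forall x, 0 <= f x) ->
  \int[mu]_x f x = r%:E * \int[mu]_x f (r * x + c)%R.
Proof.
move=> mf f0.
pose phi : measurableTypeR R -> measurableTypeR R := fun x => (r * x + c)%R.
have mphi : measurable_fun setT phi.
  by apply: measurable_funD => //; exact: measurable_funM.
pose rn : {nonneg R} := NngNum (ltW r0).
transitivity (\int[mscale rn (measure_function_pushforward__canonical__measure_function_Measure mu mphi)]_x f x).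
  by apply: eq_measure_integral => A mA _; exact: lebesgue_measure_affine.
rewrite ge0_integral_mscale//=; congr (_ * _).
by rewrite (@ge0_integral_pushforward _ _ _ _ _ phi)// preimage_setT.
Qed.

End lebesgue_line.

Section lebesgue_rV_lemmas.
Context {R : realType}.

Lemma ler_norm_rV n (x : 'rV[R]_n) (e : R) :
  0 <= e -> (forall j, `|x ord0 j| <= e) -> `|x| <= e.
Proof.
move=> e0 xe; rewrite -[leLHS]/(mx_norm _) mx_normrE.
by apply: bigmax_le => // -[i j] _ /=; rewrite ord1.
Qed.

Lemma ler_coord_norm n (x : 'rV[R]_n) j : `|x ord0 j| <= `|x|.
Proof.
rewrite -[leRHS]/(mx_norm _) mx_normrE.
exact: (le_bigmax _ (fun i : 'I_1 * 'I_n => `|x i.1 i.2|) (ord0, j)).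
Qed.

(** The sigma-algebra is generated by coordinates, not by open sets. Sup-norm balls with rational
    centre and radius are finite intersections of coordinate preimages, and an open set is the
    countable union of those that it contains. *)
Lemma open_measurable_rV n (A : set 'rV[R]_n) : open A -> measurable A.
Proof.
move=> oA.
pose B (i : 'rV[rat]_n * rat) : set 'rV[R]_n :=
  [set v | forall j, `|ratr (i.1 ord0 j) - v ord0 j| < ratr i.2].
have mB i : measurable (B i).
  rewrite (_ : B i = \bigcap_(j in [set: 'I_n])
      ((fun v : 'rV[R]_n => v ord0 j) @^-1` ball (ratr (i.1 ord0 j) : R) (ratr i.2))).
    apply: fin_bigcap_measurable => // j _; rewrite -[X in measurable X]setTI.
    by apply: measurable_coord => //; exact: measurable_ball.
  by apply/seteqP; split => [v Bv j _|v Bv j]; [exact: Bv|exact: (Bv j I)].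
pose F i := if `[< B i `<=` A >] then B i else set0.
have -> : A = \bigcup_i F i.
  apply/seteqP; split => [x Ax|x [i _]]; last first.
    by rewrite /F; case: asboolP => // BA Bx; exact: BA.
  have /nbhs_ballP[e/= e0 eA] := open_nbhs_nbhs (conj oA Ax).
  (* Less than [e / 2]: a ball of radius [r] whose centre is within [r] of [x] stays within
     [2 * r < e] of [x]. *)
  have [r] := rat_in_itvoo (divr_gt0 e0 (ltr0Sn R 1)).
  rewrite in_itv/= => /andP[r0 re].
  have H j : exists q : rat, `|ratr q - x ord0 j| < ratr r :> R.
    have : x ord0 j - ratr r < x ord0 j + ratr r by lra.
    move=> /rat_in_itvoo[q]; rewrite in_itv/= => /andP[q1 q2].
    by exists q; rewrite ltr_norml; apply/andP; split; lra.
  pose q : 'rV[rat]_n := \row_j sval (cid (H j)).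
  have qP j : `|ratr (q ord0 j) - x ord0 j| < ratr r :> R.
    by rewrite mxE; case: cid.
  exists (q, r) => //; rewrite /F; case: asboolP => [_ j|]; first exact: qP.
  move=> BA; exfalso; apply: BA => v Bv; apply: eA => /=.
  rewrite mx_norm_ball /ball_/= (le_lt_trans (y := 2 * ratr r))//; last lra.
  apply: ler_norm_rV => [|j]; first by lra.
  rewrite !mxE.
  have := Bv j; have := qP j; rewrite !ltr_norml ler_norml /= => /andP[? ?] /andP[? ?].
  by apply/andP; split; lra.
apply: countable_bigcupT_measurable => [|i]; first exact: countableP.
by rewrite /F; case: asboolP.
Qed.

Lemma closed_measurable_rV n (A : set 'rV[R]_n) : closed A -> measurable A.
Proof.
move=> cA; rewrite -[A]setCK; apply: measurableC.
by apply: open_measurable_rV; exact: closed_openC.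
Qed.

Lemma compact_measurable_rV n (A : set 'rV[R]_n) : compact A -> measurable A.
Proof.
by move=> cA; apply: closed_measurable_rV; exact: compact_closed.
Qed.

Lemma measurable_rV_comp d (T : measurableType d) n (f : T -> 'rV[R]_n) i :
  measurable_fun setT f -> measurable_fun setT (fun x => f x ord0 i).
Proof.
by move=> mf; exact: (measurableT_comp (measurable_coord (T := R) i) mf).
Qed.

Lemma measurable_rVD d (T : measurableType d) n (f g : T -> 'rV[R]_n) :
  measurable_fun setT f -> measurable_fun setT g ->
  measurable_fun setT (fun x => f x + g x).
Proof.
move=> mf mg; apply: measurable_fun_coordP => i.
under eq_fun do rewrite mxE.
by apply: measurable_funD; exact: measurable_rV_comp.
Qed.

Lemma measurable_rVZ d (T : measurableType d) n (f : T -> R) (g : T -> 'rV[R]_n) :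
  measurable_fun setT f -> measurable_fun setT g ->
  measurable_fun setT (fun x => f x *: g x).
Proof.
move=> mf mg; apply: measurable_fun_coordP => i.
under eq_fun do rewrite mxE.
by apply: measurable_funM => //; exact: measurable_rV_comp.
Qed.

Lemma measurable_rVN d (T : measurableType d) n (g : T -> 'rV[R]_n) :
  measurable_fun setT g -> measurable_fun setT (fun x => - g x).
Proof.
move=> mg; under eq_fun do rewrite -scaleN1r.
by apply: measurable_rVZ.
Qed.

Lemma measurable_rVB d (T : measurableType d) n (f g : T -> 'rV[R]_n) :
  measurable_fun setT f -> measurable_fun setT g ->
  measurable_fun setT (fun x => f x - g x).
Proof. by move=> mf mg; apply: measurable_rVD => //; exact: measurable_rVN. Qed.

Lemma measurable_dotv d (T : measurableType d) n (f g : T -> 'rV[R]_n) :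
  measurable_fun setT f -> measurable_fun setT g ->
  measurable_fun setT (fun x => dotv (f x) (g x)).
Proof.
move=> mf mg; apply: measurable_sum => i.
by apply: measurable_funM; exact: measurable_rV_comp.
Qed.

Lemma measurable_rV_consP d (T : measurableType d) n (f : T -> R) (g : T -> 'rV[R]_n) :
  measurable_fun setT f -> measurable_fun setT g ->
  measurable_fun setT (fun x => rV_cons (f x, g x)).
Proof.
move=> mf mg; apply: (measurableT_comp (@measurable_rV_cons _ _)).
exact: measurable_fun_pair.
Qed.

Local Open Scope ereal_scope.
Local Notation mu := (@lebesgue_measure R).
Local Notation lam := (@lebesgue_rV R).

Lemma rV_consD n (s t : R) (x y : 'rV[R]_n) :
  rV_cons ((s + t)%R, (x + y)%R) = (rV_cons (s, x) + rV_cons (t, y))%R.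
Proof.
apply/rowP => i; rewrite [RHS]mxE.
by case: (unliftP ord0 i) => [j ->|->]; rewrite ?rV_consS ?rV_cons0//= mxE.
Qed.

Lemma rV_consZ n (s t : R) (x : 'rV[R]_n) :
  rV_cons ((s * t)%R, (s *: x)%R) = (s *: rV_cons (t, x))%R.
Proof.
apply/rowP => i; rewrite [RHS]mxE.
by case: (unliftP ord0 i) => [j ->|->]; rewrite ?rV_consS ?rV_cons0//= mxE.
Qed.

Lemma rV_unconsK n : cancel (@rV_uncons R n) (@rV_cons R n).
Proof.
move=> v; apply/rowP => i.
by case: (unliftP ord0 i) => [j ->|->]; rewrite ?rV_consS ?rV_cons0//= mxE.
Qed.

Lemma measurable_rV_section n (f : 'rV[R]_n.+1 -> \bar R) (t : R) :
  measurable_fun setT f -> measurable_fun setT (fun y => f (rV_cons (t, y))).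
Proof.
by move=> mf; apply: (measurableT_comp mf); exact: measurable_rV_consP.
Qed.

Lemma ge0_integral_rV_cons n (f : 'rV[R]_n.+1 -> \bar R) :
  measurable_fun setT f -> (forall x, 0 <= f x) ->
  \int[lam n.+1]_v f v = \int[mu]_t \int[lam n]_y f (rV_cons (t, y)).
Proof.
move=> mf f0.
transitivity (\int[pushforward (mu \x lam n) (@rV_cons R n)]_v f v) => //.
rewrite ge0_integral_pushforward//; last exact: measurable_rV_cons.
rewrite preimage_setT.
apply: (@fubini_tonelli1 _ _ _ _ _ mu (lam n) (fun p => f (rV_cons p))).
  exact: (measurableT_comp mf (@measurable_rV_cons _ _)).
by move=> x; exact: f0.
Qed.

Lemma ge0_integral_rV_consC n (f : 'rV[R]_n.+1 -> \bar R) :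
  measurable_fun setT f -> (forall x, 0 <= f x) ->
  \int[lam n.+1]_v f v = \int[lam n]_y \int[mu]_t f (rV_cons (t, y)).
Proof.
move=> mf f0; rewrite ge0_integral_rV_cons//.
apply: (@fubini_tonelli _ _ _ _ _ mu (lam n) (fun p => f (rV_cons p))).
  exact: (measurableT_comp mf (@measurable_rV_cons _ _)).
by move=> x; exact: f0.
Qed.

(** Induction on the dimension: the one-dimensional substitution in the first coordinate yields one
    factor [r], the induction hypothesis the others. *)
Lemma ge0_integral_rV_affine n (r : R) (c : 'rV[R]_n) (f : 'rV[R]_n -> \bar R) :
  (0 < r)%R -> measurable_fun setT f -> (forall x, 0 <= f x) ->
  \int[lam n]_x f x = (r ^+ n)%:E * \int[lam n]_x f (r *: x + c)%R.
Proof.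
move=> r0; elim: n c f => [c f mf f0|n IH c f mf f0].
  rewrite expr0 mul1e; apply: eq_integral => x _; congr f.
  by apply/rowP => -[].
have mfr : measurable_fun setT (fun x : 'rV[R]_n.+1 => f (r *: x + c)%R).
  by apply: (measurableT_comp mf); apply: measurable_rVD => //; exact: measurable_rVZ.
rewrite (ge0_integral_rV_cons mf f0) (ge0_integral_rV_cons mfr)//.
have [c0 cE] : exists c0, c = rV_cons (c0.1, c0.2).
  by exists (rV_uncons c); rewrite -surjective_pairing rV_unconsK.
have mF : measurable_fun setT (fun t => \int[lam n]_y f (rV_cons (t, y))).
  apply: (@measurable_fun_fubini_tonelli_F _ _ _ _ _ (lam n) (fun p => f (rV_cons p))).
    exact: (measurableT_comp mf (@measurable_rV_cons _ _)).
  by move=> x; exact: f0.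
rewrite (@ge0_integral_affine _ r c0.1 r0)//; last first.
  by move=> t; exact: integral_ge0.
rewrite exprS EFinM -muleA; congr (_ * _).
rewrite -ge0_integralZl//; last 3 first.
- apply: (@measurable_fun_fubini_tonelli_F _ _ _ _ _ (lam n)
    (fun p => f (r *: rV_cons p + c)%R)).
    exact: (measurableT_comp mfr (@measurable_rV_cons _ _)).
  by move=> x; exact: f0.
- by move=> t _; exact: integral_ge0.
- by rewrite lee_fin exprn_ge0// ltW.
apply: eq_integral => t _.
rewrite (IH c0.2)//; last exact: measurable_rV_section.
by congr (_ * _); apply: eq_integral => y _; rewrite rV_consD rV_consZ -cE.
Qed.

Lemma ge0_integral_rV_shift n (c : 'rV[R]_n) (f : 'rV[R]_n -> \bar R) :
  measurable_fun setT f -> (forall x, 0 <= f x) ->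
  \int[lam n]_x f x = \int[lam n]_x f (x + c)%R.
Proof.
move=> mf f0; rewrite (ge0_integral_rV_affine (r := 1) c)// expr1n mul1e.
by apply: eq_integral => x _; rewrite scale1r.
Qed.

End lebesgue_rV_lemmas.

(** * Oscillatory integrals over round convex sets *)

Section oscillation_line.
Context {R : realType}.
Local Notation mu := (@lebesgue_measure R).
Local Notation integ f := (mu.-integrable setT (EFin \o f)).

(** Applied to the positive and the negative part separately, so that it also covers functions that
    are not integrable. *)
Lemma integral_shift (c : R) (f : R -> \bar R) : measurable_fun setT f ->
  (\int[mu]_x f (x + c)%R = \int[mu]_x f x)%E.
Proof.
have ge0 (g : R -> \bar R) : measurable_fun setT g -> (forall x, 0 <= g x)%E ->
    (\int[mu]_x g (x + c)%R = \int[mu]_x g x)%E.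
  move=> mg g0; rewrite (ge0_integral_affine c ltr01 mg)// mul1e.
  by apply: eq_integral => x _; rewrite mul1r.
move=> mf; rewrite integralE [in RHS]integralE.
congr (_ - _)%E.
- have h : measurable_fun setT (f^\+)%E by exact: measurable_funepos.
  by rewrite -(ge0 _ h (funepos_ge0 f)); apply: eq_integral => x _; rewrite !funeposE.
- have h : measurable_fun setT (f^\-)%E by exact: measurable_funeneg.
  by rewrite -(ge0 _ h (funeneg_ge0 f)); apply: eq_integral => x _; rewrite !funenegE.
Qed.

Lemma integrable_shift (c : R) (f : R -> R) :
  integ f -> integ (fun x => f (x + c)).
Proof.
move=> /integrableP[mf foo]; apply/integrableP; split.
  by apply: (measurableT_comp mf); exact: measurable_funD.
rewrite (integral_shift c (f := fun x => `|(f x)%:E|%E))//.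
exact: measurableT_comp.
Qed.

Lemma Rintegral_shift (c : R) (f : R -> R) : measurable_fun setT f ->
  \int[mu]_x f (x + c) = \int[mu]_x f x.
Proof.
move=> mf; congr fine; apply: (integral_shift c (f := EFin \o f)).
exact/measurable_EFinP.
Qed.

Lemma integrable_cosM (k g : R) (f : R -> R) :
  integ f -> integ (fun x => cos (k * x + g) * f x).
Proof.
move=> intf; have /integrableP[/measurable_EFinP mf _] := intf.
apply: le_integrable intf => //.
  apply/measurable_EFinP; apply: measurable_funM => //.
  apply: continuous_measurable_fun => x.
  apply: (@continuous_comp _ _ _ (fun x => k * x + g) cos).
    by apply: cvgD; [apply: cvgM; [exact: cvg_cst|exact: cvg_id]|exact: cvg_cst].
  exact: continuous_cos.
move=> x _ /=; rewrite lee_fin normrM ler_piMl//.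
by rewrite ler_norml cos_geN1 cos_le1.
Qed.

Lemma Rintegral_segment_indic (x w : R) : 0 <= w ->
  integ (\1_`[(x - w), (x + w)] : R -> R) /\
  \int[mu]_t (\1_`[(x - w), (x + w)] t) = 2 * w.
Proof.
move=> w0; have fin : mu `[(x - w), (x + w)]%classic = (2 * w)%:E.
  rewrite lebesgue_measure_itv/= lte_fin.
  case: ltP => h; last by rewrite (_ : w = 0) ?mulr0//; lra.
  by rewrite -EFinB; congr EFin; lra.
split.
  apply/integrableP; split; first exact/measurable_EFinP/measurable_indic.
  under eq_integral do rewrite gee0_abs ?lee_fin//.
  by rewrite integral_indic// setIT [ltLHS]fin ltry.
by rewrite /Rintegral integral_indic// setIT; exact: (congr1 fine fin).
Qed.

Section chord.
Variables (k w g e dl : R) (l : R -> R) (S : set R).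
Hypotheses (w0 : 0 < w) (e0 : 0 <= e) (cosw : forall x : R, cos (x + k * w) = - cos x).
Hypotheses (intl : integ l) (Sitv : is_interval S).
Hypotheses (l0 : forall t, 0 <= l t) (lS : forall t, ~ S t -> l t = 0).
Hypotheses (lconc : forall t, S (t - w) -> S (t + w) ->
  l (t - w) + l (t + w) <= 2 * l t).
Hypotheses (lS_near : forall t, e <= l t -> S (t - dl) /\ S (t + dl)).
Hypotheses (dlw : 2 * w <= dl).

(** By [cosw] the step [w] is half a period of the cosine. By [lS_near], chords closer than [dl] to
    an end of [S] are shorter than [e]. *)
Let D t := 2 * l t - l (t - w) - l (t + w).

(* Where both [t - w] and [t + w] lie in [S] the second difference is
   nonnegative by concavity; elsewhere [t] is within [w] of an end of [S]. *)
Let D_lower : exists x y : R, forall t,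
  - D t <= e * (\1_`[(x - 2 * w), (x + 2 * w)] t + \1_`[(y - 2 * w), (y + 2 * w)] t).
Proof.
have [w_gt0 e_ge0 dl_ge] := And3 w0 e0 dlw.
have Sb p q z : S p -> S q -> p <= z -> z <= q -> S z.
  by move=> Sp Sq pz zq; apply: (Sitv Sp Sq); rewrite pz zq.
pose A := [set t : R | S (t + w) /\ ~ S (t - w)].
pose B := [set t : R | S (t - w) /\ ~ S (t + w)].
have [x xP] : exists x : R, forall t, A t -> x - 2 * w <= t <= x + 2 * w.
  have [[x [Ax1 Ax2]]|A0] := pselect (A !=set0); last first.
    by exists 0 => t At; exfalso; apply: A0; exists t.
  exists x => t [At1 At2]; apply/andP; split.
    have [//|h] := lerP (x - 2 * w) t; exfalso.
    have q1 : t + w <= x - w by lra.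
    have q2 : x - w <= x + w by lra.
    by apply: Ax2; exact: (Sb (t + w) (x + w)).
  have [//|h] := lerP t (x + 2 * w); exfalso.
  have q1 : x + w <= t - w by lra.
  have q2 : t - w <= t + w by lra.
  by apply: At2; exact: (Sb (x + w) (t + w)).
have [y yP] : exists x : R, forall t, B t -> x - 2 * w <= t <= x + 2 * w.
  have [[z [Ax1 Ax2]]|A0] := pselect (B !=set0); last first.
    by exists 0 => t At; exfalso; apply: A0; exists t.
  exists z => t [At1 At2]; apply/andP; split.
    have [//|h] := lerP (z - 2 * w) t; exfalso.
    have q1 : t - w <= t + w by lra.
    have q2 : t + w <= z - w by lra.
    by apply: At2; exact: (Sb (t - w) (z - w)).
  have [//|h] := lerP t (z + 2 * w); exfalso.
  have q1 : z - w <= z + w by lra.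
  have q2 : z + w <= t - w by lra.
  by apply: Ax2; exact: (Sb (z - w) (t - w)).
exists x, y => t; rewrite /D.
have ind0 (z : R) : 0 <= \1_`[(z - 2 * w), (z + 2 * w)] t :> R by [].
have nn : 0 <= e * (\1_`[(x - 2 * w), (x + 2 * w)] t + \1_`[(y - 2 * w), (y + 2 * w)] t).
  by rewrite mulr_ge0// addr_ge0.
have lt0 := l0 t.
have [Sm|Sm] := pselect (S (t - w)); have [Sp|Sp] := pselect (S (t + w)).
- by have := lconc Sm Sp; lra.
- have le : l (t - w) <= e.
    have [//|/ltW /lS_near[_ h]] := lerP (l (t - w)) e; exfalso; apply: Sp.
    have q1 : t - w <= t + w by lra.
    have q2 : t + w <= t - w + dl by lra.
    by exact: (Sb (t - w) (t - w + dl)).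
  have yt : \1_`[(y - 2 * w), (y + 2 * w)] t = 1 :> R.
    by rewrite indicE mem_set//= in_itv/=; apply: yP.
  rewrite yt (lS Sp); apply: (@le_trans _ _ (e * 1)); first lra.
  by rewrite ler_wpM2l// lerDr.
- have le : l (t + w) <= e.
    have [//|/ltW /lS_near[h _]] := lerP (l (t + w)) e; exfalso; apply: Sm.
    have q1 : t + w - dl <= t - w by lra.
    have q2 : t - w <= t + w by lra.
    by exact: (Sb (t + w - dl) (t + w)).
  have xt : \1_`[(x - 2 * w), (x + 2 * w)] t = 1 :> R.
    by rewrite indicE mem_set//= in_itv/=; apply: xP.
  rewrite xt (lS Sm); apply: (@le_trans _ _ (e * 1)); first lra.
  by rewrite ler_wpM2l// lerDl.
- by rewrite (lS Sm) (lS Sp); lra.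
Qed.

(** Shifting by half a period flips the sign of the cosine, so its integral against the second
    difference [D] is four times its integral against [l]. As [D] integrates to 0, the integral of
    its absolute value is twice that of its negative part, which [D_lower] bounds by [e] on each of
    two intervals of length [4 * w]: in all [16 * (w * e)], to be divided by 4. *)
Lemma oscillation_chord : `|\int[mu]_t (cos (k * t + g) * l t)| <= 4 * (w * e).
Proof.
have [x [y xyP]] := D_lower.
have [w_gt0 e_ge0] := conj w0 e0.
have intlm : integ (fun t => l (t - w)) by exact: (@integrable_shift (- w)).
have intlp : integ (fun t => l (t + w)) by exact: integrable_shift.
have /integrableP[/measurable_EFinP ml _] := intl.
have mT := @measurableT _ (measurableTypeR R).
have int2l : integ (fun t => 2 * l t) by exact: integrable_scale.
have int2lm : integ (fun t => 2 * l t - l (t - w)) by exact: integrable_sub.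
have intD : integ D by exact: integrable_sub.
have cosE t : cos (k * t + g) = - cos (k * (t - w) + g).
  by rewrite -cosw; congr cos; ring.
set J := Rintegral _ _ _.
have shift c : (forall t, cos (k * t + g) = - cos (k * (t + c) + g)) ->
    \int[mu]_t (cos (k * t + g) * l (t + c)) = - J.
  move=> cc; under eq_Rintegral do rewrite cc mulNr.
  have intc := integrable_cosM k g intl.
  have /integrableP[/measurable_EFinP mc _] := intc.
  rewrite (Rintegral_shift c (f := fun t => - (cos (k * t + g) * l t))); last first.
    exact: measurableT_comp.
  under eq_Rintegral do rewrite -mulN1r.
  by rewrite RintegralZl// mulN1r.
have J4 : \int[mu]_t (cos (k * t + g) * D t) = 4 * J.
  under eq_Rintegral do rewrite /D mulrBr.
  rewrite RintegralB//; [|exact: integrable_cosM..].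
  under [X in X - _]eq_Rintegral do rewrite mulrBr.
  rewrite RintegralB//; [|exact: integrable_cosM..].
  under [X in X - _ - _]eq_Rintegral do rewrite mulrCA.
  rewrite RintegralZl//; last exact: integrable_cosM.
  rewrite -/J shift// shift; first lra.
  move=> t; rewrite (_ : k * (t + w) + g = k * t + g + k * w); last by ring.
  by rewrite cosw opprK.
have [ix eix] := @Rintegral_segment_indic x (2 * w) (ltac:(lra)).
have [iy eiy] := @Rintegral_segment_indic y (2 * w) (ltac:(lra)).
pose G t : R := e * (\1_`[(x - 2 * w), (x + 2 * w)] t + \1_`[(y - 2 * w), (y + 2 * w)] t).
have intG : integ G.
  by apply: integrable_scale => //; exact: integrable_add.
have intGE : \int[mu]_t G t = e * (8 * w).
  rewrite RintegralZl//; last exact: integrable_add.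
  by rewrite RintegralD// eix eiy; congr (_ * _); lra.
have intD0 : \int[mu]_t D t = 0.
  rewrite RintegralB// RintegralB// RintegralZl//.
  by rewrite (@Rintegral_shift (- w))// Rintegral_shift//; lra.
have : `|4 * J| <= \int[mu]_t (D t + 2 * G t).
  rewrite -J4; apply: le_trans (le_normr_Rintegral _ _) _ => //.
    exact: integrable_cosM.
  have int2G : integ (fun t => 2 * G t) by exact: integrable_scale.
  apply: le_Rintegral => //.
  - by apply: integrable_norm; exact: integrable_cosM.
  - exact: integrable_add.
  - move=> t _; rewrite normrM.
    apply: (@le_trans _ _ `|D t|).
      by rewrite ler_piMl// ler_norml cos_geN1 cos_le1.
    have G0 : 0 <= G t by rewrite mulr_ge0// addr_ge0.
    have := xyP t; rewrite -/(G t) => h.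
    by rewrite ler_norml; apply/andP; split; lra.
rewrite RintegralD//; last exact: integrable_scale.
rewrite RintegralZl// intD0 intGE normrM ger0_norm//; nra.
Qed.

End chord.
End oscillation_line.

(** * Chords of a planar convex set *)

Section planar_chord.
Context {R : realType}.
Local Notation mu := (@lebesgue_measure R).
Local Notation integ f := (mu.-integrable setT (EFin \o f)).

Lemma lebesgue_measure_segment (x y : R) : x <= y -> mu `[x, y]%classic = (y - x)%:E.
Proof.
move=> xy; rewrite lebesgue_measure_itv/= lte_fin.
case: ltP => h; first by rewrite -EFinB.
by have -> : y - x = 0 by apply/eqP; rewrite subr_eq0 eq_le h xy.
Qed.

Lemma compact_interval_segment (S : set R) : compact S -> is_interval S -> S !=set0 ->
  exists x y : R, [/\ x <= y, S x, S y & S = `[x, y]%classic].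
Proof.
move=> cS iS S0.
have cid0 : {within S, continuous (@id R)}.
  by apply: continuous_subspaceT => z; exact: cvg_id.
have [x /set_mem Sx xm] := compact_EVT_min S0 cS cid0.
have [y /set_mem Sy ym] := compact_EVT_max S0 cS cid0.
exists x, y; split => //; first exact: (xm y (mem_set Sy)).
apply/seteqP; split => z; rewrite /= in_itv/=.
  by move=> Sz; rewrite (xm z (mem_set Sz)) (ym z (mem_set Sz)).
exact: iS.
Qed.

Lemma lebesgue_measure_compact_interval (S : set R) (x : R) : compact S -> S x ->
  (forall (y z l : R), S y -> S z -> 0 <= l -> l <= 1 -> S (y + l * (z - y))) ->
  exists a b : R, [/\ a <= b, S a, S b & mu S = (b - a)%:E].
Proof.
move=> cS Sx conv.
have iS : is_interval S.
  move=> y z Sy Sz t /andP[yt tz].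
  have [yz|yz] := eqVneq y z.
    by have -> : t = y by apply/eqP; rewrite eq_le yt yz tz.
  have yz' : y < z by rewrite lt_neqAle yz (le_trans yt).
  have -> : t = y + ((t - y) / (z - y)) * (z - y).
    by rewrite divfK; [ring|rewrite subr_eq0 eq_sym].
  apply: conv => //; first by rewrite divr_ge0; lra.
  by rewrite ler_pdivrMr; lra.
have [a [b [ab Sa Sb SE]]] := compact_interval_segment cS iS (ex_intro _ x Sx).
by exists a, b; split => //; rewrite SE; exact: lebesgue_measure_segment.
Qed.

Variables (D : set (R * R)) (M : R).

Definition chord_length (t : R) : R := fine (mu (xsection D t)).

Hypotheses (mD : measurable D) (D_bounded : forall p, D p -> `|p.1| <= M /\ `|p.2| <= M).

Let xsection_sub t : xsection D t `<=` `[(- M), M].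
Proof.
move=> s /xsectionP Dts; have [_] := D_bounded Dts.
by rewrite /= in_itv/= ler_norml.
Qed.

Let xsection_le t : (mu (xsection D t) <= (`|M| *+ 2)%:E)%E.
Proof.
have M0 : 0 <= `|M| by [].
apply: (@le_trans _ _ (mu `[(- `|M|), `|M|]%classic)).
  apply: le_measure; rewrite ?inE//; first exact: measurable_xsection.
  apply: (subset_trans (@xsection_sub t)) => z; rewrite /= !in_itv/= => /andP[h1 h2].
  have := ler_norm M; have := ler_norm (- M); rewrite normrN => h3 h4.
  by apply/andP; split; lra.
rewrite lebesgue_measure_segment; last lra.
by rewrite lee_fin; lra.
Qed.

Lemma chord_lengthE t : (chord_length t)%:E = mu (xsection D t).
Proof.
rewrite fineK// ge0_fin_numE; last exact: measure_ge0.
by apply: le_lt_trans (xsection_le t) _; rewrite ltry.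
Qed.

Lemma chord_length_integrable : integ chord_length.
Proof.
have mc : measurable_fun setT chord_length.
  apply/measurable_EFinP; rewrite (_ : EFin \o chord_length = mu \o xsection D).
    exact: measurable_fun_xsection.
  by apply/funext => t /=; rewrite chord_lengthE.
have [intI _] := @Rintegral_segment_indic R 0 `|M| (normr_ge0 _).
apply: (le_integrable _ _ _ (integrable_scale _ (`|M| *+ 2) intI)) => //.
  exact/measurable_EFinP.
move=> t _ /=; rewrite lee_fin sub0r add0r.
have c0 : 0 <= chord_length t by apply: fine_ge0; exact: measure_ge0.
rewrite (ger0_norm c0) ger0_norm ?mulr_ge0 ?mulrn_wge0//.
have [tM|tM] := boolP (t \in `[(- `|M|), `|M|]%classic).
  rewrite indicE tM mulr1 -lee_fin chord_lengthE; exact: xsection_le.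
rewrite /chord_length (_ : xsection D t = set0) ?measure0 ?mulr_ge0 ?mulrn_wge0//.
rewrite -subset0 => s /xsectionP Dts; have [tM' _] := D_bounded Dts.
move/negP : tM; apply; rewrite inE/= in_itv/=.
rewrite -ler_norml (le_trans tM')//; exact: ler_norm.
Qed.

Variables (k w g e dl : R).
Hypotheses (w0 : 0 < w) (e0 : 0 < e) (cosw : forall x : R, cos (x + k * w) = - cos x).
Hypothesis D_convex : forall (t1 s1 t2 s2 l : R), D (t1, s1) -> D (t2, s2) ->
  0 <= l -> l <= 1 -> D (t1 + l * (t2 - t1), s1 + l * (s2 - s1)).
Hypothesis D_compact : forall t, compact (xsection D t).
Hypothesis D_round : forall t s1 s2, D (t, s1) -> D (t, s2) -> e <= s2 - s1 ->
  D (t - dl, (s1 + s2) / 2) /\ D (t + dl, (s1 + s2) / 2).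
Hypotheses (dlw : 2 * w <= dl).

Let chord t s : D (t, s) ->
  exists a b : R, [/\ a <= b, D (t, a), D (t, b) & chord_length t = b - a].
Proof.
move=> Dts; have [||a [b [ab /xsectionP Da /xsectionP Db mab]]] :=
    @lebesgue_measure_compact_interval (xsection D t) s (@D_compact t).
- exact/xsectionP.
- move=> y z l /xsectionP Dy /xsectionP Dz l0 l1; apply/xsectionP.
  by have := D_convex Dy Dz l0 l1; rewrite subrr mulr0 addr0.
- by exists a, b; split => //; rewrite /chord_length mab.
Qed.

(** Concavity of chord lengths: the midpoint of the lower ends and that of the upper ends of two
    chords lie in [D] and span, by convexity, a segment of the middle chord. The margin [dl] comes
    from [D_round] at the two ends of a chord of length at least [e]. *)
Lemma oscillation_planar :
  `|\int[mu]_t (cos (k * t + g) * chord_length t)| <= 4 * (w * e).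
Proof.
have c0 t : 0 <= chord_length t by apply: fine_ge0; exact: measure_ge0.
have cS t : ~ (exists s, D (t, s)) -> chord_length t = 0.
  move=> nD; rewrite /chord_length (_ : xsection D t = set0) ?measure0//.
  by rewrite -subset0 => s /xsectionP Dts; apply: nD; exists s.
apply: (@oscillation_chord _ k w g e dl chord_length [set t | exists s, D (t, s)]) => //.
- exact: ltW.
- exact: chord_length_integrable.
- move=> x y [s1 D1] [s2 D2] t /andP[xt ty].
  have [xy|xy] := eqVneq x y.
    by exists s1; have -> : t = x by apply/eqP; rewrite eq_le xt xy ty.
  have xy' : x < y by rewrite lt_neqAle xy (le_trans xt).
  have tE : t = x + ((t - x) / (y - x)) * (y - x).
    by rewrite divfK; [ring|rewrite subr_eq0 eq_sym].
  exists (s1 + ((t - x) / (y - x)) * (s2 - s1)); rewrite [X in D (X, _)]tE.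
  apply: D_convex => //; first by rewrite divr_ge0; lra.
  by rewrite ler_pdivrMr; lra.
- move=> t [s1 D1] [s2 D2].
  have [a1 [b1 [ab1 Da1 Db1 ->]]] := chord D1.
  have [a2 [b2 [ab2 Da2 Db2 ->]]] := chord D2.
  have h0 : 0 <= 2^-1 :> R by lra.
  have h1 : 2^-1 <= 1 :> R by lra.
  have tE : t - w + 2^-1 * (t + w - (t - w)) = t by lra.
  have Da := D_convex Da1 Da2 h0 h1; have Db := D_convex Db1 Db2 h0 h1.
  rewrite !tE in Da Db.
  have ab : a1 + 2^-1 * (a2 - a1) <= b1 + 2^-1 * (b2 - b1) by lra.
  have : ((b1 + 2^-1 * (b2 - b1) - (a1 + 2^-1 * (a2 - a1)))%:E <= (chord_length t)%:E)%E.
    rewrite chord_lengthE -lebesgue_measure_segment//.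
    apply: le_measure; rewrite ?inE//; first exact: measurable_xsection.
    move=> s; rewrite /= in_itv/= => /andP[as_ sb]; apply/xsectionP.
    set a := a1 + _ in ab as_ Da *; set b := b1 + _ in ab sb Db *.
    have [eab|nab] := eqVneq a b.
      by have -> : s = a by apply/eqP; rewrite eq_le as_ eab sb.
    have ltab : a < b by rewrite lt_neqAle nab.
    have sE : s = a + ((s - a) / (b - a)) * (b - a).
      by rewrite divfK; [ring|rewrite subr_eq0 eq_sym].
    have l0 : 0 <= (s - a) / (b - a) by rewrite divr_ge0; lra.
    have l1 : (s - a) / (b - a) <= 1 by rewrite ler_pdivrMr; lra.
    by have := D_convex Da Db l0 l1; rewrite -sE subrr mulr0 addr0.
  by rewrite lee_fin; lra.
- move=> t et; have [[s Dts]|nD] := pselect (exists s, D (t, s)); last first.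
    by have := lt_le_trans e0 et; rewrite (cS _ nD) ltxx.
  have [a [b [ab Da Db cE]]] := chord Dts.
  rewrite cE in et; have [D1 D2] := D_round Da Db et.
  by split; exists ((a + b) / 2).
Qed.

End planar_chord.

(** * Fubini along an arbitrary coordinate and along sheared lines *)

Section coordinate_insertion.
Context {R : realType}.
Local Notation mu := (@lebesgue_measure R).
Local Notation lam := (@lebesgue_rV R).

(** The measure [lebesgue_rV] peels off the first coordinate, but a frequency vector may be nonzero
    only at another one; insertion at position [i] gives access to that coordinate. *)
Definition rV_insert n (i : 'I_n.+1) (t : R) (y : 'rV[R]_n) : 'rV[R]_n.+1 :=
  \row_j oapp (fun k => y ord0 k) t (unlift i j).

Lemma rV_insertE n (i : 'I_n.+1) t (y : 'rV[R]_n) : rV_insert i t y ord0 i = t.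
Proof. by rewrite mxE unlift_none. Qed.

Lemma rV_insert_lift n (i : 'I_n.+1) t (y : 'rV[R]_n) k :
  rV_insert i t y ord0 (lift i k) = y ord0 k.
Proof. by rewrite mxE liftK. Qed.

Lemma rV_insert0 n t (y : 'rV[R]_n) : rV_insert ord0 t y = rV_cons (t, y).
Proof.
apply/rowP => j; case: (unliftP ord0 j) => [k ->|->].
  by rewrite rV_insert_lift rV_consS.
by rewrite rV_insertE rV_cons0.
Qed.

Lemma rV_insert_cons n (i : 'I_n.+1) t s (y : 'rV[R]_n) :
  rV_insert (lift ord0 i) t (rV_cons (s, y)) = rV_cons (s, rV_insert i t y).
Proof.
apply/rowP => j; case: (unliftP ord0 j) => [k ->|->]; last first.
  rewrite rV_cons0.
  have -> : ord0 = lift (lift ord0 i) (ord0 : 'I_n.+1) by apply: val_inj.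
  by rewrite rV_insert_lift rV_cons0.
rewrite rV_consS; case: (unliftP i k) => [l ->|->]; last by rewrite !rV_insertE.
rewrite rV_insert_lift.
have -> : lift ord0 (lift i l) = lift (lift ord0 i) (lift ord0 l).
  by apply: val_inj; rewrite /= /bump !leq0n !add1n ltnS addnS.
by rewrite rV_insert_lift rV_consS.
Qed.

Lemma measurable_rV_insert d (T : measurableType d) n (i : 'I_n.+1)
    (f : T -> R) (g : T -> 'rV[R]_n) :
  measurable_fun setT f -> measurable_fun setT g ->
  measurable_fun setT (fun x => rV_insert i (f x) (g x)).
Proof.
move=> mf mg; apply: measurable_fun_coordP => j; case: (unliftP i j) => [k ->|->].
  by under eq_fun do rewrite rV_insert_lift; exact: measurable_rV_comp.
by under eq_fun do rewrite rV_insertE.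
Qed.

Local Open Scope ereal_scope.

(** Induction on the dimension: the first coordinate is peeled off, the inserted one is brought out
    of the rest, and the two one-dimensional integrals are exchanged. *)
Lemma ge0_integral_rV_insert n (i : 'I_n.+1) (f : 'rV[R]_n.+1 -> \bar R) :
  measurable_fun setT f -> (forall x, 0 <= f x) ->
  \int[lam n.+1]_v f v = \int[mu]_t \int[lam n]_y f (rV_insert i t y).
Proof.
elim: n i f => [|n IH] i f mf f0.
  rewrite (ge0_integral_rV_cons mf f0); apply: eq_integral => t _.
  by apply: eq_integral => y _; rewrite (ord1 i) rV_insert0.
case: (unliftP ord0 i) => [k ->|->]; last first.
  rewrite (ge0_integral_rV_cons mf f0); apply: eq_integral => t _.
  by apply: eq_integral => y _; rewrite rV_insert0.
rewrite (ge0_integral_rV_cons mf f0).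
transitivity (\int[mu]_s \int[mu]_t \int[lam n]_z f (rV_cons (s, rV_insert k t z))).
  by apply: eq_integral => s _; rewrite (IH k)//; exact: measurable_rV_section.
have m3 : measurable_fun setT (fun p : (R * R) * 'rV[R]_n =>
    f (rV_cons (p.1.1, rV_insert k p.1.2 p.2))).
  apply: (measurableT_comp mf); apply: measurable_rV_consP.
    exact: measurableT_comp.
  by apply: measurable_rV_insert => //; exact: measurableT_comp.
rewrite (@fubini_tonelli _ _ _ _ _ mu mu (fun p : R * R =>
  \int[lam n]_z f (rV_cons (p.1, rV_insert k p.2 z)))); last 2 first.
- exact: (@measurable_fun_fubini_tonelli_F _ _ _ _ _ (lam n) _ m3 (fun x => f0 _)).
- by move=> p; exact: integral_ge0.
apply: eq_integral => t _.
have mt : measurable_fun setT (fun y => f (rV_insert (lift ord0 k) t y)).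
  by apply: (measurableT_comp mf); exact: measurable_rV_insert.
rewrite (ge0_integral_rV_cons mt) => [|x]; last exact: f0.
by apply: eq_integral => s _; apply: eq_integral => z _; rewrite rV_insert_cons.
Qed.

(* Points are listed along lines of direction [e_j - c e_i], [e_j] being the
   first coordinate left after removing [e_i]. *)
Definition shear_point n (i : 'I_n.+2) (c t s : R) (z : 'rV[R]_n) : 'rV[R]_n.+2 :=
  rV_insert i (t - c * s)%R (rV_cons (s, z)).

Lemma measurable_shear_point d (T : measurableType d) n (i : 'I_n.+2) (c : R)
    (f g : T -> R) (h : T -> 'rV[R]_n) :
  measurable_fun setT f -> measurable_fun setT g -> measurable_fun setT h ->
  measurable_fun setT (fun x => shear_point i c (f x) (g x) (h x)).
Proof.
move=> mf mg mh; apply: measurable_rV_insert; last exact: measurable_rV_consP.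
by apply: measurable_funB => //; exact: measurable_funM.
Qed.

(** For fixed [s] and [z] the shear is a translation in [t], under which Lebesgue measure is
    invariant. *)
Lemma ge0_integral_shear n (i : 'I_n.+2) (c : R) (f : 'rV[R]_n.+2 -> \bar R) :
  measurable_fun setT f -> (forall x, 0 <= f x) ->
  \int[lam n.+2]_v f v =
  \int[lam n]_z \int[mu]_t \int[mu]_s f (shear_point i c t s z).
Proof.
move=> mf f0; rewrite (ge0_integral_rV_insert i mf f0).
have mi : measurable_fun setT (fun p : R * 'rV[R]_n.+1 => f (rV_insert i p.1 p.2)).
  by apply: (measurableT_comp mf); exact: measurable_rV_insert.
rewrite (@fubini_tonelli _ _ _ _ _ mu (lam n.+1) (fun p => f (rV_insert i p.1 p.2))
  mi (fun x => f0 _)) /=.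
rewrite (@ge0_integral_rV_consC _ _ (fun y => \int[mu]_x f (rV_insert i x y))); last 2 first.
- exact: (@measurable_fun_fubini_tonelli_G _ _ _ _ _ mu _ mi (fun x => f0 _)).
- by move=> x; exact: integral_ge0.
apply: eq_integral => z _.
have mz : measurable_fun setT (fun p : R * R => f (shear_point i c p.1 p.2 z)).
  by apply: (measurableT_comp mf); exact: measurable_shear_point.
rewrite (@fubini_tonelli _ _ _ _ _ mu mu _ mz (fun x => f0 _)) /=.
apply: eq_integral => s _.
have ms : measurable_fun setT (fun t => f (rV_insert i t (rV_cons (s, z)))).
  by apply: (measurableT_comp mf); exact: measurable_rV_insert.
rewrite (ge0_integral_affine (- (c * s))%R ltr01 ms (fun x => f0 _)) mul1e.
by apply: eq_integral => t _; rewrite mul1r.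
Qed.

Definition rV_box n (M : R) : set 'rV[R]_n := [set z | forall j, (`|z ord0 j| <= M)%R].

Arguments rV_box n M : clear implicits.

Lemma measurable_rV_box n (M : R) : measurable (rV_box n M).
Proof.
rewrite (_ : rV_box n M = \bigcap_(j in [set: 'I_n])
    ((fun v : 'rV[R]_n => v ord0 j) @^-1` `[(- M)%R, M])).
  apply: fin_bigcap_measurable => // j _; rewrite -[X in measurable X]setTI.
  by apply: measurable_coord.
apply/seteqP; split => [v Bv j _|v Bv j]; first by rewrite /= in_itv/= -ler_norml.
by have := Bv j I; rewrite /= in_itv/= -ler_norml.
Qed.

Lemma lebesgue_rV_box n (M : R) : (0 <= M)%R ->
  lam n (rV_box n M) = ((2 * M) ^+ n)%:E.
Proof.
move=> M0.
have mB k := @measurable_rV_box k M.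
elim: n => [|n IH].
  rewrite expr0 (_ : rV_box 0 M = setT) /=; last by apply/seteqP; split => // z _ [].
  by rewrite diracT.
rewrite measure_integral_indic; last exact: mB.
have mi : measurable_fun setT (fun v : 'rV[R]_n.+1 =>
    (\1_(rV_box n.+1 M) v : R)%:E).
  by apply/measurable_EFinP; apply: measurable_indic => //; exact: mB.
rewrite (ge0_integral_rV_cons mi) => [|x]; last by rewrite lee_fin.
transitivity (\int[mu]_t (((2 * M) ^+ n)%:E * (\1_`[(- M)%R, M] t)%:E)); last first.
  rewrite ge0_integralZl//; last 2 first.
  - by apply/measurable_EFinP; apply: measurable_indic.
  - by rewrite lee_fin exprn_ge0// mulr_ge0.
  rewrite -measure_integral_indic// [X in _ * X]lebesgue_measure_segment; last lra.
  by rewrite -EFinM exprSr; congr EFin; congr (_ * _)%R; lra.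
apply: eq_integral => t _ /=; rewrite -IH (measure_integral_indic _ (mB n)).
rewrite muleC -ge0_integralZl//; last by apply/measurable_EFinP; apply: measurable_indic => //; exact: mB.
apply: eq_integral => y _; rewrite -EFinM !indicE -natrM mulnb; congr (((nat_of_bool _) %:R)%:E).
apply/idP/andP => [|[]]; rewrite !inE /= in_itv/= -ler_norml.
  move=> h; split; first by have := h ord0; rewrite rV_cons0.
  by move=> j; have := h (lift ord0 j); rewrite rV_consS.
by move=> tM h j; case: (unliftP ord0 j) => [l ->|->]; rewrite ?rV_consS ?rV_cons0.

Qed.

End coordinate_insertion.

(** * Oscillatory integrals over a round convex body *)

Section oscillation_convex.
Context {R : realType}.
Local Notation mu := (@lebesgue_measure R).
Local Notation lam := (@lebesgue_rV R).

(** Elementary form of [convex_set], with real coefficients instead of the interval type;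
    [convex_set_cvx] converts. *)
Definition cvx n (C : set 'rV[R]_n) :=
  forall x y (l : R), C x -> C y -> 0 <= l -> l <= 1 -> C (x + l *: (y - x)).

Lemma dotvC n (x y : 'rV[R]_n) : dotv x y = dotv y x.
Proof. by apply: eq_bigr => i _; rewrite mulrC. Qed.

Lemma dotvDr n (x y z : 'rV[R]_n) : dotv x (y + z) = dotv x y + dotv x z.
Proof. by rewrite -big_split; apply: eq_bigr => i _; rewrite mxE mulrDr. Qed.

Lemma dotvZr n (x y : 'rV[R]_n) r : dotv x (r *: y) = r * dotv x y.
Proof. by rewrite big_distrr; apply: eq_bigr => i _; rewrite mxE mulrCA. Qed.

Lemma dotvNr n (x y : 'rV[R]_n) : dotv x (- y) = - dotv x y.
Proof. by rewrite -scaleN1r dotvZr mulN1r. Qed.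

Lemma dotvBr n (x y z : 'rV[R]_n) : dotv x (y - z) = dotv x y - dotv x z.
Proof. by rewrite dotvDr dotvNr. Qed.

Lemma dotvDl n (x y z : 'rV[R]_n) : dotv (x + y) z = dotv x z + dotv y z.
Proof. by rewrite !(dotvC _ z) dotvDr. Qed.

Lemma dotvZl n (x y : 'rV[R]_n) r : dotv (r *: x) y = r * dotv x y.
Proof. by rewrite !(dotvC _ y) dotvZr. Qed.

Lemma dotvBl n (x y z : 'rV[R]_n) : dotv (x - y) z = dotv x z - dotv y z.
Proof. by rewrite !(dotvC _ z) dotvBr. Qed.

Lemma dotv_insert n (k : 'rV[R]_n.+1) (i : 'I_n.+1) t (y : 'rV[R]_n) :
  dotv k (rV_insert i t y) = k ord0 i * t + dotv (\row_j k ord0 (lift i j)) y.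
Proof.
rewrite /dotv (bigD1_ord i)//= rV_insertE; congr (_ + _).
by apply: eq_bigr => j _; rewrite rV_insert_lift mxE.
Qed.

Lemma dotv_cons n (k : 'rV[R]_n.+1) t (y : 'rV[R]_n) :
  dotv k (rV_cons (t, y)) = k ord0 ord0 * t + dotv (\row_j k ord0 (lift ord0 j)) y.
Proof. by rewrite -rV_insert0 dotv_insert. Qed.

Lemma shear_point_convex n (i : 'I_n.+2) c t1 s1 t2 s2 (z : 'rV[R]_n) (l : R) :
  shear_point i c t1 s1 z + l *: (shear_point i c t2 s2 z - shear_point i c t1 s1 z) =
  shear_point i c (t1 + l * (t2 - t1)) (s1 + l * (s2 - s1)) z.
Proof.
apply/rowP => j; rewrite !mxE; case: (unlift i j) => [k|] /=; last by ring.
by case: (unliftP ord0 k) => [m ->|->]; rewrite ?rV_consS ?rV_cons0 /=; ring.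
Qed.

Lemma continuous_coords n (T : topologicalType) (f : T -> 'rV[R]_n) (x : T) :
  (forall j, {for x, continuous (fun t => f t ord0 j)}) -> {for x, continuous f}.
Proof.
move=> cf; apply/cvg_ballP => e e0.
have : \forall t \near x, forall j, `|f x ord0 j - f t ord0 j| < e.
  apply: filter_forall => j.
  by have /cvgr_dist_lt/(_ e e0) := cf j.
apply: filterS => t h; rewrite mx_norm_ball /ball_/=.
rewrite -[ltLHS]/(mx_norm _) mx_normrE; apply/bigmax_ltP; split => //= -[j1 j2] _ /=.
by rewrite ord1 !mxE.
Qed.

Lemma continuous_shear_point n (i : 'I_n.+2) c t (z : 'rV[R]_n) :
  continuous (fun s : R => shear_point i c t s z).
Proof.
move=> s; apply: continuous_coords => j.
case: (unliftP i j) => [k ->|->]; last first.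
  rewrite (_ : (fun _ => _) = (fun s => t - c * s)); last first.
    by apply/funext => s'; rewrite rV_insertE.
  apply: cvgB; first exact: cvg_cst.
  by apply: cvgM; [exact: cvg_cst|exact: cvg_id].
case: (unliftP ord0 k) => [m ->|->].
  rewrite (_ : (fun _ => _) = cst (z ord0 m)); first exact: cvg_cst.
  by apply/funext => s'; rewrite rV_insert_lift rV_consS.
rewrite (_ : (fun _ => _) = id); first exact: cvg_id.
by apply/funext => s'; rewrite rV_insert_lift rV_cons0.
Qed.

Variables (n : nat) (C : set 'rV[R]_n.+2) (k : 'rV[R]_n.+2) (g M e dl : R) (i : 'I_n.+2).
Hypotheses (cC : compact C) (vC : cvx C) (CM : forall x, C x -> `|x| <= M) (M0 : 0 <= M).
Hypotheses (ki : k ord0 i != 0) (e0 : 0 < e).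
Hypothesis round : forall p q u, C p -> C q -> e <= `|p - q| -> `|u| <= dl ->
  C (p + 2^-1 *: (q - p) + u).
Let w := pi / `|k ord0 i|.
Hypothesis dlw : 2 * w <= dl.

(** This slope makes the lines along which [s] runs orthogonal to [k]: only [t] drives the phase,
    with half period [w]. *)
Let c := k ord0 (lift i ord0) / k ord0 i.
Let P t s z := shear_point i c t s z.
Let D z : set (R * R) := [set p | C (P p.1 p.2 z)].
Let k' : 'rV[R]_n := \row_j k ord0 (lift i (lift ord0 j)).
Let ell z := chord_length (D z).
Let M' := M + `|c| * M.

Let w0 : 0 < w.
Proof. by rewrite divr_gt0 ?pi_gt0// normr_gt0. Qed.

Let phase t s z : dotv k (P t s z) = k ord0 i * t + dotv k' z.
Proof.
have e1 := ki; rewrite /P /shear_point dotv_insert dotv_cons !mxE.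
have -> : \row_j (\row_j0 k ord0 (lift i j0)) ord0 (lift ord0 j) = k'.
  by apply/rowP => j; rewrite !mxE.
by rewrite /c; field.
Qed.

Let cosw (x : R) : cos (x + k ord0 i * w) = - cos x.
Proof.
rewrite /w; have [kp|kn] := ltP 0 (k ord0 i).
  by rewrite gtr0_norm// mulrC divfK ?cosDpi// gt_eqF.
rewrite ler0_norm// invrN mulrN mulrN mulrC divfK//.
by rewrite -[RHS]opprK -[in RHS](subrK pi x) cosDpi !opprK.
Qed.

Let coordP t s z : [/\ P t s z ord0 i = t - c * s, P t s z ord0 (lift i ord0) = s
  & forall j, P t s z ord0 (lift i (lift ord0 j)) = z ord0 j].
Proof.
split; first by rewrite rV_insertE.
  by rewrite rV_insert_lift rV_cons0.
by move=> j; rewrite rV_insert_lift rV_consS.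
Qed.

Let D_bounded z p : D z p -> `|p.1| <= M' /\ `|p.2| <= M'.
Proof.
have M0' := M0; move=> /CM CP; have [P1 P2 _] := coordP p.1 p.2 z.
have s0 : `|p.2| <= M by rewrite -[in leLHS]P2; apply: le_trans CP; exact: ler_coord_norm.
have t0 : `|p.1 - c * p.2| <= M.
  by rewrite -[in leLHS]P1; apply: le_trans CP; exact: ler_coord_norm.
have cM : `|c * p.2| <= `|c| * M by rewrite normrM ler_wpM2l.
have c0 : 0 <= `|c| * M by rewrite mulr_ge0.
split; rewrite /M'; last by lra.
rewrite -[p.1](subrK (c * p.2)); apply: le_trans (ler_normD _ _) _; lra.
Qed.

Let mC : measurable C.
Proof. exact: compact_measurable_rV. Qed.

Let mD z : measurable (D z).
Proof.
rewrite -[X in measurable X]setTI.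
have : measurable_fun setT (fun p : R * R => P p.1 p.2 z).
  exact: measurable_shear_point.
by apply.
Qed.

Let D_compact z t : compact (xsection (D z) t).
Proof.
have -> : xsection (D z) t = (fun s => P t s z) @^-1` C.
  by apply/seteqP; split => s; [move=> /xsectionP|move=> h; apply/xsectionP].
apply: (@subclosed_compact _ _ `[(- M'), M']).
- apply: preimage_closed => [s _|]; first exact: continuous_shear_point.
  by apply: compact_closed => //; exact: norm_hausdorff.
- exact: segment_compact.
- move=> s /= CP; have [_] := @D_bounded z (t, s) CP.
  by rewrite in_itv/= -ler_norml.
Qed.

(** Changing [t] moves a point along coordinate [i] only, and [s] is itself a coordinate; so the
    roundness of [C] in the sup norm passes to the slice with the same [e] and [dl]. *)
Let planar z : `|\int[mu]_t (cos (k ord0 i * t + (dotv k' z + g)) * ell z t)| <= 4 * (w * e).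
Proof.
apply: (@oscillation_planar _ (D z) M' (mD z) (@D_bounded z) _ w _ e dl) => //.
- move=> t1 s1 t2 s2 l D1 D2 l0 l1; rewrite /D/= /P -shear_point_convex.
  exact: vC.
move=> t s1 s2 D1 D2 es.
have [_ P1 _] := coordP t s1 z; have [_ P2 _] := coordP t s2 z.
have ep : e <= `|P t s1 z - P t s2 z|.
  have E12 : s1 - s2 = (P t s1 z - P t s2 z) ord0 (lift i ord0).
    by rewrite -[in LHS]P1 -[in LHS]P2 !mxE.
  have := ler_coord_norm (P t s1 z - P t s2 z) (lift i ord0).
  rewrite -E12 distrC; apply: le_trans; apply: le_trans es _; exact: ler_norm.
have dl0 : 0 <= dl by have := w0; have := dlw; lra.
have key u : `|u| <= dl -> D z (t + u, (s1 + s2) / 2).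
  move=> ud; have := @round _ _ (rV_insert i u 0) D1 D2 ep.
  have nu : `|rV_insert i u (0 : 'rV[R]_n.+1)| <= dl.
    apply: ler_norm_rV => // j; rewrite mxE.
    by case: (unlift i j) => [j'|] //=; rewrite mxE normr0.
  move=> /(_ nu); rewrite /P shear_point_convex /D /= /P; congr C.
  apply/rowP => j; rewrite !mxE; case: (unlift i j) => [j'|] /=; last by field.
  case: (unliftP ord0 j') => [m ->|->]; rewrite ?rV_consS ?rV_cons0 /=.
    by rewrite mxE addr0.
  by rewrite mxE; field.
by split; apply: key; rewrite ?normrN ger0_norm.
Qed.

Let box := @rV_box R n M.

Let ell_box z t : ~ box z -> ell z t = 0.
Proof.
move=> nz; rewrite /ell /chord_length (_ : xsection _ _ = set0) ?measure0//.
rewrite -subset0 => s /xsectionP Dts; apply: nz => j.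
have [_ _ <-] := coordP t s z.
by apply: le_trans (CM Dts); exact: ler_coord_norm.
Qed.

(** The added 1 makes the integrand nonnegative, as Tonelli's theorem asks; the oscillating integral
    is recovered at the end by subtracting the volume of [C]. *)
Let F (v : 'rV[R]_n.+2) : R := (1 + cos (dotv k v + g)) * \1_C v.

Let cosge (x : R) : 0 <= 1 + cos x.
Proof. by have := cos_geN1 x; lra. Qed.

Let F0 v : 0 <= F v.
Proof. by rewrite mulr_ge0. Qed.

Let mcos : measurable_fun setT (fun v : 'rV[R]_n.+2 => cos (dotv k v + g)).
Proof.
apply: (@measurableT_comp _ _ _ _ _ _ (@cos R)).
  by apply: continuous_measurable_fun; exact: continuous_cos.
by apply: measurable_funD => //; exact: measurable_dotv.
Qed.

Let mF : measurable_fun setT F.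
Proof.
apply: measurable_funM; last exact: measurable_indic.
exact: measurable_funD.
Qed.

Let box_fin : lam n box = ((2 * M) ^+ n)%:E.
Proof. exact: lebesgue_rV_box. Qed.

Let mbox : measurable box.
Proof. exact: measurable_rV_box. Qed.

Local Open Scope ereal_scope.

Let a z := \int[mu]_t ((1 + cos (k ord0 i * t + (dotv k' z + g))) * ell z t)%:E.
Let b z := \int[mu]_t (ell z t)%:E.

Let ell0 z t : (0 <= ell z t)%R.
Proof. by apply: fine_ge0; exact: measure_ge0. Qed.

Let intell z : mu.-integrable setT (EFin \o ell z).
Proof. exact: chord_length_integrable (mD z) (@D_bounded z). Qed.

Let ellE z t : (ell z t)%:E = \int[mu]_s (\1_(xsection (D z) t) s)%:E.
Proof.
rewrite /ell (chord_lengthE (mD z) (@D_bounded z)).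
by apply: measure_integral_indic; exact: (measurable_xsection t (mD z)).
Qed.

Let mshear (f : 'rV[R]_n.+2 -> \bar R) : measurable_fun setT f -> (forall v, 0 <= f v) ->
  measurable_fun setT (fun z => \int[mu]_t \int[mu]_s f (P t s z)).
Proof.
move=> mf f0.
have m3 : measurable_fun setT (fun p : ('rV[R]_n * R) * R => f (P p.1.2 p.2 p.1.1)).
  apply: (measurableT_comp mf); apply: measurable_shear_point => //.
    exact: measurableT_comp.
  exact: measurableT_comp.
have m2 := @measurable_fun_fubini_tonelli_F _ _ _ _ _ mu _ m3 (fun x => f0 _).
apply: (@measurable_fun_fubini_tonelli_F _ _ _ _ _ mu _ m2) => p.
exact: integral_ge0.
Qed.

Let aE z : a z = \int[mu]_t \int[mu]_s (F (P t s z))%:E.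
Proof.
apply: eq_integral => t _.
rewrite EFinM ellE.
rewrite -ge0_integralZl//; last first.
  by apply/measurable_EFinP; apply: measurable_indic; exact: (measurable_xsection t (mD z)).
apply: eq_integral => s _; rewrite /F -EFinM; congr (_ * _)%:E.
  by rewrite -/(P t s z) phase addrA.
rewrite !indicE; congr ((nat_of_bool _)%:R)%R.
by apply/idP/idP; rewrite !inE; [move=> /xsectionP|move=> h; apply/xsectionP].
Qed.

Let bE z : b z = \int[mu]_t \int[mu]_s (\1_C (P t s z))%:E.
Proof.
apply: eq_integral => t _.
rewrite ellE.
apply: eq_integral => s _; congr (_ %:E).
rewrite !indicE; congr ((nat_of_bool _)%:R)%R.
by apply/idP/idP; rewrite !inE; [move=> /xsectionP|move=> h; apply/xsectionP].
Qed.

Let mFE : measurable_fun setT (EFin \o F).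
Proof. exact/measurable_EFinP. Qed.

Let mCE : measurable_fun setT (EFin \o (\1_C : 'rV[R]_n.+2 -> R)).
Proof. by apply/measurable_EFinP; exact: measurable_indic. Qed.

Let intF : \int[lam n.+2]_v (F v)%:E = \int[lam n]_z a z.
Proof.
rewrite (ge0_integral_shear i c mFE) => [|v]; last by rewrite lee_fin.
by apply: eq_integral => z _; rewrite aE.
Qed.

Let intC : lam n.+2 C = \int[lam n]_z b z.
Proof.
rewrite (measure_integral_indic _ mC) (ge0_integral_shear i c mCE) => [|v].
  by apply: eq_integral => z _; rewrite bE.
by rewrite lee_fin.
Qed.

Let ma : measurable_fun setT a.
Proof.
by rewrite (funext aE); apply: (mshear mFE) => v; rewrite lee_fin.
Qed.

Let mb : measurable_fun setT b.
Proof.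
by rewrite (funext bE); apply: (mshear mCE) => v; rewrite lee_fin.
Qed.

Let a0 z : 0 <= a z.
Proof. by apply: integral_ge0 => t _; rewrite lee_fin mulr_ge0. Qed.

Let b0 z : 0 <= b z.
Proof. by apply: integral_ge0 => t _; rewrite lee_fin. Qed.

Let E := (4 * (w * e))%R.

Let E0 : (0 <= E)%R.
Proof. by apply: mulr_ge0 => //; apply: mulr_ge0; apply: ltW. Qed.

(** Off the box both integrals vanish, so the planar error is paid only over a set of volume
    [(2 * M) ^+ n]. *)
Let ab z : a z <= b z + (E * \1_box z)%:E /\ b z <= a z + (E * \1_box z)%:E.
Proof.
have mT := @measurableT _ (measurableTypeR R).
have intz := @intell z.
have intc := integrable_cosM (k ord0 i) (dotv k' z + g)%R intz.
have aD : a z = b z + \int[mu]_t (cos (k ord0 i * t + (dotv k' z + g)) * ell z t)%:E.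
  rewrite /a /b -integralD//.
  by apply: eq_integral => t _; rewrite -EFinD mulrDl mul1r.
have [zb|zb] := pselect (box z).
  rewrite indicE mem_set// mulr1.
  have := planar z; rewrite -/E -lee_fin EFin_normr_Rintegral//.
  have fb : b z \is a fin_num by apply: integrable_fin_num.
  have fc : \int[mu]_t (cos (k ord0 i * t + (dotv k' z + g)) * ell z t)%:E \is a fin_num.
    by apply: integrable_fin_num.
  rewrite aD; move: fb fc => /fineK <- /fineK <-.
  rewrite -!EFinD !lee_fin ler_norml => /andP[h1 h2]; split; lra.
have -> : b z = 0 by rewrite /b integral0_eq// => t _; rewrite ell_box.
have -> : a z = 0 by rewrite /a integral0_eq// => t _; rewrite ell_box// mulr0.
by rewrite add0e lee_fin mulr_ge0.
Qed.

Let intE : \int[lam n]_z (E * \1_box z)%:E = (E * (2 * M) ^+ n)%:E.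
Proof.
under eq_integral do rewrite EFinM.
rewrite ge0_integralZl//; last first.
  by apply/measurable_EFinP; exact: measurable_indic.
by rewrite -measure_integral_indic// [X in _ * X]box_fin.
Qed.

Let mbE : measurable_fun setT (fun z : 'rV[R]_n => (E * \1_box z)%:E).
Proof. by apply/measurable_EFinP; apply: measurable_funM => //; exact: measurable_indic. Qed.

Let bE0 z : 0 <= (E * \1_box z)%:E.
Proof. by rewrite lee_fin mulr_ge0. Qed.

Let C_fin : lam n.+2 C \is a fin_num.
Proof.
rewrite ge0_fin_numE ?measure_ge0//.
apply: (@le_lt_trans _ _ ((2 * M) ^+ n.+2)%:E); last by rewrite ltry.
rewrite -(@lebesgue_rV_box _ n.+2 _ M0); apply: le_measure; rewrite ?inE//.
  exact: measurable_rV_box.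
by move=> v Cv j; apply: le_trans (CM Cv); exact: ler_coord_norm.
Qed.

Let FC : \int[lam n.+2]_v (F v)%:E <= lam n.+2 C + (E * (2 * M) ^+ n)%:E /\
  lam n.+2 C <= \int[lam n.+2]_v (F v)%:E + (E * (2 * M) ^+ n)%:E.
Proof.
rewrite intF intC -intE -!ge0_integralD//.
split; (apply: ge0_le_integral => //; [exact: emeasurable_funD|]).
- by move=> z _; have [] := ab z.
- by move=> z _; have [] := ab z.
Qed.

Lemma oscillation_convex :
  (`|\int[lam n.+2]_(v in C) cos (dotv k v + g)| <= 4 * (pi / `|k ord0 i| * e) * (2 * M) ^+ n)%R.
Proof.
have intC1 : (lam n.+2).-integrable setT (EFin \o (\1_C : 'rV[R]_n.+2 -> R)).
  apply/integrableP; split => //.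
  under eq_integral do rewrite /= ger0_norm//.
  by rewrite -measure_integral_indic// -ge0_fin_numE ?measure_ge0.
have intF1 : (lam n.+2).-integrable setT (EFin \o F).
  apply: (le_integrable _ _ _ (integrable_scale measurableT 2 intC1)) => //.
  move=> v _; rewrite lee_fin !ger0_norm ?mulr_ge0//.
  by rewrite ler_wpM2r//; have := cos_le1 (dotv k v + g); lra.
have -> : (\int[lam n.+2]_(v in C) cos (dotv k v + g) =
    fine (\int[lam n.+2]_v (F v)%:E) - fine (lam n.+2 C))%R.
  rewrite (measure_integral_indic _ mC).
  rewrite -[RHS]/(\int[lam n.+2]_v F v - \int[lam n.+2]_v \1_C v)%R -RintegralB//.
  rewrite Rintegral_mkcond; apply: eq_Rintegral => v _.
  rewrite patchE /F indicE; case: (v \in C) => /=; last by rewrite mulr0 subr0.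
  by rewrite mulr1 addrAC subrr add0r.
have [] := FC; have fF : \int[lam n.+2]_v (F v)%:E \is a fin_num.
  by apply: integrable_fin_num.
rewrite -(fineK C_fin) -(fineK fF) -!EFinD !lee_fin -/w -/E => h1 h2.
rewrite ler_norml; apply/andP; split; lra.
Qed.

End oscillation_convex.

(** * Convex bodies without segments in the boundary *)

Section convex_bodies.
Context {R : realType}.

Lemma cvg_dotv n (T : Type) (F : set_system T) {FF : Filter F} (f g : T -> 'rV[R]_n) x y :
  f @ F --> x -> g @ F --> y -> (fun t => dotv (f t) (g t)) @ F --> dotv x y.
Proof.
move=> fx gy; rewrite /dotv; apply: cvg_big => [|i _]; first exact: add_continuous.
have c z := @coord_continuous R 1 n ord0 i z.
by apply: cvgM; [exact: (cvg_comp _ _ fx (c x))|exact: (cvg_comp _ _ gy (c y))].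
Qed.

Lemma continuous_dotv n (T : topologicalType) (f g : T -> 'rV[R]_n) (x : T) :
  {for x, continuous f} -> {for x, continuous g} ->
  {for x, continuous (fun t => dotv (f t) (g t))}.
Proof. by move=> fx gx; exact: (cvg_dotv (F := nbhs x) fx gx). Qed.

Lemma continuous_dotvl n (x : 'rV[R]_n) : continuous (dotv x).
Proof.
by move=> y; apply: (@continuous_dotv _ _ (fun=> x) id); [exact: cst_continuous|by move=> A].
Qed.

Lemma dotv_ge0 n (x : 'rV[R]_n) : 0 <= dotv x x.
Proof. by apply: sumr_ge0 => i _; rewrite -expr2 sqr_ge0. Qed.

Lemma dotv_eq0 n (x : 'rV[R]_n) : dotv x x = 0 -> x = 0.
Proof.
move=> /eqP; rewrite psumr_eq0 => [/allP h|i _]; last by rewrite -expr2 sqr_ge0.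
apply/rowP => i; rewrite mxE; have := h i (mem_index_enum _).
by rewrite mulf_eq0 orbb => /eqP.
Qed.

Lemma dotv_gt0 n (x : 'rV[R]_n) : x != 0 -> 0 < dotv x x.
Proof.
by move=> x0; rewrite lt_def dotv_ge0 andbT; apply: contra x0 => /eqP/dotv_eq0 ->.
Qed.

Lemma dotv_unit n (x : 'rV[R]_n) : x != 0 ->
  exists2 r : R, 0 < r & dotv (r *: x) (r *: x) = 1.
Proof.
move=> /dotv_gt0 x0; exists (Num.sqrt (dotv x x))^-1.
  by rewrite invr_gt0 sqrtr_gt0.
rewrite dotvZl dotvZr mulrA -invfM -expr2 sqr_sqrtr ?mulVf ?gt_eqF//.
exact: ltW.
Qed.

Lemma norm_le_dotv n (x : 'rV[R]_n) : `|x| ^+ 2 <= dotv x x.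
Proof.
have [->|x0] := eqVneq x 0; first by rewrite normr0 expr0n/= dotv_ge0.
rewrite -[leLHS]ger0_norm ?sqr_ge0// -(ger0_norm (dotv_ge0 x)).
have [i ->] : exists i, `|x| = `|x ord0 i|.
  have xE : `|x| = mx_norm x by [].
  have [|[j i] h] := @mx_norm_neq0 _ _ _ x; first by rewrite -xE normr_eq0.
  by exists i; rewrite xE h ord1.
rewrite real_normK ?num_real// !ger0_norm ?sqr_ge0 ?dotv_ge0//.
rewrite /dotv (bigD1 i)//= -expr2 lerDl.
by apply: sumr_ge0 => j _; rewrite -expr2 sqr_ge0.
Qed.

Definition sphere n : set 'rV[R]_n := [set x | dotv x x = 1].

Arguments sphere n : clear implicits.

Lemma sphere_compact n : compact (sphere n).
Proof.
apply: bounded_closed_compact.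
  exists 1; split; first exact: num_real.
  move=> M M1 x /= xs; apply: (@le_trans _ _ 1); last exact: ltW.
  by have := norm_le_dotv x; rewrite xs -[leRHS](expr1n _ 2) ler_pXn2r// nnegrE.
rewrite (_ : sphere n = (fun x => dotv x x) @^-1` [set 1])//.
apply: preimage_closed; last exact: closed_eq.
by move=> x _; apply: (@continuous_dotv _ _ id id) => A.
Qed.

(** A Lebesgue number argument: around each point half of the available radius is kept for the
    perturbation [u], and compactness makes this uniform. *)
Lemma compact_sub_open n (A U : set 'rV[R]_n) : compact A -> open U -> A `<=` U ->
  exists2 e : R, 0 < e & forall x u, A x -> `|u| <= e -> U (x + u).
Proof.
move=> cA oU AU.
have := (compact_near_coveringP A).1 cA _ (0 : R)^'+ (fun e x => forall u, `|u| <= e -> U (x + u)).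
have h x : A x -> \forall x' \near x & e \near (0 : R)^'+, forall u, `|u| <= e -> U (x' + u).
  move=> Ax; have /nbhs_ballP[r/= r0 rU] := open_nbhs_nbhs (conj oU (AU _ Ax)).
  have r20 : 0 < r / 2 by lra.
  exists (ball x (r / 2), [set e : R | e < r / 2]) => /=.
    by split; [exact: nbhsx_ballx|exact: nbhs_right_lt].
  move=> [x' e] /= [xx' er] u ue; apply: rU.
  rewrite -ball_normE /ball_/= in xx' *.
  rewrite opprD addrA; apply: le_lt_trans (ler_normB _ _) _.
  have h1 : `|u| < r / 2 by apply: le_lt_trans er.
  lra.
move=> /(_ _ h) near0.
have [e [e0 eU]] : exists e : R, 0 < e /\ (forall x, A x -> forall u, `|u| <= e -> U (x + u)).
  near (0 : R)^'+ => e; exists e; split; first by near: e; exact: nbhs_right_gt.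
  by near: e.
by exists e => // x u Ax; exact: eU.
Unshelve. all: by end_near. Qed.

(** The separating direction is [q - x0], scaled to unit length, for the point [x0] of [K] nearest
    to [q] in the Euclidean norm. *)
Lemma cvx_separation n (K : set 'rV[R]_n) q : compact K -> cvx K -> ~ K q ->
  K !=set0 ->
  exists2 v, sphere n v & forall x, K x -> dotv v x < dotv v q.
Proof.
move=> cK vK nKq K0.
have cq : continuous (fun x : 'rV[R]_n => q - x).
  by move=> x; apply: continuousB; [exact: cst_continuous|move=> A].
have cf : {within K, continuous (fun x => dotv (q - x) (q - x))}.
  by apply: continuous_subspaceT => x; exact: (continuous_dotv (cq x) (cq x)).
have [x0 /set_mem Kx0 x0m] := EVT_min_rV K0 cK cf.
have qx0 : q - x0 != 0.
  by rewrite subr_eq0; apply/eqP => qx; apply: nKq; rewrite qx.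
have [r r0 ru] := dotv_unit qx0.
exists (r *: (q - x0)) => // x Kx; rewrite !dotvZl ltr_pM2l//.
have D0 : 0 < dotv (q - x0) (q - x0) by exact: dotv_gt0.
set D := dotv (q - x0) (q - x0) in D0 *.
set N := dotv (x - x0) (x - x0); set I := dotv (q - x0) (x - x0).
have N0 : 0 <= N by exact: dotv_ge0.
(* Minimality of the distance at [x0], compared with the point at parameter [t] of the segment from
   [x0] to [x] and expanded. *)
have key (t : R) : 0 <= t -> t <= 1 -> 2 * t * I <= t ^+ 2 * N.
  move=> t0 t1; have := x0m _ (mem_set (vK _ _ t Kx0 Kx t0 t1)).
  have -> : q - (x0 + t *: (x - x0)) = (q - x0) - t *: (x - x0) by rewrite opprD addrA.
  rewrite (dotvBl (q - x0) (t *: (x - x0))) (dotvBr (q - x0) (q - x0)).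
  rewrite (dotvBr (t *: (x - x0)) (q - x0)) !dotvZl !dotvZr.
  by rewrite (dotvC (x - x0)) -/D -/N -/I => h; lra.
have I0 : I <= 0.
  rewrite leNgt; apply/negP => I0.
  (* With [I > 0] this choice gives [t * N < 2 * I], against [key] divided by [t]. *)
  have := key (Num.min 1 (I / (N + 1))).
  have NI : 0 < I / (N + 1) by rewrite divr_gt0//; lra.
  set t := Num.min _ _.
  have t0 : 0 < t by rewrite lt_min ltr01.
  have t1 : t <= 1 by rewrite ge_min lexx.
  have tI : t * (N + 1) <= I by rewrite -ler_pdivlMr ?ge_min ?lexx ?orbT//; lra.
  move=> /(_ (ltW t0) t1); nra.
have -> : dotv (q - x0) x = I + dotv (q - x0) x0 by rewrite /I dotvBr; ring.
have -> : dotv (q - x0) q = D + dotv (q - x0) x0 by rewrite /D [in RHS]dotvBr; ring.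
by lra.
Qed.

Section body.
Variables (n : nat) (K : set 'rV[R]_n).
Hypotheses (cK : compact K) (vK : cvx K).

Lemma compact_closed_rV : closed K.
Proof. by apply: compact_closed => //; exact: norm_hausdorff. Qed.

Lemma frontier_sub : frontier K `<=` K.
Proof. by move=> x [+ _]; rewrite -(closure_id K).1//; exact: compact_closed_rV. Qed.

Lemma frontierP x : frontier K x <-> K x /\ ~ K° x.
Proof.
split => [fx|[Kx nx]]; first by split; [exact: frontier_sub|case: fx].
by split => //; exact: subset_closure.
Qed.

Lemma closed_frontier : closed (frontier K).
Proof.
rewrite /frontier setDE; apply: closedI; first exact: closed_closure.
by apply: open_closedC; exact: open_interior.
Qed.

Lemma compact_frontier : compact (frontier K).
Proof.
by apply: subclosed_compact cK _; [exact: closed_frontier|exact: frontier_sub].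
Qed.

Lemma interior_ball x : K° x -> exists2 e : R, 0 < e & forall u, `|u| < e -> K (x + u).
Proof.
move=> /nbhs_ballP[e/= e0 eK]; exists e => // u ue; apply: eK.
by rewrite -ball_normE /ball_/= opprD addrA subrr sub0r normrN.
Qed.

Lemma ball_interior x (e : R) : 0 < e -> (forall u, `|u| < e -> K (x + u)) -> K° x.
Proof.
move=> e0 eK; apply/nbhs_ballP; exists e => //= y.
rewrite -ball_normE /ball_/= => xy; rewrite -(subrK x y) addrC.
by apply: eK; rewrite distrC.
Qed.

(** If no unit vector supported [K] at [p], each [v] would have a point of [K] strictly higher than
    [p]; by compactness of the sphere this persists for all [q] near [p] and all [v] at once. Such a
    [q] cannot be separated from [K], hence lies in it, and [p] would be interior. *)
Lemma supporting_normal p : frontier K p ->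
  exists2 v, sphere n v & forall x, K x -> dotv v x <= dotv v p.
Proof.
move=> /frontierP[Kp nKp]; apply/not_exists2P => H.
have := (compact_near_coveringP _).1 (@sphere_compact n) _ (nbhs p)
  (fun q v => exists2 x, K x & dotv v q < dotv v x).
have h v : sphere n v -> \forall v' \near v & q \near p, exists2 x, K x & dotv v' q < dotv v' x.
  move=> Sv; have [//|/existsNP[x /not_implyP[Kx /negP]]] := H v.
  rewrite -ltNge => vx.
  have c1 : {for (v, p), continuous (fun z : 'rV[R]_n * 'rV[R]_n => dotv z.1 x - dotv z.1 z.2)}.
    have c2 : {for (v, p), continuous (fun z : 'rV[R]_n * 'rV[R]_n => dotv z.1 x)}.
      by apply: continuous_dotv; [exact: cvg_fst|exact: cst_continuous].
    apply: continuousB => //.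
    by apply: continuous_dotv; [exact: cvg_fst|exact: cvg_snd].
  have : \forall z \near (v, p), 0 < dotv z.1 x - dotv z.1 z.2.
    by apply: (cvgr_gt _ c1); rewrite subr_gt0.
  by apply: filterS => z; rewrite subr_gt0 => h; exists x.
move=> /(_ _ h) near_p.
apply: nKp; rewrite /interior/=; apply: filterS near_p => q hq.
apply: contrapT => nKq.
have [v Sv sep] := cvx_separation cK vK nKq (ex_intro _ p Kp).
have [x Kx] := hq v Sv; have := sep x Kx => h1 h2.
by have := lt_trans h1 h2; rewrite ltxx.
Qed.

(** A short step from [x] along [v] itself stays in [K] and raises the functional. *)
Lemma interior_strict v p x : sphere n v -> (forall x, K x -> dotv v x <= dotv v p) ->
  K° x -> dotv v x < dotv v p.
Proof.
move=> Sv sup /interior_ball[e e0 eK].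
have v0 : v != 0.
  by apply/eqP => v0; move: Sv; rewrite /sphere/= v0 /dotv big1 => [/eqP|i _];
   rewrite ?mxE ?mul0r// eq_sym oner_eq0.
have [r [r0 re]] : exists r : R, 0 < r /\ `|r *: v| < e.
  exists (e / (2 * `|v|)); split; first by rewrite divr_gt0// mulr_gt0// normr_gt0.
  rewrite normrZ gtr0_norm ?divr_gt0// ?mulr_gt0 ?normr_gt0//.
  have v1 : `|v| != 0 by rewrite normr_eq0.
  have -> : e / (2 * `|v|) * `|v| = e / 2 by field.
  by lra.
have := sup _ (eK _ re); rewrite dotvDr dotvZr Sv mulr1; lra.
Qed.

(** Shrinking towards [x] by the factor [t] carries a ball of radius [e] about [c] to a ball of
    radius [t * e] inside [K]. *)
Lemma interior_segment x c (t : R) : K x -> K° c -> 0 < t -> t <= 1 ->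
  K° (x + t *: (c - x)).
Proof.
move=> Kx /interior_ball[e e0 eK] t0 t1; apply: (@ball_interior _ (t * e)).
  exact: mulr_gt0.
move=> u ut; have Kc : K (c + t^-1 *: u).
  apply: eK; rewrite normrZ gtr0_norm ?invr_gt0// mulrC ltr_pdivrMr// mulrC//.
have := vK Kx Kc (ltW t0) t1; congr K.
apply/rowP => i; rewrite !mxE; field; exact: lt0r_neq0.
Qed.

Hypothesis strict : forall p q, K p -> K q -> p != q ->
  ~ (forall t : R, 0 <= t -> t <= 1 -> frontier K (p + t *: (q - p))).

(** A functional supporting [K] at a boundary midpoint attains its maximum at both ends too, hence
    on the whole segment, which would then lie in the frontier. *)
Lemma strict_midpoint p q : K p -> K q -> p != q -> K° (p + 2^-1 *: (q - p)).
Proof.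
move=> Kp Kq pq; apply: contrapT => nK.
have h0 : 0 <= 2^-1 :> R by lra.
have h1 : 2^-1 <= 1 :> R by lra.
set m := p + _ in nK.
have Km : K m by exact: vK.
have [v Sv sup] := supporting_normal ((frontierP m).2 (conj Km nK)).
have vm : dotv v m = dotv v p + 2^-1 * (dotv v q - dotv v p).
  by rewrite /m dotvDr dotvZr dotvBr.
have vp := sup _ Kp; have vq := sup _ Kq.
apply: (strict Kp Kq pq) => t t0 t1; apply/frontierP; split; first exact: vK.
move=> /(interior_strict Sv sup); rewrite dotvDr dotvZr dotvBr.
have -> : dotv v q = dotv v p by lra.
by rewrite subrr mulr0 addr0; lra.
Qed.

(** Midpoints of pairs at distance at least [e] form a compact subset of the interior, which leaves
    a uniform margin [dl]. *)
Lemma uniformly_round (e : R) : 0 < e -> exists2 dl : R, 0 < dl &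
  forall p q u, K p -> K q -> e <= `|p - q| -> `|u| <= dl -> K (p + 2^-1 *: (q - p) + u).
Proof.
move=> e0; pose A := (K `*` K) `&` [set z : 'rV[R]_n * 'rV[R]_n | e <= `|z.1 - z.2|].
have cA : compact A.
  apply: compact_closedI; first exact: compact_setX.
  rewrite (_ : mkset _ = (fun z => `|z.1 - z.2|) @^-1` [set x | e <= x])//.
  apply: preimage_closed; last exact: closed_ge.
  move=> z _; apply: cvg_norm; apply: cvgB; [exact: cvg_fst|exact: cvg_snd].
pose mid (z : 'rV[R]_n * 'rV[R]_n) := z.1 + 2^-1 *: (z.2 - z.1).
have cm : compact (mid @` A).
  apply: continuous_compact => //; apply: continuous_subspaceT => z.
  apply: cvgD; first exact: cvg_fst.
  apply: cvgZr; apply: cvgB; [exact: cvg_snd|exact: cvg_fst].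
have [|dl dl0 dlK] := compact_sub_open cm (@open_interior _ K).
  move=> _ [[p q] [[/= Kp Kq] epq]] <-; apply: strict_midpoint => //.
  apply/eqP => /= pq; move: epq; rewrite /= pq subrr normr0 => e0'.
  by have := lt_le_trans e0 e0'; rewrite ltxx.
exists dl => // p q u Kp Kq epq ud; apply: interior_subset.
by apply: (dlK (mid (p, q))) => //; exists (p, q).
Qed.

End body.
End convex_bodies.

Arguments sphere {R} n.

(** * Smooth maps *)

Section gradients.
Context {R : realType}.

(** Fréchet differentiability at [u] with gradient [a], with explicit radii: the form in which the
    estimates for inverse maps handle it. *)
Definition has_grad n (f : 'rV[R]_n -> R) (u a : 'rV[R]_n) :=
  forall e : R, 0 < e -> exists2 dl : R, 0 < dl &
    forall h, `|h| <= dl -> `|f (u + h) - f u - dotv a h| <= e * `|h|.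

Lemma continuous_rVP n (W : normedModType R) (f : 'rV[R]_n -> W) u :
  {for u, continuous f} <-> forall e : R, 0 < e -> exists2 dl : R, 0 < dl &
    forall h, `|h| <= dl -> `|f (u + h) - f u| <= e.
Proof.
split=> [/(@cvgrPdist_le _ _ _ (nbhs u) _ f (f u)) H e e0|H].
  have /nbhs_ballP[r/= r0 rU] := H e e0; exists (r / 2); first by lra.
  move=> h hr; rewrite distrC; apply: rU; rewrite -ball_normE /ball_/=.
  by rewrite opprD addrA subrr sub0r normrN; lra.
apply/(@cvgrPdist_le _ _ _ (nbhs u) _ f (f u)) => e e0; have [dl dl0 dH] := H e e0.
apply/nbhs_ballP; exists dl => //= y; rewrite -ball_normE /ball_/= => uy.
rewrite distrC; have := dH (y - u); rewrite (addrC u) subrK; apply.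
by rewrite distrC ltW.
Qed.

Lemma dotv_delta n (a : 'rV[R]_n) i : dotv a (delta_mx ord0 i) = a ord0 i.
Proof.
rewrite /dotv (bigD1 i)//= mxE !eqxx mulr1 big1 ?addr0// => j ji.
by rewrite mxE (negbTE ji) andbF mulr0.
Qed.

Lemma norm_delta n (i : 'I_n) : `|delta_mx ord0 i : 'rV[R]_n| <= 1.
Proof.
apply: ler_norm_rV => // j; rewrite mxE eqxx /=.
by case: eqP => _; rewrite ?normr1 ?normr0.
Qed.

Lemma has_grad_derive n (f : 'rV[R]_n -> R) u a i : has_grad f u a ->
  is_derive u (delta_mx ord0 i) f (a ord0 i).
Proof.
move=> fa; set v := delta_mx ord0 i.
have lim_ : (fun h => h^-1 *: ((f \o shift u) (h *: v) - f u)) @ (0 : R)^' --> a ord0 i.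
  apply/cvgrPdist_le => e e0; have [dl dl0 H] := fa e e0.
  near=> h => /=.
  have h0 : h != 0 by near: h; exact: nbhs_dnbhs_neq.
  have hd : `|h| <= dl by near: h; exact: dnbhs0_le.
  have hv : `|h *: v| <= `|h| by rewrite normrZ ler_piMr// norm_delta.
  have := H (h *: v) (le_trans hv hd); rewrite dotvZr dotv_delta => H1.
  rewrite distrC [h *: v + u]addrC.
  have -> : h^-1 *: (f (u + h *: v) - f u) - a ord0 i =
      h^-1 * (f (u + h *: v) - f u - h * a ord0 i).
    by rewrite mulrBr mulKf.
  rewrite normrM normfV ler_pdivrMl ?normr_gt0//.
  apply: le_trans H1 _; rewrite mulrC ler_wpM2r// ltW//.
apply: DeriveDef; first by apply/cvg_ex; exists (a ord0 i).
by apply/cvg_lim => //; exact: lim_.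
Unshelve. all: by end_near. Qed.

Lemma has_grad_continuous n (f : 'rV[R]_n -> R) u a : has_grad f u a ->
  {for u, continuous f}.
Proof.
move=> fa; apply/continuous_rVP => e e0; have [dl dl0 H] := fa 1 ltr01.
have e20 : 0 < e / 2 by lra.
have /continuous_rVP/(_ _ e20)[r r0 rH] := @continuous_dotvl _ _ a u.
exists (Num.min (Num.min dl r) (e / 2)); first by rewrite !lt_min dl0 r0.
move=> h; rewrite !le_min => /andP[/andP[hdl hr] he].
have := H h hdl; have := rH h hr; rewrite mul1r dotvDr (addrC (dotv a u)) addrK => H2 H1.
rewrite -[f (u + h) - f u](subrK (dotv a h)).
by apply: le_trans (ler_normD _ _) _; lra.
Qed.

Lemma line_derive n (f : 'rV[R]_n -> R) p v (t : R) :
  derivable f (p + t *: v) v ->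
  is_derive t 1 (fun s : R => f (p + s *: v)) ('D_v f (p + t *: v)).
Proof.
set q := p + t *: v => fd.
have E : (fun h : R => h^-1 *: ((f \o shift q) (h *: v) - f q)) =
    (fun h : R => h^-1 *: (((fun s : R => f (p + s *: v)) \o shift t) (h *: (1 : R)) - f (p + t *: v))).
  apply/funext => h /=; congr (_ *: (f _ - _)).
  by rewrite /q [h *: 1]mulr1 scalerDl addrCA addrC -addrA.
apply: DeriveDef; first by move: fd; rewrite /derivable E.
by rewrite /derive E.
Qed.

Lemma MVT_line n (f : 'rV[R]_n -> R) p v (a : R) :
  (forall t : R, `|t| <= `|a| -> derivable f (p + t *: v) v) ->
  exists2 c : R, `|c| <= `|a| & f (p + a *: v) - f p = a * 'D_v f (p + c *: v).
Proof.
move=> fd; pose g (s : R) := f (p + s *: v); pose dg (s : R) := 'D_v f (p + s *: v).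
have gd (t : R) : `|t| <= `|a| -> is_derive t 1 g (dg t).
  by move=> ta; apply: line_derive; exact: fd.
have gc (x y : R) : (forall t, x <= t <= y -> `|t| <= `|a|) ->
    {within `[x, y], continuous g}.
  move=> xy; apply: derivable_within_continuous => t; rewrite in_itv/= => tt.
  by apply: ex_derive; apply: gd; exact: xy.
have g0 : f p = g 0 by rewrite /g scale0r addr0.
have [a0|a0] := leP 0 a.
  have ta t : 0 <= t <= a -> `|t| <= `|a| by move=> /andP[t0 t1]; rewrite !ger0_norm.
  have [|c] := @MVT_segment R g dg 0 a a0 _ (gc _ _ ta).
    by move=> t; rewrite in_itv/= => /andP[/ltW t0 /ltW t1]; apply: gd; apply: ta; rewrite t0.
  rewrite in_itv/= => cc E; exists c; first exact: ta.
  by rewrite g0 -/(g a) E subr0 mulrC.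
have ta t : a <= t <= 0 -> `|t| <= `|a|.
  by move=> /andP[t0 t1]; rewrite !ler0_norm ?lerN2// ltW.
have [|c] := @MVT_segment R g dg a 0 (ltW a0) _ (gc _ _ ta).
  by move=> t; rewrite in_itv/= => /andP[/ltW t0 /ltW t1]; apply: gd; apply: ta; rewrite t0.
rewrite in_itv/= => cc E; exists c; first exact: ta.
by rewrite g0 -/(g a) -[LHS]opprB E sub0r mulrN opprK mulrC.
Qed.

(** Coordinates change one at a time: [hk k] keeps the first [k] entries of [h], and the mean value
    theorem on each axis-parallel step compares a nearby partial derivative with the one at [u]. *)
Lemma C1_has_grad n (f : 'rV[R]_n -> R) (U : set 'rV[R]_n) u : open U -> U u ->
  (forall x i, U x -> derivable f x (delta_mx ord0 i)) ->
  (forall i, {for u, continuous ('D_(delta_mx ord0 i) f)}) ->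
  has_grad f u (\row_i 'D_(delta_mx ord0 i) f u).
Proof.
move=> oU Uu fd fc e e0.
(* A share of the error for each of the [n] steps; the successor keeps the quotient meaningful in
   dimension 0. *)
pose en := e / n.+1%:R.
have en0 : 0 < en by rewrite divr_gt0.
have : \forall x \near u, U x /\
    (forall i : 'I_n, `|'D_(delta_mx ord0 i) f u - 'D_(delta_mx ord0 i) f x| <= en).
  near=> x; split; first by near: x; exact: open_nbhs_nbhs.
  move=> i; move: i; near: x; apply: filter_forall => i.
  by have /cvgrPdist_le := fc i; apply.
move=> /nbhs_ballP[r/= r0 rU].
exists (r / 2); first by lra.
move=> h hr.
pose hk (k : nat) : 'rV[R]_n := \row_j (if (j < k)%N then h ord0 j else 0).
have hk0 : hk 0%N = 0 by apply/rowP => j; rewrite !mxE.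
have hkn : hk n = h by apply/rowP => j; rewrite !mxE ltn_ord.
have hkS (i : 'I_n) : hk i.+1 = hk i + h ord0 i *: delta_mx ord0 i.
  apply/rowP => j; rewrite !mxE eqxx /=; have [->|ji] := eqVneq j i.
    by rewrite leqnn ltnn add0r mulr1.
  by rewrite mulr0 addr0 ltnS leq_eqVlt (negbTE ji : (j == i :> nat) = false).
have step (i : 'I_n) : `|f (u + hk i.+1) - f (u + hk i) - 'D_(delta_mx ord0 i) f u * h ord0 i|
    <= en * `|h|.
  have near_pt (t : R) : `|t| <= `|h ord0 i| -> ball u r (u + hk i + t *: delta_mx ord0 i).
    move=> th; rewrite -ball_normE /ball_/= opprD addrA opprD addrA subrr sub0r -opprD normrN.
    apply: (@le_lt_trans _ _ (r / 2)); last lra.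
    apply: le_trans hr; apply: ler_norm_rV => // j; rewrite !mxE eqxx /=.
    have [->|ji] := eqVneq j i.
      by rewrite ltnn add0r mulr1 (le_trans th)// ler_coord_norm.
    by rewrite mulr0 addr0; case: ifP => _; rewrite ?normr0// ler_coord_norm.
  have [t th|c ch] := @MVT_line n f (u + hk i) (delta_mx ord0 i) (h ord0 i).
    by apply: fd; have [] := rU _ (near_pt t th).
  rewrite hkS addrA => ->.
  rewrite mulrC -mulrBl normrM distrC ler_pM ?ler_coord_norm//.
  by have [_] := rU _ (near_pt c ch); apply.
have -> : f (u + h) - f u - dotv (\row_i 'D_(delta_mx ord0 i) f u) h =
    \sum_(i < n) (f (u + hk i.+1) - f (u + hk i) - 'D_(delta_mx ord0 i) f u * h ord0 i).
  rewrite big_split/= sumrN; congr (_ - _); last by apply: eq_bigr => i _; rewrite mxE.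
  rewrite -(big_mkord xpredT (fun i => f (u + hk i.+1) - f (u + hk i))) telescope_sumr//.
  by rewrite hkn hk0 addr0.
apply: le_trans (ler_norm_sum _ _ _) _.
apply: (@le_trans _ _ (\sum_(i < n) (en * `|h|))); first by apply: ler_sum => i _; exact: step.
rewrite sumr_const card_ord -mulr_natl mulrA ler_wpM2r//.
by rewrite /en mulrA ler_pdivrMr// mulrC ler_pM2l// ler_nat leqnSn.
Unshelve. all: by end_near. Qed.

End gradients.

(** * Calculus of smooth functions and of inverse maps *)

Section smooth_functions.
Context {R : realType}.

Section Ck.
Variable n : nat.
Implicit Types (U W : set 'rV[R]_n) (f g : 'rV[R]_n -> R).
Local Notation pd i := (derive^~ (delta_mx ord0 i : 'rV[R]_n)).

(** Scalar and graded by the order, unlike [smooth_on]: the derivatives of an inverse map involve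
    the inverse map itself, so its smoothness is an induction on [k]. *)
Fixpoint Ck (k : nat) U f : Prop :=
  (forall u, U u -> {for u, continuous f}) /\
  if k is k'.+1 then
    (forall i u, U u -> derivable f u (delta_mx ord0 i)) /\
    forall i, Ck k' U ('D_(delta_mx ord0 i) f)
  else True.

Lemma Ck_continuous k U f u : Ck k U f -> U u -> {for u, continuous f}.
Proof. by case: k => [|k] [cf _] Uu; exact: cf. Qed.

Lemma CkS k U f : Ck k.+1 U f -> Ck k U f.
Proof.
elim: k f => [|k IH] f [cf [df pf]]; first by split.
by split => //; split => // i; apply: IH; exact: pf.
Qed.

Lemma Ck_sub k U W f : W `<=` U -> Ck k U f -> Ck k W f.
Proof.
move=> WU; elim: k f => [|k IH] f [cf df]; split => //.
- by move=> u /WU; exact: cf.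
- by move=> u /WU; exact: cf.
by case: df => df pf; split => [i u /WU|i]; [exact: df|exact: IH (pf i)].
Qed.

Lemma near_open U u (P : 'rV[R]_n -> Prop) : open U -> U u -> (forall x, U x -> P x) ->
  \forall x \near u, P x.
Proof. by move=> oU Uu h; exact: (filterS h (open_nbhs_nbhs (conj oU Uu))). Qed.

Lemma near_open_eq (T : Type) U u (f g : 'rV[R]_n -> T) : open U -> U u ->
  (forall x, U x -> f x = g x) -> \forall x \near u, f x = g x.
Proof. by move=> oU Uu fg; exact: (near_open oU Uu fg). Qed.

Lemma continuous_ext U u f g : open U -> U u -> (forall x, U x -> f x = g x) ->
  {for u, continuous f} -> {for u, continuous g}.
Proof.
move=> oU Uu fg cf; rewrite /prop_for /continuous_at -(fg u Uu).
exact: (cvg_trans (near_eq_cvg (near_open_eq oU Uu fg)) cf).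
Qed.

Lemma Ck_ext k U f g : open U -> (forall u, U u -> f u = g u) -> Ck k U f -> Ck k U g.
Proof.
move=> oU; elim: k f g => [|k IH] f g fg [cf df].
  by split => // u Uu; exact: (continuous_ext oU Uu fg (cf u Uu)).
split; first by move=> u Uu; exact: (continuous_ext oU Uu fg (cf u Uu)).
case: df => df pf; split => [i u Uu|i].
  exact: (near_eq_derivable (near_open_eq oU Uu fg) (df i u Uu)).
apply: IH (pf i) => u Uu.
exact: (near_eq_derive _ (near_open_eq oU Uu fg)).
Qed.

Lemma Ck_cst k U (c : R) : Ck k U (fun=> c).
Proof.
elim: k c => [|k IH] c; split => //; try by move=> u _; exact: cst_continuous.
split=> [i u _|i]; first exact: derivable_cst.
rewrite (_ : 'D_(delta_mx ord0 i) _ = (fun=> 0)); first exact: IH.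
by apply/funext => u; rewrite derive_cst.
Qed.

Lemma Ck_add k U f g : open U -> Ck k U f -> Ck k U g -> Ck k U (fun x => f x + g x).
Proof.
move=> oU; elim: k f g => [|k IH] f g [cf df] [cg dg]; split => //;
  try by move=> u Uu; apply: continuousD; [exact: cf|exact: cg].
case: df dg => df pf [dg pg]; split => [i u Uu|i].
  by apply: derivableD; [exact: df|exact: dg].
apply: (@Ck_ext k U (fun x => 'D_(delta_mx ord0 i) f x + 'D_(delta_mx ord0 i) g x)) => //.
  by move=> u Uu; rewrite deriveD//; [exact: df|exact: dg].
exact: (IH _ _ (pf i) (pg i)).
Qed.

Lemma Ck_mul k U f g : open U -> Ck k U f -> Ck k U g -> Ck k U (fun x => f x * g x).
Proof.
move=> oU; elim: k f g => [|k IH] f g Cf Cg; case: (Cf) (Cg) => [cf df] [cg dg]; split => //;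
  try by move=> u Uu; apply: continuousM; [exact: cf|exact: cg].
case: df dg => df pf [dg pg]; split => [i u Uu|i].
  by apply: derivableM; [exact: df|exact: dg].
apply: (@Ck_ext k U (fun x => f x * 'D_(delta_mx ord0 i) g x + g x * 'D_(delta_mx ord0 i) f x)) => //.
  by move=> u Uu; rewrite [RHS]deriveM//; [exact: df|exact: dg].
by apply: Ck_add => //; [exact: (IH _ _ (CkS Cf) (pg i))|exact: (IH _ _ (CkS Cg) (pf i))].
Qed.

Lemma Ck_opp k U f : open U -> Ck k U f -> Ck k U (fun x => - f x).
Proof.
move=> oU Cf; apply: (@Ck_ext k U (fun x => -1 * f x)) => // [u _|].
  by rewrite mulN1r.
by apply: Ck_mul => //; exact: Ck_cst.
Qed.

Lemma Ck_inv k U f : open U -> (forall u, U u -> f u != 0) -> Ck k U f ->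
  Ck k U (fun x => (f x)^-1).
Proof.
move=> oU f0; elim: k => [|k IH] Cf; case: (Cf) => cf df; split => //;
  try by move=> u Uu; apply: continuousV; [exact: f0|exact: cf].
case: df => df pf; split => [i u Uu|i].
  by apply: derivableV; [exact: f0|exact: df].
apply: (@Ck_ext k U (fun x => - ((f x)^-1 * (f x)^-1 * 'D_(delta_mx ord0 i) f x))) => //.
  move=> u Uu; rewrite deriveV//; [|exact: f0|exact: df].
  by rewrite scaleNr -[RHS]/(- (_ * _)) expr2 invfM.
have h := IH (CkS Cf).
by apply: Ck_opp => //; apply: Ck_mul => //; [exact: Ck_mul|exact: pf].
Qed.

Lemma Ck_sum (I : Type) (r : seq I) (P : pred I) k U (F : I -> 'rV[R]_n -> R) : open U ->
  (forall i, P i -> Ck k U (F i)) -> Ck k U (fun x => \sum_(i <- r | P i) F i x).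
Proof.
move=> oU CF; elim: r => [|i r IH].
  by apply: Ck_ext (Ck_cst k U 0) => // u _; rewrite big_nil.
have [Pi|Pi] := boolP (P i).
  apply: (Ck_ext oU _ (Ck_add oU (CF i Pi) IH)) => u _.
  by rewrite big_cons Pi.
by apply: (Ck_ext oU _ IH) => u _; rewrite big_cons (negbTE Pi).
Qed.

Lemma Ck_prod (I : Type) (r : seq I) (P : pred I) k U (F : I -> 'rV[R]_n -> R) : open U ->
  (forall i, P i -> Ck k U (F i)) -> Ck k U (fun x => \prod_(i <- r | P i) F i x).
Proof.
move=> oU CF; elim: r => [|i r IH].
  by apply: Ck_ext (Ck_cst k U 1) => // u _; rewrite big_nil.
have [Pi|Pi] := boolP (P i).
  apply: (Ck_ext oU _ (Ck_mul oU (CF i Pi) IH)) => u _.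
  by rewrite big_cons Pi.
by apply: (Ck_ext oU _ IH) => u _; rewrite big_cons (negbTE Pi).
Qed.

Lemma Ck_det m k U (A : 'rV[R]_n -> 'M[R]_m) : open U ->
  (forall i j, Ck k U (fun x => A x i j)) -> Ck k U (fun x => \det (A x)).
Proof.
move=> oU CA; apply: Ck_sum => // s _; apply: Ck_mul => //; first exact: Ck_cst.
by apply: Ck_prod => // i _.
Qed.

(** Cramer's rule: the entries of the inverse are cofactors over the determinant. *)
Lemma Ck_invmx m k U (A : 'rV[R]_n -> 'M[R]_m) : open U ->
  (forall u, U u -> A u \in unitmx) ->
  (forall i j, Ck k U (fun x => A x i j)) ->
  forall i j, Ck k U (fun x => invmx (A x) i j).
Proof.
move=> oU A0 CA i j.
apply: (@Ck_ext k U (fun x => (\det (A x))^-1 * cofactor (A x) j i)) => //.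
  by move=> u Uu; rewrite /invmx A0// !mxE.
apply: Ck_mul => //.
  apply: Ck_inv => //; last exact: Ck_det.
  by move=> u /A0; rewrite unitmxE unitfE.
apply: Ck_mul => //; first exact: Ck_cst.
apply: Ck_det => // a b.
by apply: Ck_ext (CA (lift j a) (lift i b)) => // u _; rewrite !mxE.
Qed.

Lemma Ck_has_grad k U f u : open U -> U u -> Ck k.+1 U f ->
  has_grad f u (\row_i 'D_(delta_mx ord0 i) f u).
Proof.
move=> oU Uu [cf [df pf]]; apply: (C1_has_grad oU Uu) => [x i Ux|i]; first exact: df.
exact: Ck_continuous (pf i) Uu.
Qed.

End Ck.

Lemma smooth_on_Ck m n (U : set 'rV[R]_m) (X : 'rV[R]_m -> 'rV[R]_n) j k : open U ->
  smooth_on U X -> Ck k U (fun u => X u ord0 j).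
Proof.
move=> oU sX; suff H s : Ck k U (fun u => iter_partial s X u ord0 j) by exact: (H [::]).
elim: k s => [|k IH] s; split => //; try split.
- move=> u Uu; have [cX _] := sX s u Uu.
  exact: (continuous_comp cX (@coord_continuous R 1 n ord0 j _)).
- move=> u Uu; have [cX _] := sX s u Uu.
  exact: (continuous_comp cX (@coord_continuous R 1 n ord0 j _)).
- by move=> i u Uu; have [_ dX] := sX s u Uu; move: (dX i) => /derivable_mxP.
move=> i; apply: Ck_ext (IH (i :: s)) => // u Uu.
have [_ dX] := sX s u Uu.
by rewrite /= /partial (derive_mx (dX i)) mxE.
Qed.

Lemma Ck_smooth_on m n (U : set 'rV[R]_m) (X : 'rV[R]_m -> 'rV[R]_n) : open U ->
  (forall j k, Ck k U (fun u => X u ord0 j)) -> smooth_on U X.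
Proof.
move=> oU CX s.
have {}CX : forall j k, Ck k U (fun u => iter_partial s X u ord0 j).
  elim: s => [//|i s IH] j k; have [_ [dX pX]] := IH j k.+1.
  apply: Ck_ext (pX i) => // u Uu; rewrite /= /partial derive_mx ?mxE//.
  apply/derivable_mxP => a b; rewrite (ord1 a).
  by have [_ [d _]] := IH b 1%N; exact: d.
move=> u Uu; split.
  by apply: continuous_coords => j; have [c _] := CX j 0%N; exact: c.
move=> i; apply/derivable_mxP => a b; rewrite (ord1 a).
by have [_ [d _]] := CX b 1%N; exact: d.
Qed.

Lemma ler_norm_mulmx m n (x : 'rV[R]_m) (A : 'M[R]_(m, n)) :
  `|x *m A| <= (\sum_i \sum_j `|A i j|) * `|x|.
Proof.
have A0 : 0 <= \sum_i \sum_j `|A i j| by do 2!apply: sumr_ge0 => ? _.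
apply: ler_norm_rV => [|j]; first by rewrite mulr_ge0.
rewrite mxE; apply: le_trans (ler_norm_sum _ _ _) _.
rewrite mulr_suml; apply: ler_sum => i _; rewrite normrM mulrC ler_pM ?ler_coord_norm//.
by rewrite (bigD1 j)//= lerDl sumr_ge0.
Qed.

Section inverse.
Variables (n : nat) (F G : 'rV[R]_n -> 'rV[R]_n) (U W : set 'rV[R]_n).
Hypotheses (oU : open U) (oW : open W) (GW : forall y, W y -> U (G y)).
Hypotheses (cG : forall y, W y -> {for y, continuous G}) (FG : forall y, W y -> F (G y) = y).
Hypothesis CF : forall k j, Ck k U (fun u => F u ord0 j).

Let J u : 'M[R]_n := \matrix_(i, j) 'D_(delta_mx ord0 i) (fun u => F u ord0 j) u.

Hypothesis J_unit : forall u, U u -> J u \in unitmx.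

(** The map [G] is a given continuous right inverse of [F], so only differentiability is at stake.
    If [h] is the increment of [G] for an increment [k] of [y], then [k = h *m J (G y) + r] with [r]
    small against [h]; inverting the Jacobian gives [h] up to a small error, and
    [|h| <= 2 * c * |k|]. *)
Lemma inverse_comp_has_grad phi y a : W y -> has_grad phi (G y) a ->
  has_grad (phi \o G) y (\row_i \sum_j invmx (J (G y)) i j * a ord0 j).
Proof.
move=> Wy phia e e0.
set Ji := invmx (J (G y)); set c := 1 + \sum_i \sum_j `|Ji i j|.
have c1 : 1 <= c by rewrite lerDl; do 2!apply: sumr_ge0 => ? _.
set A := 1 + \sum_i \sum_j `|(a^T) i j|.
have A1 : 1 <= A by rewrite lerDl; do 2!apply: sumr_ge0 => ? _.
(* The first bound absorbs [c * |r|] into [|h| / 2]; the second leaves an error [e / 2 * |k|] from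
   [dotv a (r *m Ji)], and [e2] yields the other half. *)
pose e1 := Num.min ((2 * c)^-1) (e / (4 * c * A * c)).
have c0 : 0 < c by lra.
have A0 : 0 < A by lra.
have e10 : 0 < e1.
  by rewrite lt_min invr_gt0 mulr_gt0// divr_gt0// !mulr_gt0.
pose e2 := e / (4 * c).
have e20 : 0 < e2 by rewrite divr_gt0// mulr_gt0.
have gradF j := Ck_has_grad oU (GW Wy) (CF 1 j).
have [d1 d10 H1] : exists2 dl : R, 0 < dl & forall h, `|h| <= dl -> forall j,
    `|F (G y + h) ord0 j - F (G y) ord0 j - (h *m J (G y)) ord0 j| <= e1 * `|h|.
  have near0 : \forall dl \near (0 : R)^'+, forall j : 'I_n, forall h, `|h| <= dl ->
      `|F (G y + h) ord0 j - F (G y) ord0 j - (h *m J (G y)) ord0 j| <= e1 * `|h|.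
    apply: filter_forall => j; have [dl dl0 H] := gradF j e1 e10.
    near=> d => h hd; have /H : `|h| <= dl.
      by apply: le_trans hd _; near: d; exact: nbhs_right_le.
    rewrite dotvC; congr (`|_ - _| <= _); rewrite mxE.
    by apply: eq_bigr => i _; rewrite !mxE.
  near (0 : R)^'+ => dl; exists dl; first by near: dl; exact: nbhs_right_gt.
  by move=> h hd j; move: h hd; move: j; near: dl.
have [d2 d20 H2] := phia e2 e20.
have [d3 d30 H3] := (continuous_rVP G y).1 (cG Wy) (Num.min d1 d2) ltac:(by rewrite lt_min d10).
have [/= d4 d40 H4] := (nbhs_ballP _ _).1 (open_nbhs_nbhs (conj oW Wy)).
exists (Num.min d3 (d4 / 2)); first by rewrite lt_min d30; lra.
move=> k; rewrite le_min => /andP[k3 k4].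
have Wk : W (y + k).
  by apply: H4; rewrite -ball_normE /ball_/= opprD addrA subrr sub0r normrN; lra.
pose h := G (y + k) - G y.
have := H3 k k3; rewrite -/h le_min => /andP[h1 h2].
have GE : G (y + k) = G y + h by rewrite /h [RHS]addrC subrK.
pose r := k - h *m J (G y).
have rh : `|r| <= e1 * `|h|.
  apply: ler_norm_rV => [|j]; first by rewrite mulr_ge0// ltW.
  have := H1 h h1 j; rewrite -GE !FG//; congr (`|_| <= _).
  by rewrite /r !mxE; congr (_ + _); ring.
have hE : h = k *m Ji - r *m Ji.
  rewrite -mulmxBl /r opprB addrC subrK -mulmxA mulmxV ?mulmx1//.
  exact/J_unit/GW.
have bnd (x : 'rV[R]_n) : `|x *m Ji| <= c * `|x|.
  apply: le_trans (ler_norm_mulmx _ _) _; rewrite ler_wpM2r// /c; lra.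
have hk : `|h| <= 2 * c * `|k|.
  have : `|h| <= c * `|k| + c * `|r|.
    by rewrite [in leLHS]hE; apply: le_trans (ler_normB _ _) _; rewrite lerD.
  have : c * `|r| <= 2^-1 * `|h|.
    apply: (@le_trans _ _ (c * ((2 * c)^-1 * `|h|))).
      rewrite ler_pM2l//; apply: le_trans rh _; rewrite ler_wpM2r// ge_min lexx//.
    by rewrite mulrA invfM mulrCA mulfV ?gt_eqF// mulr1.
  lra.
rewrite /= GE.
have -> : dotv (\row_i \sum_j Ji i j * a ord0 j) k = dotv a (k *m Ji).
  rewrite /dotv; under eq_bigr do rewrite mxE mulr_suml.
  rewrite exchange_big/=; apply: eq_bigr => j _; rewrite mxE mulr_sumr.
  by apply: eq_bigr => i _; ring.
have -> : phi (G y + h) - phi (G y) - dotv a (k *m Ji) =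
    (phi (G y + h) - phi (G y) - dotv a h) - dotv a (r *m Ji).
  by rewrite [in X in _ = _ - X - _]hE dotvBr; ring.
apply: le_trans (ler_normB _ _) _.
have P1 : `|phi (G y + h) - phi (G y) - dotv a h| <= e / 2 * `|k|.
  apply: le_trans (H2 h h2) _.
  apply: (@le_trans _ _ (e2 * (2 * c * `|k|))); first by rewrite ler_pM2l.
  by rewrite /e2 le_eqVlt; apply/orP; left; apply/eqP; field; rewrite gt_eqF.
have P2 : `|dotv a (r *m Ji)| <= e / 2 * `|k|.
  have aE x : `|dotv a x| <= A * `|x|.
    have -> : dotv a x = (x *m a^T) ord0 ord0.
      by rewrite mxE; apply: eq_bigr => i _; rewrite !mxE mulrC.
    apply: le_trans (ler_coord_norm _ _) _; apply: le_trans (ler_norm_mulmx _ _) _.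
    by rewrite ler_wpM2r// /A; lra.
  apply: le_trans (aE _) _.
  apply: (@le_trans _ _ (A * (c * (e / (4 * c * A * c) * (2 * c * `|k|))))); last first.
    by rewrite le_eqVlt; apply/orP; left; apply/eqP; field; rewrite !gt_eqF.
  rewrite ler_pM2l//; apply: le_trans (bnd _) _; rewrite ler_pM2l//.
  apply: le_trans rh _; rewrite ler_pM ?(ltW e10)// ge_min lexx orbT//.
by lra.
Unshelve. all: by end_near. Qed.

(** The partial derivatives of [phi \o G] are again of the form [psi \o G] with [psi] smooth on [U];
    the claim for every smooth [phi] at once lets the induction on [k] close. *)
Lemma inverse_comp_Ck phi : (forall k, Ck k U phi) -> forall k, Ck k W (phi \o G).
Proof.
move=> Cphi k; elim: k phi Cphi => [|k IH] phi Cphi.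
  split => // y Wy; apply: continuous_comp (cG Wy) _.
  exact: Ck_continuous (Cphi 0%N) (GW Wy).
have grad y : W y -> has_grad (phi \o G) y
    (\row_i \sum_j invmx (J (G y)) i j * 'D_(delta_mx ord0 j) phi (G y)).
  move=> Wy; have := inverse_comp_has_grad Wy (Ck_has_grad oU (GW Wy) (Cphi 1%N)).
  congr has_grad; apply/rowP => i; rewrite !mxE; apply: eq_bigr => j _.
  by rewrite ?mxE.
split; first by move=> y Wy; exact: has_grad_continuous (grad y Wy).
split => [i y Wy|i]; first by have [] := has_grad_derive i (grad y Wy).
pose psi u := \sum_j invmx (J u) i j * 'D_(delta_mx ord0 j) phi u.
apply: (@Ck_ext n k W (psi \o G)) => //.
  by move=> y Wy; have [_ ->] := has_grad_derive i (grad y Wy); rewrite mxE.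
apply: IH => k'; apply: Ck_sum => // j _; apply: Ck_mul => //.
  apply: Ck_invmx => // a b.
  apply: (@Ck_ext n k' U ('D_(delta_mx ord0 a) (fun u => F u ord0 b))) => //.
    by move=> u _; rewrite mxE.
  by have [_ [_ h]] := CF k'.+1 b; exact: h.
by have [_ [_ h]] := Cphi k'.+1; exact: h.
Qed.

End inverse.
End smooth_functions.

(** * Nonvanishing curvature excludes boundary segments *)

Section strict_convexity.
Context {R : realType}.

Lemma derive_dotv m n (nu : 'rV[R]_n) (X : 'rV[R]_m -> 'rV[R]_n) u v :
  derivable X u v -> is_derive u v (fun x => dotv nu (X x)) (dotv nu ('D_v X u)).
Proof.
move=> dX.
have c : (fun h => h^-1 *: ((fun x => dotv nu (X x)) \o shift u) (h *: v)
    - h^-1 *: dotv nu (X u)) @ (0 : R)^' --> dotv nu ('D_v X u).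
  have := cvg_comp _ _ dX (@continuous_dotvl _ _ nu ('D_v X u)).
  apply: cvg_trans; apply: near_eq_cvg; near=> h => /=.
  by rewrite dotvZr dotvBr mulrBr.
have c' : (fun h => h^-1 *: (((fun x => dotv nu (X x)) \o shift u) (h *: v)
    - dotv nu (X u))) @ (0 : R)^' --> dotv nu ('D_v X u).
  by under eq_fun do rewrite scalerBr.
apply: DeriveDef; first by apply/cvg_ex; exists (dotv nu ('D_v X u)).
by apply/cvg_lim => //; exact: c'.
Unshelve. all: by end_near. Qed.

(** A small step along [a] would increase [f] to first order; [norm_le_dotv] compares that gain with
    the error, which is measured in the sup norm. *)
Lemma has_grad_max n (f : 'rV[R]_n -> R) (U : set 'rV[R]_n) u a : open U -> U u ->
  has_grad f u a -> (forall x, U x -> f x <= f u) -> a = 0.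
Proof.
move=> oU Uu fa fmax; apply/eqP; rewrite -normr_eq0; apply/negPn/negP => a0.
have an : 0 < `|a| by rewrite lt_def a0 normr_ge0.
have e0 : 0 < `|a| / 2 by lra.
have [dl dl0 H] := fa _ e0.
have [r/= r0 rU] := (nbhs_ballP _ _).1 (open_nbhs_nbhs (conj oU Uu)).
pose s := Num.min dl (r / 2) / `|a|.
have s0 : 0 < s by rewrite divr_gt0// lt_min dl0; lra.
have sa : `|s *: a| = Num.min dl (r / 2) by rewrite normrZ gtr0_norm// /s divfK.
have := H (s *: a); rewrite sa ge_min lexx => /(_ isT).
have : f (u + s *: a) <= f u.
  apply: fmax; apply: rU; rewrite -ball_normE /ball_/= opprD addrA subrr sub0r normrN sa.
  by rewrite gt_min; apply/orP; right; lra.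
rewrite dotvZr => h1 h2.
have h3 : s * dotv a a <= `|a| / 2 * (s * `|a|).
  have -> : s * `|a| = Num.min dl (r / 2) by rewrite /s divfK.
  by have := ler_norm (- (f (u + s *: a) - f u - s * dotv a a)); rewrite normrN; lra.
have := norm_le_dotv a => h4.
have : s * `|a| ^+ 2 <= `|a| / 2 * (s * `|a|).
  by apply: le_trans h3; rewrite ler_pM2l.
have : 0 < s * `|a| ^+ 2 by rewrite mulr_gt0// exprn_gt0.
by rewrite expr2 => h5 h6; lra.
Qed.

Lemma smooth_on_iter m n (U : set 'rV[R]_m) (X : 'rV[R]_m -> 'rV[R]_n) s :
  smooth_on U X -> smooth_on U (iter_partial s X).
Proof.
move=> sX s'; rewrite (_ : iter_partial s' _ = iter_partial (s' ++ s) X); last first.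
  by rewrite /iter_partial foldr_cat.
exact: sX.
Qed.

Lemma smooth_on_dotv m n (U : set 'rV[R]_m) (X : 'rV[R]_m -> 'rV[R]_n) nu k : open U ->
  smooth_on U X -> Ck k U (fun u => dotv nu (X u)).
Proof.
move=> oU sX; apply: Ck_sum => // j _; apply: Ck_mul => //; first exact: Ck_cst.
exact: smooth_on_Ck.
Qed.

Lemma smooth_on_derivable m n (U : set 'rV[R]_m) (X : 'rV[R]_m -> 'rV[R]_n) u i :
  smooth_on U X -> U u -> derivable X u (delta_mx ord0 i).
Proof. by move=> sX Uu; have [_] := sX [::] u Uu. Qed.

Lemma smooth_on_continuous m n (U : set 'rV[R]_m) (X : 'rV[R]_m -> 'rV[R]_n) u :
  smooth_on U X -> U u -> {for u, continuous X}.
Proof. by move=> sX Uu; have [] := sX [::] u Uu. Qed.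

Section hypersurface.
Variables (m : nat) (K : set 'rV[R]_m.+1).
Hypotheses (cK : compact K) (vK : cvx K).
Local Notation M := (frontier K).

Lemma parametrization_sub U X u : @local_parametrization R m.+1 M U X -> U u -> M (X u).
Proof.
move=> [oU _ _ _ hom] Uu; have [V _ E] := hom U oU (@subset_refl _ U).
have : (X @` U) (X u) by exists u.
by rewrite E => -[].
Qed.

(** The chart takes values in [K], so [dotv nu] composed with it has a maximum at [u] and its
    gradient vanishes. *)
Lemma support_tangent U X nu u i : @local_parametrization R m.+1 M U X -> U u ->
  (forall x, K x -> dotv nu x <= dotv nu (X u)) -> dotv nu (partial i X u) = 0.
Proof.
move=> lp Uu sup; have [oU sX _ _ _] := lp.
have := @has_grad_max _ (fun u => dotv nu (X u)) U u _ oU Uu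
  (Ck_has_grad oU Uu (smooth_on_dotv nu 1 oU sX)).
have h x : U x -> dotv nu (X x) <= dotv nu (X u).
  by move=> Ux; apply: sup; apply: frontier_sub => //; exact: parametrization_sub lp Ux.
move=> /(_ h)/rowP/(_ i); rewrite !mxE.
by have [_ ->] := derive_dotv nu (smooth_on_derivable (i := i) sX Uu).
Qed.

Hypotheses (hM : smooth_hypersurface M) (curv : nonvanishing_curvature M).

(** A normal [nu] supporting [K] at the midpoint is constant on the segment, so it supports [K] all
    along it and is orthogonal to the tangent vectors there. The map sending [u] to the products of
    [nu] with the partial derivatives of [X] thus vanishes at the parameters of all nearby points of
    the segment. But its derivative at [u0] is the second fundamental form, which is invertible, so
    the zero at [u0] is isolated. *)
Lemma no_segment p q : K p -> K q -> p != q ->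
  ~ (forall t : R, 0 <= t -> t <= 1 -> frontier K (p + t *: (q - p))).
Proof.
move=> Kp Kq pq seg.
have Mx0 : M (p + 2^-1 *: (q - p)) by apply: seg; lra.
set x0 := p + _ in Mx0.
have [U [X [lp [u0 Uu0 Xu0]]]] := hM Mx0.
have [oU sX rf inj hom] := lp.
have [nu Snu sup] := supporting_normal cK vK Mx0.
have nx0 : dotv nu x0 = dotv nu p + 2^-1 * (dotv nu q - dotv nu p).
  by rewrite /x0 dotvDr dotvZr dotvBr.
have nuseg (t : R) : dotv nu (p + t *: (q - p)) = dotv nu x0.
  rewrite dotvDr dotvZr dotvBr nx0; have := sup _ Kp; have := sup _ Kq; rewrite nx0 => h1 h2.
  have -> : dotv nu q = dotv nu p by lra.
  by rewrite subrr !mulr0.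
have un : unit_normal X u0 nu.
  split => // i; rewrite dotvC; apply: (support_tangent _ lp Uu0) => x Kx.
  by rewrite Xu0; exact: sup.
have := curv lp Uu0 un; rewrite /gaussian_curvature mulf_eq0 negb_or => /andP[dII _].
set II := second_form X nu u0 in dII.
have IIu : II \in unitmx by rewrite unitmxE unitfE.
pose c := 1 + \sum_i \sum_j `|invmx II i j|.
have c1 : 1 <= c by rewrite lerDl; do 2!apply: sumr_ge0 => ? _.
have c0 : 0 < c by lra.
(* Chosen against [|h| <= c * |h *m II|]: if [h *m II] is no more than the linearisation error
   [(2 * c)^-1 * |h|], then [|h| <= |h| / 2]. *)
have e0 : 0 < (2 * c)^-1 by rewrite invr_gt0; lra.
have gradG i : has_grad (fun u => dotv nu (partial i X u)) u0
    (\row_j 'D_(delta_mx ord0 j) (fun u => dotv nu (partial i X u)) u0).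
  apply: (Ck_has_grad oU Uu0).
  exact: (@smooth_on_dotv _ _ U (iter_partial [:: i] X) nu 1 oU (smooth_on_iter [:: i] sX)).
have [dl dl0 H] : exists2 dl : R, 0 < dl & forall h, `|h| <= dl -> forall i,
    `|dotv nu (partial i X (u0 + h)) - dotv nu (partial i X u0) - (h *m II) ord0 i| <=
      (2 * c)^-1 * `|h|.
  have near0 : \forall dl \near (0 : R)^'+, forall i, forall h, `|h| <= dl ->
      `|dotv nu (partial i X (u0 + h)) - dotv nu (partial i X u0) - (h *m II) ord0 i| <=
      (2 * c)^-1 * `|h|.
    apply: filter_forall => i; have [dl dl0 H] := gradG i _ e0.
    near=> d => h hd; have /H : `|h| <= dl.
      by apply: le_trans hd _; near: d; exact: nbhs_right_le.
    rewrite (dotvC _ h); congr (`|_ - _| <= _); rewrite mxE.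
    apply: eq_bigr => j _; rewrite !mxE; congr (_ * _).
    have dX : derivable (partial i X) u0 (delta_mx ord0 j).
      by have [_] := sX [:: i] u0 Uu0.
    by have [_ ->] := derive_dotv nu dX; rewrite dotvC.
  near (0 : R)^'+ => dl; exists dl; first by near: dl; exact: nbhs_right_gt.
  by move=> h hd i; move: h hd; move: i; near: dl.
have [W0/= r0 rU] := (nbhs_ballP _ _).1 (open_nbhs_nbhs (conj oU Uu0)).
(* The chart is open onto its image: points of [M] close to [x0] have their parameters in this small
   ball. *)
pose W := U `&` ball u0 dl.
have oW : open W by apply: openI => //; exact: ball_open.
have [V oV VE] := hom W oW (@subIsetl _ _ _).
have Vx0 : V x0.
  have : (X @` W) x0 by exists u0 => //; split => //; exact: ballxx.
  by rewrite VE => -[].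
have [r/= rr0 rV] := (nbhs_ballP _ _).1 (open_nbhs_nbhs (conj oV Vx0)).
have pqn : 0 < `|q - p| by rewrite normr_gt0 subr_eq0 eq_sym.
(* At most 1/2 to remain on the segment, and small enough to remain in [V]. *)
pose s := Num.min 2^-1 (r / (2 * `|q - p|)).
have s0 : 0 < s by rewrite lt_min invr_gt0 ltr0n divr_gt0// mulr_gt0.
have s1 : s <= 2^-1 by rewrite ge_min lexx.
have sr : s * `|q - p| < r.
  apply: (@le_lt_trans _ _ (r / (2 * `|q - p|) * `|q - p|)).
    by rewrite ler_pM2r// ge_min lexx orbT.
  have -> : r / (2 * `|q - p|) * `|q - p| = r / 2 by field; rewrite gt_eqF.
  by lra.
have zE : p + (2^-1 + s) *: (q - p) = x0 + s *: (q - p) by rewrite /x0 scalerDl addrA.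
have Mz : M (x0 + s *: (q - p)) by rewrite -zE; apply: seg; lra.
have : (X @` W) (x0 + s *: (q - p)).
  rewrite VE; split => //; apply: rV; rewrite -ball_normE /ball_/=.
  by rewrite opprD addrA subrr sub0r normrN normrZ gtr0_norm.
move=> [u1 [Uu1 u1d] Xu1].
pose h := u1 - u0.
have hd : `|h| <= dl by move: u1d; rewrite -ball_normE /ball_/= distrC => /ltW.
have h0 : h != 0.
  rewrite subr_eq0; apply/eqP => E; move: Xu1; rewrite E Xu0 => E2.
  have /eqP : s *: (q - p) = 0 by apply: (addrI x0); rewrite addr0 -E2.
  by rewrite scaler_eq0 (gt_eqF s0)/= subr_eq0 eq_sym (negbTE pq).
have hII : `|h *m II| <= (2 * c)^-1 * `|h|.
  apply: ler_norm_rV => [|i]; first by rewrite mulr_ge0// ltW.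
  have := H h hd i.
  have -> : u0 + h = u1 by rewrite /h addrC subrK.
  have -> : dotv nu (partial i X u1) = 0.
    apply: (support_tangent _ lp Uu1) => x Kx; rewrite Xu1 -zE nuseg; exact: sup.
  have -> : dotv nu (partial i X u0) = 0.
    apply: (support_tangent _ lp Uu0) => x Kx; rewrite Xu0; exact: sup.
  by rewrite subr0 sub0r normrN.
have hn : 0 < `|h| by rewrite normr_gt0.
have : `|h| <= c * `|h *m II|.
  rewrite -[in leLHS](mulmx1 h) -(mulmxV IIu) mulmxA.
  by apply: le_trans (ler_norm_mulmx _ _) _; rewrite ler_wpM2r// /c; lra.
have : c * `|h *m II| <= 2^-1 * `|h|.
  apply: (@le_trans _ _ (c * ((2 * c)^-1 * `|h|))); first by rewrite ler_pM2l.
  by rewrite mulrA invfM mulrCA mulfV ?gt_eqF// mulr1.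
by lra.
Unshelve. all: by end_near. Qed.

End hypersurface.
End strict_convexity.

(** * Shadows and Cauchy's projection formula *)

Section graph_parametrization.
Context {R : realType}.

Lemma dotv_mulmx m n (z : 'rV[R]_n) (a : 'rV[R]_m) (B : 'M[R]_(m, n)) :
  dotv z (a *m B) = \sum_j a ord0 j * dotv z (row j B).
Proof.
under [RHS]eq_bigr do rewrite mulr_sumr.
rewrite exchange_big/=; apply: eq_bigr => k _; rewrite [X in _ * X]mxE mulr_sumr.
by apply: eq_bigr => j _; rewrite [row _ _ _ _]mxE; ring.
Qed.

Lemma open_preimage_on (S T : topologicalType) (U : set S) (f : S -> T) (O : set T) :
  open U -> (forall u, U u -> {for u, continuous f}) -> open O -> open (U `&` f @^-1` O).
Proof.
move=> oU cf oO; rewrite openE => u [Uu Of] /=; apply: filterI.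
  exact: open_nbhs_nbhs.
by apply: (cf u Uu); exact: open_nbhs_nbhs.
Qed.

Lemma Ck_local n k (U : set 'rV[R]_n) (f : 'rV[R]_n -> R) :
  (forall u, U u -> exists W, [/\ open W, W u & Ck k W f]) -> Ck k U f.
Proof.
elim: k f => [|k IH] f H; split => //.
- by move=> u /H[W [_ Wu CW]]; exact: Ck_continuous CW Wu.
- by move=> u /H[W [_ Wu CW]]; exact: Ck_continuous CW Wu.
split => [i u /H[W [_ Wu [_ [d _]]]]|i]; first exact: d.
by apply: IH => u /H[W [oW Wu [_ [_ p]]]]; exists W; split => //; exact: p.
Qed.

Lemma has_grad_coord n j (u : 'rV[R]_n) :
  has_grad (fun u : 'rV[R]_n => u ord0 j) u (delta_mx ord0 j).
Proof.
move=> e e0; exists 1 => // h _; rewrite dotvC dotv_delta mxE.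
by rewrite (addrC (u ord0 j)) addrK subrr normr0 mulr_ge0// ltW.
Qed.

Lemma Ck_coord n k (U : set 'rV[R]_n) j : Ck k U (fun u : 'rV[R]_n => u ord0 j).
Proof.
have g (u : 'rV[R]_n) := has_grad_coord j u.
case: k => [|k]; split => //; try by move=> u _; exact: has_grad_continuous (g u).
split => [i u _|i]; first by have [] := has_grad_derive i (g u).
rewrite (_ : 'D_(delta_mx ord0 i) _ = (fun=> (delta_mx ord0 j : 'rV[R]_n) ord0 i)).
  exact: Ck_cst.
by apply/funext => u; have [_ ->] := has_grad_derive i (g u).
Qed.

Variables (m : nat) (K : set 'rV[R]_m.+1).
Hypotheses (cK : compact K) (vK : cvx K).
Local Notation M := (frontier K).
Hypotheses (hM : smooth_hypersurface M).
Variable v : 'rV[R]_m.+1.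
Hypothesis v0 : v ord0 ord0 != 0.

(** The coordinates of the projection along [v] as vectors, so that [derive_dotv] and
    [smooth_on_dotv] apply to them. *)
Definition proj_row (j : 'I_m) : 'rV[R]_m.+1 :=
  delta_mx ord0 (lift ord0 j) - (v ord0 (lift ord0 j) / v ord0 ord0) *: delta_mx ord0 ord0.

(* Projection onto the hyperplane [z_0 = 0] along [v]. *)
Definition proj (z : 'rV[R]_m.+1) : 'rV[R]_m := \row_j dotv (proj_row j) z.

Definition line (y : 'rV[R]_m) (t : R) : 'rV[R]_m.+1 := rV_cons (0, y) + t *: v.

Lemma projE z j : proj z ord0 j =
  z ord0 (lift ord0 j) - (v ord0 (lift ord0 j) / v ord0 ord0) * z ord0 ord0.
Proof. by rewrite mxE dotvC dotvBr dotvZr !dotv_delta. Qed.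

Lemma line0 y t : line y t ord0 ord0 = t * v ord0 ord0.
Proof. by rewrite mxE rV_cons0 mxE add0r. Qed.

Lemma lineS y t j : line y t ord0 (lift ord0 j) = y ord0 j + t * v ord0 (lift ord0 j).
Proof. by rewrite mxE rV_consS mxE. Qed.

Lemma proj_line y t : proj (line y t) = y.
Proof.
by apply/rowP => j; have := v0; rewrite projE line0 lineS => h; field.
Qed.

Lemma line_proj z : line (proj z) (z ord0 ord0 / v ord0 ord0) = z.
Proof.
have h := v0; apply/rowP => j; case: (unliftP ord0 j) => [i ->|->].
  by rewrite lineS projE; field.
by rewrite line0 divfK.
Qed.

Lemma line_conv y t s l : line y t + l *: (line y s - line y t) = line y (t + l * (s - t)).
Proof. by apply/rowP => j; rewrite !mxE; ring. Qed.

Lemma line_sub y t s : line y t - s *: v = line y (t - s).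
Proof. by rewrite /line -addrA -scalerBl. Qed.

Lemma continuous_line t : continuous (line^~ t).
Proof.
move=> y; apply: continuous_coords => j; case: (unliftP ord0 j) => [i ->|->].
  rewrite (_ : (fun _ => _) = (fun y : 'rV[R]_m => y ord0 i + t * v ord0 (lift ord0 i))).
    by apply: continuousD; [exact: coord_continuous|exact: cst_continuous].
  by apply/funext => y'; rewrite lineS.
rewrite (_ : (fun _ => _) = cst (t * v ord0 ord0)); first exact: cst_continuous.
by apply/funext => y'; rewrite line0.
Qed.

Lemma continuous_line_param y : continuous (line y).
Proof.
move=> t; apply: cvgD; first exact: cvg_cst.
by apply: cvgZl; exact: cvg_id.
Qed.

(** Only lines through the interior of [K] count: the shadow is then open, and over each of its
    points the line leaves [K] transversally, as a smooth chart requires. *)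
Definition shadow : set 'rV[R]_m := [set y | exists t, K° (line y t)].

Definition top_height (y : 'rV[R]_m) : R :=
  xget 0 [set t | K (line y t) /\ forall s, K (line y s) -> s <= t].

Definition top_point y := line y (top_height y).

(** Phrased with the interior to be an open condition. On the boundary it amounts to a positive
    product of [v] with the outer normal, by [topmost_normal] and [normal_topmost]. *)
Definition topmost z := exists2 s : R, 0 < s & K° (z - s *: v).

Lemma shadow_open : open shadow.
Proof.
rewrite (_ : shadow = \bigcup_t (line^~ t @^-1` K°)); last first.
  by apply/seteqP; split => [y [t h]|y [t _ h]]; exists t.
apply: bigcup_open => t _; apply: open_comp => [y _|]; last exact: open_interior.
exact: continuous_line.
Qed.

Lemma topmost_open : open [set z | topmost z].
Proof.
rewrite (_ : mkset _ = \bigcup_(s in [set s : R | 0 < s]) ((fun z : 'rV[R]_m.+1 => z - s *: v) @^-1` K°)).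
  apply: bigcup_open => t _; apply: open_comp => [y _|]; last exact: open_interior.
  have c : continuous (fun z : 'rV[R]_m.+1 => z - t *: v).
    move=> z; apply: (@continuousB _ _ _ id (fun=> t *: v)); first by move=> A.
    exact: cst_continuous.
  exact: c.
by apply/seteqP; split => [z [s s0 h]|z [s s0 h]]; exists s.
Qed.

Lemma top_heightP y : shadow y ->
  K (top_point y) /\ forall s, K (line y s) -> s <= top_height y.
Proof.
move=> [t0 /interior_subset Kt0].
pose S := [set t | K (line y t)].
have cS : compact S.
  have [B [_ BK]] := compact_bounded cK.
  have KB x : K x -> `|x| <= B + 1 by apply: BK; rewrite ltrDl.
  apply: (@subclosed_compact _ _ `[(- ((B + 1) / `|v ord0 ord0|)), ((B + 1) / `|v ord0 ord0|)]).
  - apply: (preimage_closed (f := line y) (D := K)); last exact: compact_closed_rV.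
    by move=> t _; exact: continuous_line_param.
  - exact: segment_compact.
  - move=> t /= /KB Kt; rewrite in_itv/= -ler_norml ler_pdivlMr ?normr_gt0//.
    by rewrite -normrM -(line0 y); apply: le_trans Kt; exact: ler_coord_norm.
have ci : {within S, continuous (@id R)} by apply: continuous_subspaceT => z; exact: cvg_id.
have [t /set_mem St tm] := compact_EVT_max (ex_intro _ t0 Kt0) cS ci.
apply: (@xgetPex _ 0 [set t | K (line y t) /\ forall s, K (line y s) -> s <= t]).
by exists t; split => // s Ks; exact: (tm s (mem_set Ks)).
Qed.

Lemma top_point_frontier y : shadow y -> M (top_point y) /\ topmost (top_point y).
Proof.
move=> sy; have [Kt tmax] := top_heightP sy.
have Mt : M (top_point y).
  apply/frontierP => //; split => // /(interior_ball)[e e0 eK].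
  have vn : 0 < `|v|.
    by rewrite normr_gt0; apply: contra v0 => /eqP ->; rewrite mxE.
  have := eK ((e / (2 * `|v|)) *: v).
  rewrite normrZ gtr0_norm ?divr_gt0 ?mulr_gt0//.
  have -> : e / (2 * `|v|) * `|v| = e / 2 by field; rewrite gt_eqF.
  rewrite /top_point /line -addrA -scalerDl => /(_ ltac:(lra)) /tmax.
  have : 0 < e / (2 * `|v|) by rewrite divr_gt0// mulr_gt0.
  by move=> h1 h2; lra.
split => //; have [t0 Kt0] := sy.
have le : t0 <= top_height y by apply: tmax; exact: interior_subset.
have ne : t0 != top_height y.
  by apply/eqP => E; move/frontierP : Mt => /(_ cK)[_]; apply; rewrite /top_point -E.
exists (top_height y - t0); first by rewrite subr_gt0 lt_neqAle ne.
by rewrite line_sub opprB addrC subrK.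
Qed.

(** If the line went on in [K] above [z], then [z] would lie strictly between a point of [K] and the
    interior point [z - s *: v], hence be interior. *)
Lemma topmost_top_point z : M z -> topmost z -> shadow (proj z) /\ top_point (proj z) = z.
Proof.
move=> Mz [s s0 Ks]; set t := z ord0 ord0 / v ord0 ord0.
have zE : line (proj z) t = z := line_proj z.
have sz : shadow (proj z) by exists (t - s); rewrite -line_sub zE.
have [Kt tmax] := top_heightP sz.
split => //; rewrite -[RHS]zE; congr line; apply/eqP; rewrite eq_le.
have /(frontierP cK)[Kz nKz] := Mz.
rewrite (tmax t) ?zE// andbT leNgt; apply/negP => tlt.
apply: nKz.
have d0 : 0 < top_height (proj z) - t + s by rewrite addr_gt0// subr_gt0.
have r0 : 0 < (top_height (proj z) - t) / (top_height (proj z) - t + s).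
  by rewrite divr_gt0// subr_gt0.
have r1 : (top_height (proj z) - t) / (top_height (proj z) - t + s) <= 1.
  by rewrite ler_pdivrMr// mul1r lerDl ltW.
have := interior_segment vK Kt Ks r0 r1.
have zs : z - s *: v = line (proj z) (t - s) by rewrite -line_sub zE.
rewrite zs /top_point line_conv -[X in _ -> K° X]zE; congr (K° (line _ _)).
by field; rewrite gt_eqF.
Qed.

(** From below, a point slightly under the top is interior and remains so on nearby lines. From
    above, a point over the top lies in the open complement of [K]; by convexity nearby lines cannot
    reach beyond it. *)
Lemma top_height_continuous y : shadow y -> {for y, continuous top_height}.
Proof.
move=> sy; have [Kt tmax] := top_heightP sy; have [_ [s s0 Ks]] := top_point_frontier sy.
apply/continuous_rVP => e e0.
pose d := Num.min e s.
have d0 : 0 < d by rewrite lt_min e0.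
have low : K° (line y (top_height y - d)).
  have ds0 : 0 < d / s by rewrite divr_gt0.
  have ds1 : d / s <= 1 by rewrite ler_pdivrMr// mul1r ge_min lexx orbT.
  have := interior_segment vK Kt Ks ds0 ds1.
  by rewrite /top_point line_sub line_conv; congr (K° (line _ _)); field; rewrite gt_eqF.
have high : ~ K (line y (top_height y + e)) by move=> /tmax; lra.
have oKC : open (~` K) by apply: closed_openC; exact: compact_closed_rV.
have n1 : \forall y' \near y, K° (line y' (top_height y - d)).
  exact: (@continuous_line _ y _ (open_nbhs_nbhs (conj (@open_interior _ K) low))).
have n2 : \forall y' \near y, ~ K (line y' (top_height y + e)).
  exact: (@continuous_line _ y _ (open_nbhs_nbhs (conj oKC high))).
have [r/= r0 rH] := (nbhs_ballP y _).1 (filterI n1 n2).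
exists (r / 2); first by lra.
move=> h hr; have [|K1 K2] := rH (y + h).
  by rewrite -ball_normE /ball_/= opprD addrA subrr sub0r normrN; lra.
have sh : shadow (y + h) by exists (top_height y - d).
have [Kh hmax] := top_heightP sh.
have h1 : top_height y - d <= top_height (y + h) by apply: hmax; exact: interior_subset.
have de : d <= e by rewrite ge_min lexx.
have h2 : top_height (y + h) <= top_height y + e.
  rewrite leNgt; apply/negP => lt2; apply: K2.
  set a := top_height y - d in K1 h1 *; set b := top_height (y + h) in lt2 h1 Kh.
  have ab : 0 < b - a by rewrite /a; lra.
  have l0 : 0 <= (top_height y + e - a) / (b - a).
    by apply: divr_ge0; [rewrite /a; lra|exact: ltW].
  have l1 : (top_height y + e - a) / (b - a) <= 1 by rewrite ler_pdivrMr//; lra.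
  have := vK (interior_subset K1) Kh l0 l1; rewrite /top_point line_conv.
  by congr (K (line _ _)); rewrite divfK ?gt_eqF// addrC subrK.
by rewrite ler_norml; apply/andP; split; lra.
Qed.

Lemma top_point_continuous y : shadow y -> {for y, continuous top_point}.
Proof.
move=> sy; apply: continuous_coords => j.
have cv (c : R) : {for y, continuous (fun y => top_height y * c)}.
  by apply: continuousM; [exact: top_height_continuous|exact: cst_continuous].
case: (unliftP ord0 j) => [i ->|->].
  rewrite (_ : (fun _ => _) = (fun y : 'rV[R]_m => y ord0 i + top_height y * v ord0 (lift ord0 i))).
    by apply: continuousD => //; exact: coord_continuous.
  by apply/funext => y'; rewrite lineS.
rewrite (_ : (fun _ => _) = (fun y => top_height y * v ord0 ord0)) //.
by apply/funext => y'; rewrite line0.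
Qed.

Lemma topmost_normal z nu : topmost z -> sphere m.+1 nu ->
  (forall x, K x -> dotv nu x <= dotv nu z) -> 0 < dotv nu v.
Proof.
move=> [s s0 Ks] Snu sup; have := interior_strict Snu sup Ks.
by rewrite dotvBr dotvZr => h; rewrite -(pmulr_rgt0 _ s0); lra.
Qed.

(** A tangent vector killed by the projection is a multiple of [v]; it is orthogonal to the
    supporting normal, which has positive product with [v], so it is 0. *)
Lemma proj_jacobian_unit U X u : @local_parametrization R m.+1 M U X -> U u ->
  topmost (X u) ->
  \matrix_(i < m, j < m) 'D_(delta_mx ord0 i) (fun u : 'rV[R]_m => proj (X u) ord0 j) u
    \in unitmx.
Proof.
move=> lp Uu tu; have [oU sX rf _ _] := lp.
have [nu Snu sup] := supporting_normal cK vK (parametrization_sub lp Uu).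
have nv := topmost_normal tu Snu sup.
rewrite -row_free_unit; apply: inj_row_free => a aJ.
set w := a *m tangent_frame X u.
have wE i : dotv i w = \sum_j a ord0 j * dotv i (partial j X u).
  by rewrite dotv_mulmx; apply: eq_bigr => j _; rewrite rowK.
have pw : proj w = 0.
  apply/rowP => j; move/rowP/(_ j): aJ; rewrite !mxE wE => aJ; rewrite -[RHS]aJ.
  apply: eq_bigr => i _; rewrite !mxE; congr (_ * _).
  have [_ <-] := derive_dotv (proj_row j) (smooth_on_derivable (i := i) sX Uu).
  by under [in RHS]eq_fun do rewrite mxE.
have wv : w = (w ord0 ord0 / v ord0 ord0) *: v.
  rewrite -[LHS]line_proj pw /line (_ : rV_cons _ = 0) ?add0r//.
  by apply/rowP => j; case: (unliftP ord0 j) => [i ->|->]; rewrite ?rV_consS ?rV_cons0 !mxE.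
have nw : dotv nu w = 0.
  rewrite wE big1// => j _; rewrite (support_tangent cK _ lp Uu) ?mulr0// => x; exact: sup.
move: nw; rewrite wv dotvZr => /eqP; rewrite mulf_eq0 (gt_eqF nv) orbF => /eqP c0.
have w0 : w = 0 by rewrite wv c0 scale0r.
by apply/eqP; rewrite -(mulmx_free_eq0 _ (rf u Uu)); apply/eqP.
Qed.

(** Near [y0] take any chart [X1] through the top point. The chart followed by the projection, [F],
    has invertible Jacobian on the topmost part, and its inverse [G] is the parameter of the top
    point. The height is the first coordinate of [X1] at [G y], over [v ord0 ord0], so
    [inverse_comp_Ck] applies. *)
Lemma top_height_Ck k : Ck k shadow top_height.
Proof.
apply: Ck_local => y0 sy0; have [M0 t0] := top_point_frontier sy0.
have [U1 [X1 [lp [u0 Uu0 Xu0]]]] : exists (U : set 'rV[R]_m) (X : 'rV[R]_m -> 'rV[R]_m.+1),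
    @local_parametrization R m.+1 M U X /\ (X @` U) (top_point y0) := hM M0.
have [oU1 sX1 rf inj hom] := lp.
have cX1 u : U1 u -> {for u, continuous X1} by exact: smooth_on_continuous.
pose U2 := U1 `&` X1 @^-1` [set z | topmost z].
have oU2 : open U2 by apply: open_preimage_on => //; exact: topmost_open.
have [V1 oV1 E1] := hom U2 oU2 (@subIsetl _ _ _).
pose W := shadow `&` top_point @^-1` V1.
have oW : open W := open_preimage_on shadow_open (@top_point_continuous) oV1.
have exG y : W y -> exists u, U2 u /\ X1 u = top_point y.
  move=> [sy Vy]; have : (X1 @` U2) (top_point y).
    by rewrite E1; exact: (conj (top_point_frontier sy).1 Vy).
  by move=> [u U2u ?]; exists u.
pose G y := xget 0 [set u | U2 u /\ X1 u = top_point y].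
have GP y : W y -> U2 (G y) /\ X1 (G y) = top_point y by move=> /exG; exact: xgetPex.
(* The chart sends neighbourhoods of [G y] to relatively open subsets of [M], and [top_point] is
   continuous: nearby top points have nearby parameters. *)
have cG y : W y -> {for y, continuous G}.
  move=> Wy A; have [[U1G tG] XG] := GP y Wy; rewrite nbhsE => -[B [oB BG] BA].
  have oB2 : open (B `&` U2) by exact: openI.
  have [V oV EV] := hom (B `&` U2) oB2 (subset_trans (@subIsetr _ _ _) (@subIsetl _ _ _)).
  have Vy : V (top_point y).
    have : (X1 @` (B `&` U2)) (top_point y) by exists (G y).
    by rewrite EV => -[].
  have : nbhs y (W `&` (shadow `&` top_point @^-1` V)).
    have oV2 := open_preimage_on shadow_open (@top_point_continuous) oV.
    exact: (open_nbhs_nbhs (conj (openI oW oV2) (conj Wy (conj Wy.1 Vy)))).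
  apply: filterS => y' [Wy' [sy' Vy']]; apply: BA.
  have : (X1 @` (B `&` U2)) (top_point y').
    by rewrite EV; exact: (conj (top_point_frontier sy').1 Vy').
  move=> [u' [Bu' [U1u' tu']] Xu']; have [[U1G' _] XG'] := GP y' Wy'.
  suff <- : u' = G y' by [].
  by apply: inj; rewrite ?inE// XG' Xu'.
pose F u := proj (X1 u).
have FG y : W y -> F (G y) = y by move=> /GP[_ XG]; rewrite /F XG proj_line.
have CF k' j : Ck k' U2 (fun u => F u ord0 j).
  apply: (@Ck_ext _ _ _ U2 (fun u => dotv (proj_row j) (X1 u))) => //.
    by move=> u _; rewrite /F mxE.
  by apply: (@Ck_sub _ _ _ U1); [exact: subIsetl|exact: smooth_on_dotv].
exists W; split => //.
  split => //=; have : (X1 @` U2) (top_point y0).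
    have tu0 : topmost (X1 u0) by rewrite Xu0.
    exact: (ex_intro2 _ _ u0 (conj Uu0 tu0) Xu0).
  by rewrite E1 => -[].
have := @inverse_comp_Ck _ _ F G U2 W oU2 oW (fun y Wy => (GP y Wy).1) cG FG CF _
  (fun u => X1 u ord0 ord0 * (v ord0 ord0)^-1) _ k.
move=> H; apply: Ck_ext (H _ _) => //.
- move=> y Wy; have [_ XG] := GP y Wy.
  by rewrite /= XG line0 mulfK.
- by move=> u [U1u tu]; exact: (proj_jacobian_unit lp U1u tu).
- move=> k'; apply: Ck_mul => //; last exact: Ck_cst.
  by apply: (@Ck_sub _ _ _ U1); [exact: subIsetl|exact: smooth_on_Ck].
Qed.

Lemma top_point_smooth : smooth_on shadow top_point.
Proof.
apply: Ck_smooth_on; first exact: shadow_open.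
have oS := shadow_open.
move=> j k; case: (unliftP ord0 j) => [i ->|->].
  apply: (@Ck_ext _ _ _ _ (fun y : 'rV[R]_m => y ord0 i + top_height y * v ord0 (lift ord0 i))) => //.
    by move=> y _; rewrite lineS.
  apply: Ck_add => //; first exact: Ck_coord.
  by apply: Ck_mul => //; [exact: top_height_Ck|exact: Ck_cst].
apply: (@Ck_ext _ _ _ _ (fun y : 'rV[R]_m => top_height y * v ord0 ord0)) => //.
  by move=> y _; rewrite line0.
by apply: Ck_mul => //; [exact: top_height_Ck|exact: Ck_cst].
Qed.

Lemma proj_partial y i : shadow y -> proj (partial i top_point y) = delta_mx ord0 i.
Proof.
move=> sy; apply/rowP => j; rewrite [LHS]mxE.
have [_ <-] := derive_dotv (proj_row j) (smooth_on_derivable (i := i) top_point_smooth sy).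
have -> : (fun x => dotv (proj_row j) (top_point x)) = (fun x : 'rV[R]_m => x ord0 j).
  by apply/funext => x; rewrite -[in RHS](proj_line x (top_height x)) mxE.
by have [_ ->] := has_grad_derive i (has_grad_coord j y); rewrite !mxE eq_sym.
Qed.

(** A single chart for the whole part of the boundary that faces [v]; the defining property of the
    surface measure is later applied to it. *)
Lemma top_point_parametrization : @local_parametrization R m.+1 M shadow top_point.
Proof.
split; first exact: shadow_open.
- exact: top_point_smooth.
- move=> y sy; apply: inj_row_free => a aT; apply/rowP => j.
  have := congr1 (fun z => dotv (proj_row j) z) aT.
  have -> : dotv (proj_row j) (a *m tangent_frame top_point y) =
      \sum_i a ord0 i * dotv (proj_row j) (partial i top_point y).
    by rewrite dotv_mulmx; apply: eq_bigr => i _; rewrite rowK.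
  have pE i : dotv (proj_row j) (partial i top_point y) = (i == j)%:R.
    by have /rowP/(_ j) := proj_partial i sy; rewrite !mxE eqxx /= eq_sym => ->.
  under eq_bigr do rewrite pE.
  have -> : \sum_i a ord0 i * (i == j)%:R = a ord0 j.
    rewrite (bigD1 j)//= eqxx mulr1 big1 ?addr0// => i /negbTE ->.
    by rewrite mulr0.
  by move=> ->; rewrite mxE -(scale0r (0 : 'rV[R]_m.+1)) dotvZr mul0r.
- by move=> y y' _ _ E; rewrite -(proj_line y (top_height y)) -/(top_point y) E proj_line.
move=> W oW Ws; exists ([set z | topmost z] `&` proj @^-1` W).
  apply: open_preimage_on => //; first exact: topmost_open.
  move=> z _; apply: continuous_coords => j.
  rewrite (_ : (fun _ => _) = dotv (proj_row j)); first exact: continuous_dotvl.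
  by apply/funext => t; rewrite mxE.
apply/seteqP; split => [_ [y Wy <-]|z [Mz [tz Wz]]].
  have [My ty] := top_point_frontier (Ws _ Wy).
  by split => //; split => //=; rewrite proj_line.
by have [_ E] := topmost_top_point Mz tz; exists (proj z).
Qed.

End graph_parametrization.

(** * The outer normal and the area element of the graph chart *)

Section normals.
Context {R : realType}.

Lemma dotv_mx n (x y : 'rV[R]_n) : x *m y^T = (dotv x y)%:M.
Proof.
apply/matrixP => i j; rewrite !mxE (ord1 i) (ord1 j) eqxx mulr1n.
by apply: eq_bigr => k _; rewrite mxE.
Qed.

Lemma first_form_gram m n (X : 'rV[R]_m -> 'rV[R]_n) u :
  first_form X u = tangent_frame X u *m (tangent_frame X u)^T.
Proof.
apply/matrixP => i j; rewrite !mxE; apply: eq_bigr => k _.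
by rewrite !mxE.
Qed.

Lemma gram_unit m n (B : 'M[R]_(m, n)) : row_free B -> B *m B^T \in unitmx.
Proof.
move=> fB; rewrite -row_free_unit; apply: inj_row_free => a aI.
have : dotv (a *m B) (a *m B) = 0.
  have := congr1 (fun z => (z *m a^T) ord0 ord0) aI.
  by rewrite mul0mx [RHS]mxE mulmxA -mulmxA -trmx_mul dotv_mx mxE eqxx mulr1n.
by move=> /dotv_eq0/eqP; rewrite mulmx_free_eq0// => /eqP.
Qed.

(* Multiplying the matrix with rows [v, B] by the transpose of the one with
   rows [nu, B] gives a block triangular matrix when [B nu^T = 0]. *)
Lemma det_gram_normal m (v nu : 'rV[R]_(1 + m)) (B : 'M[R]_(m, 1 + m)) :
  dotv nu nu = 1 -> B *m nu^T = 0 -> row_free B ->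
  \det (col_mx v B) ^+ 2 = dotv v nu ^+ 2 * \det (B *m B^T).
Proof.
move=> nn Bn fB; set I := B *m B^T.
have E1 : \det (col_mx v B) * \det (col_mx nu B) = dotv v nu * \det I.
  rewrite -[in X in _ * X]det_tr -det_mulmx tr_col_mx mul_col_row Bn.
  by rewrite det_ublock dotv_mx det_scalar1.
have E2 : \det (col_mx nu B) ^+ 2 = \det I.
  rewrite expr2 -[in X in _ * X]det_tr -det_mulmx tr_col_mx mul_col_row Bn.
  by rewrite det_ublock dotv_mx det_scalar1 nn mul1r.
have I0 : \det I != 0 by have := gram_unit fB; rewrite unitmxE unitfE.
apply: (mulIf I0); rewrite -[in LHS]E2 -exprMn E1 exprMn.
by rewrite (expr2 (\det I)) mulrA.
Qed.

(** Up to multiples of [v], the rows of [B] are the standard basis vectors after the first; row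
    operations remove these multiples. *)
Lemma det_line_frame m (v : 'rV[R]_(1 + m)) (B : 'M[R]_(m, 1 + m)) (t : 'cV[R]_m) :
  B = t *m v + row_mx 0 1%:M -> \det (col_mx v B) = v ord0 (lshift m ord0).
Proof.
move=> ->.
have -> : col_mx v (t *m v + row_mx 0 1%:M) =
    block_mx 1%:M 0 t 1%:M *m col_mx v (row_mx 0 1%:M).
  by rewrite mul_block_col !mul1mx mul0mx addr0.
rewrite det_mulmx det_lblock !det1 !mul1r.
rewrite -[v in LHS]hsubmxK -[col_mx _ _]/(block_mx _ _ _ _) det_ublock det1 mulr1.
by rewrite [lsubmx v]mx11_scalar det_scalar1 mxE.
Qed.

Variables (m : nat) (K : set 'rV[R]_m.+1).
Hypotheses (cK : compact K) (vK : cvx K).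
Local Notation M := (frontier K).
Hypotheses (hM : smooth_hypersurface M) (curv : nonvanishing_curvature M).
Variable c : 'rV[R]_m.+1.
Hypothesis Kc : K° c.

(** Both vectors annihilate the tangent frame, of rank [m], so they lie on one line; being unit
    vectors they differ by a sign, and the interior point [c] excludes opposite ones. *)
Lemma normal_unique p nu1 nu2 : M p -> sphere m.+1 nu1 -> sphere m.+1 nu2 ->
  (forall x, K x -> dotv nu1 x <= dotv nu1 p) ->
  (forall x, K x -> dotv nu2 x <= dotv nu2 p) -> nu1 = nu2.
Proof.
move=> Mp S1 S2 sup1 sup2.
have [U [X [lp [u Uu Xu]]]] : exists (U : set 'rV[R]_m) (X : 'rV[R]_m -> 'rV[R]_m.+1),
    @local_parametrization R m.+1 M U X /\ (X @` U) p := hM Mp.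
have [_ _ rf _ _] := lp; rewrite -Xu in sup1 sup2.
set B := tangent_frame X u.
have tan nu : (forall x, K x -> dotv nu x <= dotv nu (X u)) -> nu *m B^T = 0.
  move=> sup; apply/rowP => i; rewrite [RHS]mxE -(support_tangent cK i lp Uu sup).
  by rewrite mxE; apply: eq_bigr => k _; rewrite !mxE.
have nz (nu : 'rV[R]_m.+1) : sphere m.+1 nu -> nu != 0.
  move=> S; apply/eqP => nu0; move: S; rewrite /sphere/= nu0 /dotv big1 => [/eqP|i _].
    by rewrite eq_sym oner_eq0.
  by rewrite mxE mul0r.
have rk : \rank (kermx B^T) = 1%N.
  rewrite mxrank_ker mxrank_tr.
  by have /eqP -> := rf u Uu; rewrite subSnn.
have sub (nu : 'rV[R]_m.+1) : nu *m B^T = 0 -> (nu <= kermx B^T)%MS by move=> /eqP; rewrite sub_kermx.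
have r1 : \rank nu1 = 1%N by rewrite rank_rV nz.
have /eqmxP e1 : (nu1 == kermx B^T)%MS.
  by rewrite -(mxrank_leqif_eq (sub _ (tan _ sup1))) r1 rk.
have /sub_rVP[a nuE] : (nu2 <= nu1)%MS by rewrite e1; exact: sub (tan _ sup2).
have : a ^+ 2 = 1 by move: S2; rewrite /sphere/= nuE dotvZl dotvZr S1 mulr1.
move=> /eqP; rewrite sqrf_eq1 => /orP[/eqP a1|/eqP a1]; first by rewrite nuE a1 scale1r.
have h1 := interior_strict S1 sup1 Kc.
have := sup2 c (interior_subset Kc); rewrite nuE a1 !dotvZl !mulN1r lerN2 => h2.
by have := lt_le_trans h1 h2; rewrite ltxx.
Qed.

(** The value 0 off the frontier makes [Num.max 0 (dotv (normal p) v)] vanish there, so integrals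
    can run over the whole space. *)
Definition normal p : 'rV[R]_m.+1 :=
  xget 0 [set nu | [/\ M p, sphere m.+1 nu & forall x, K x -> dotv nu x <= dotv nu p]].

Lemma normalP p : M p -> sphere m.+1 (normal p) /\
  forall x, K x -> dotv (normal p) x <= dotv (normal p) p.
Proof.
move=> Mp; have [nu Snu sup] := supporting_normal cK vK Mp.
have := @xgetPex _ (0 : 'rV[R]_m.+1)
  [set nu | [/\ M p, sphere m.+1 nu & forall x, K x -> dotv nu x <= dotv nu p]].
by case; [exists nu|].
Qed.

Lemma normal_out p : ~ M p -> normal p = 0.
Proof. by move=> nM; rewrite /normal; case: xgetP => // y _ []. Qed.

(** Pairs of a boundary point and a unit vector supporting [K] there form a compact set; by
    uniqueness of the normal, the superlevel set is the projection of a closed part of it. This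
    yields the measurability of [normal]. *)
Lemma compact_normal_coord (r : R) i :
  compact [set p | M p /\ r <= normal p ord0 i].
Proof.
pose A := (M `*` sphere m.+1) `&` ([set z : 'rV[R]_m.+1 * 'rV[R]_m.+1 | r <= z.2 ord0 i] `&`
  \bigcap_(x in K) [set z : 'rV[R]_m.+1 * 'rV[R]_m.+1 | dotv z.2 x <= dotv z.2 z.1]).
have cA : compact A.
  apply: compact_closedI.
    by apply: compact_setX; [exact: compact_frontier|exact: sphere_compact].
  apply: closedI.
    have : closed ((fun z : 'rV[R]_m.+1 * 'rV[R]_m.+1 => z.2 ord0 i) @^-1` [set x : R | r <= x]).
      apply: preimage_closed; last exact: closed_ge.
      by move=> z _; exact: (continuous_comp cvg_snd (@coord_continuous R 1 m.+1 ord0 i _)).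
    by [].
  apply: closed_bigI => x _.
  have : closed ((fun z : 'rV[R]_m.+1 * 'rV[R]_m.+1 => dotv z.2 z.1 - dotv z.2 x) @^-1`
      [set y : R | 0 <= y]).
    apply: preimage_closed; last exact: closed_ge.
    move=> z _.
    have cz : {for z, continuous (fun z : 'rV[R]_m.+1 * 'rV[R]_m.+1 => dotv z.2 z.1 - dotv z.2 x)}.
      apply: continuousB.
        by apply: continuous_dotv; [exact: cvg_snd|exact: cvg_fst].
      by apply: continuous_dotv; [exact: cvg_snd|exact: cst_continuous].
    exact: cz.
  by congr closed; apply/seteqP; split => z /=; rewrite subr_ge0.
rewrite (_ : mkset _ = fst @` A).
  apply: continuous_compact => //; apply: continuous_subspaceT => z; exact: cvg_fst.
apply/seteqP; split => [p [Mp rp]|_ [[p nu] [[/= Mp Snu] [/= rnu sup]] <-]].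
  have [S sup] := normalP Mp.
  by exists (p, normal p).
split => //; have [S sup'] := normalP Mp.
by rewrite (normal_unique Mp S Snu sup' sup).
Qed.

Lemma measurable_normal : measurable_fun setT normal.
Proof.
apply: measurable_fun_coordP => i; apply: (measurability _ (RGenCInfty.measurableE R)) => //.
move=> _ [_ [r ->] <-]; rewrite setTI.
have mA : measurable [set p | M p /\ r <= normal p ord0 i].
  by apply: compact_measurable_rV; exact: compact_normal_coord.
have mM : measurable M by apply: compact_measurable_rV; exact: compact_frontier.
(* For [r <= 0] the superlevel set also contains everything off [M], where [normal] is 0. *)
have [r0|r0] := leP r 0.
  rewrite (_ : _ @^-1` _ = ~` M `|` [set p | M p /\ r <= normal p ord0 i]).
    by apply: measurableU => //; exact: measurableC.
  apply/seteqP; split => p /=; rewrite in_itv/= andbT.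
    by move=> h; have [Mp|nMp] := pselect (M p); [right|left].
  by move=> [nMp|[]//]; rewrite normal_out// mxE.
rewrite (_ : _ @^-1` _ = [set p | M p /\ r <= normal p ord0 i])//.
apply/seteqP; split => p /=; rewrite in_itv/= andbT; last by case.
move=> h; have [//|nMp] := pselect (M p).
by move: h; rewrite normal_out// mxE leNgt r0.
Qed.

Section direction.
Variable v : 'rV[R]_m.+1.
Hypothesis v0 : v ord0 ord0 != 0.

(** Some [p - s *: v] with [s > 0] cannot be separated from [K]: each unit vector other than the
    normal takes a larger value on [K] than at [p], the normal itself decreases along [- v], and
    compactness of the sphere makes [s] uniform. Strict convexity then puts the midpoint in the
    interior. *)
Lemma normal_topmost p : M p -> 0 < dotv (normal p) v -> topmost K v p.
Proof.
move=> Mp nv; have [Sn sup] := normalP Mp.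
have := (compact_near_coveringP _).1 (@sphere_compact R m.+1) _ (0 : R)^'+
  (fun s nu => exists2 x, K x & dotv nu (p - s *: v) <= dotv nu x).
have h nu : sphere m.+1 nu -> \forall nu' \near nu & s \near (0 : R)^'+,
    exists2 x, K x & dotv nu' (p - s *: v) <= dotv nu' x.
  move=> Snu; have [E|nE] := eqVneq nu (normal p).
    have /cvgr_gt H : {for nu, continuous (fun n : 'rV[R]_m.+1 => dotv n v)}.
      by apply: continuous_dotv; [move=> A|exact: cst_continuous].
    exists ([set n : 'rV[R]_m.+1 | 0 < dotv n v], [set s : R | 0 < s]) => /=.
      by split; [apply: H; rewrite E|exact: nbhs_right_gt].
    move=> [n s] /= [nv' s0]; exists p; first by have [] := (frontierP cK p).1 Mp.
    by rewrite dotvBr dotvZr lerBlDr lerDl mulr_ge0// ltW.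
  have [x Kx nux] : exists2 x, K x & dotv nu p < dotv nu x.
    apply: contrapT => nex; move/eqP : nE; apply.
    apply: (normal_unique Mp Snu Sn) => // x Kx.
    by rewrite leNgt; apply/negP => lt; apply: nex; exists x.
  have c1 : {for (nu, 0 : R), continuous (fun z : 'rV[R]_m.+1 * R =>
      dotv z.1 x - dotv z.1 (p - z.2 *: v))}.
    apply: continuousB.
      by apply: continuous_dotv; [exact: cvg_fst|exact: cst_continuous].
    apply: continuous_dotv; first exact: cvg_fst.
    apply: continuousB; first exact: cst_continuous.
    by apply: continuousZl; exact: cvg_snd.
  have : \forall z \near (nu, 0 : R), 0 < dotv z.1 x - dotv z.1 (p - z.2 *: v).
    by apply: (cvgr_gt _ c1); rewrite scale0r subr0 subr_gt0.
  move=> [[A B] /= [An Bn] AB]; exists (A, B) => /=; first by split => //; exact: cvg_within Bn.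
  move=> [n s] /= [An' Bs]; exists x => //; have := AB (n, s) (conj An' Bs) => /=.
  by rewrite subr_gt0 => /ltW.
move=> /(_ _ h) near0.
have [s [s0 Hs]] : exists s : R, 0 < s /\
    (forall nu, sphere m.+1 nu -> exists2 x, K x & dotv nu (p - s *: v) <= dotv nu x).
  near (0 : R)^'+ => s; exists s; split; first by near: s; exact: nbhs_right_gt.
  by near: s.
have Kps : K (p - s *: v).
  apply: contrapT => nK.
  have [nu Snu sep] := cvx_separation cK vK nK (ex_intro _ c (interior_subset Kc)).
  have [x Kx h1] := Hs nu Snu; have := sep x Kx => h2.
  by have := lt_le_trans h2 h1; rewrite ltxx.
have vn : v != 0 by apply: contra v0 => /eqP ->; rewrite mxE.
have ps : p != p - s *: v.
  rewrite -subr_eq0 opprB addrC subrK scaler_eq0 negb_or vn andbT gt_eqF//.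
exists (s / 2); first by rewrite divr_gt0.
have Kp := ((frontierP cK p).1 Mp).1.
have := strict_midpoint cK vK (no_segment cK vK hM curv) Kp Kps ps.
by congr (K° _); apply/rowP => i; rewrite !mxE; field.
Unshelve. all: by end_near. Qed.

(** The determinant of the tangent frame completed by [v], computed twice up to sign: through the
    Gram matrix it is the area element times the product of normal and [v], through the projection
    along [v] it is [v ord0 ord0]. *)
Lemma sqrt_det_first_form y : shadow K v y ->
  Num.sqrt (\det (first_form (top_point K v) y)) * dotv (normal (top_point K v y)) v =
  `|v ord0 ord0|.
Proof.
move=> sy; have [My ty] := top_point_frontier cK v0 sy.
have [Sn sup] := normalP My; have nv := topmost_normal ty Sn sup.
have lp := top_point_parametrization cK vK hM v0; have [oS sX rf _ _] := lp.
set X := top_point K v; set B : 'M[R]_(m, 1 + m) := tangent_frame X y.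
have Bn : B *m (normal (X y))^T = 0.
  apply/colP => i; rewrite [RHS]mxE -(support_tangent cK i lp sy sup).
  by rewrite mxE; apply: eq_bigr => k _; rewrite !mxE mulrC.
have := @det_gram_normal m v _ B Sn Bn (rf y sy).
rewrite (@det_line_frame m v B (\col_i (partial i X y ord0 ord0 / v ord0 ord0))); last first.
  apply/row_matrixP => i; rewrite [row i B]rowK.
  rewrite -[LHS](line_proj v0) (proj_partial cK vK hM v0)//.
  rewrite /line addrC linearD/=; congr (_ + _).
    by apply/rowP => j; rewrite !mxE big_ord1 !mxE.
  rewrite /rV_cons/= row_row_mx row0 row1; congr row_mx.
  by apply/rowP => j; rewrite !mxE mul0rn.
have -> : lshift m ord0 = ord0 :> 'I_(1 + m) by apply: val_inj.
rewrite first_form_gram -/X -/B => E.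
have D0 : 0 <= \det (B *m B^T).
  rewrite -(@pmulr_rge0 _ (dotv v (normal (X y)) ^+ 2)) -?E ?sqr_ge0//.
  by rewrite exprn_gt0// dotvC.
rewrite -[RHS]sqrtr_sqr E dotvC sqrtrM ?sqr_ge0// sqrtr_sqr dotvC mulrC.
by rewrite gtr0_norm// dotvC.
Qed.

End direction.
End normals.

(** * Integration through a density *)

Section density.
Context {R : realType}.
Import HBNNSimple.
Local Open Scope ereal_scope.

(** From sets to functions by simple functions and monotone convergence; meant for the graph chart
    [phi] and its area element [g]. *)
Lemma ge0_integral_density d1 d2 (T1 : measurableType d1) (T2 : measurableType d2)
    (mu : {measure set T1 -> \bar R}) (nu : {measure set T2 -> \bar R})
    (D : set T1) (E : set T2) (phi : T1 -> T2) (g : T1 -> R) (h : T2 -> R) :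
  measurable D -> measurable E -> measurable_fun D phi -> measurable_fun D g ->
  (forall x, D x -> (0 <= g x)%R) -> (forall x, D x -> E (phi x)) ->
  (forall A, measurable A -> A `<=` E ->
    nu A = \int[mu]_(x in D `&` phi @^-1` A) (g x)%:E) ->
  measurable_fun E h -> (forall y, E y -> (0 <= h y)%R) ->
  \int[nu]_(y in E) (h y)%:E = \int[mu]_(x in D) (h (phi x) * g x)%:E.
Proof.
move=> mD mE mphi mg g0 DE nuE mh h0.
have mh' : measurable_fun E (EFin \o h) by exact/measurable_EFinP.
pose f_ := nnsfun_approx mE mh'.
have h0' y : E y -> 0 <= (EFin \o h) y by move=> Ey; rewrite lee_fin h0.
have mD' A : measurable A -> measurable (D `&` phi @^-1` A) by move=> mA; exact: mphi.
transitivity (limn (fun n => \int[nu]_(y in E) (f_ n y)%:E)).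
  rewrite -monotone_convergence//.
  - apply: eq_integral => y /[!inE] yE; apply/esym/cvg_lim => //.
    exact: (cvg_nnsfun_approx mE mh' h0').
  - by move=> n; exact/measurable_EFinP/measurable_funTS.
  - by move=> n y _; rewrite lee_fin.
  - by move=> y _ m n mn; rewrite lee_fin; exact/lefP/nd_nnsfun_approx.
have mfg n : measurable_fun D (fun x => f_ n (phi x)).
  apply: (measurable_comp (F := setT)) => //.
have mfn n r : measurable (f_ n @^-1` [set r]) by exact: measurable_sfunP.
rewrite [X in limn X](_ : _ = (fun n => \int[mu]_(x in D) (f_ n (phi x) * g x)%:E)).
  rewrite -monotone_convergence//; last 3 first.
    - by move=> n /=; apply/measurable_EFinP; exact: measurable_funM.
    - by move=> n x Dx /=; rewrite lee_fin mulr_ge0// g0.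
    - move=> x Dx m n mn; rewrite lee_fin ler_wpM2r ?g0//.
      by apply/lefP/nd_nnsfun_approx.
  apply: eq_integral => x /[!inE] Dx /=; apply/cvg_lim => //.
  under eq_fun do rewrite EFinM; rewrite EFinM.
  apply: cvgeM => //; last exact: cvg_cst.
  exact: (cvg_nnsfun_approx mE mh' h0' (DE x Dx)).
apply/funext => n.
transitivity (\sum_(k \in range (f_ n))
    \int[nu]_(y in E) (k * \1_(f_ n @^-1` [set k]) y)%:E).
  under eq_integral do rewrite fimfunE -fsumEFin//.
  rewrite ge0_integral_fsum//.
  - by move=> y; apply/measurable_EFinP; apply: measurable_funM => //; exact: measurable_indic.
  - by move=> y x _; rewrite nnfun_muleindic_ge0.
have fgE x : (f_ n (phi x) * g x)%:E =
    \sum_(k \in range (f_ n)) (k * \1_(f_ n @^-1` [set k]) (phi x) * g x)%:E.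
  rewrite fimfunE fsumEFin//; congr EFin.
  by rewrite !fsbig_finite//= mulr_suml.
have k0 k x : D x -> 0 <= (k * \1_(f_ n @^-1` [set k]) (phi x) * g x)%:E.
  move=> Dx; rewrite EFinM mule_ge0 ?lee_fin ?g0//.
  by have := nnfun_muleindic_ge0 (f_ n) k (phi x); rewrite -EFinM lee_fin.
under [in RHS]eq_integral do rewrite fgE.
have mi k : measurable_fun D (fun x => \1_(f_ n @^-1` [set k]) (phi x) : R).
  by apply: (measurable_comp (F := setT)) => //; exact: measurable_indic.
rewrite ge0_integral_fsum//; last first.
  move=> k; apply/measurable_EFinP; apply: measurable_funM => //.
  exact: measurable_funM.
apply: eq_fsbigr => k _.
have [klt|kge] := ltP k 0%R.
  rewrite preimage_nnfun0// !integral0_eq// => x _; rewrite indicE in_set0 ?mulr0 ?mul0r//.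
rewrite (integralZl_indic mE (fun k => f_ n @^-1` [set k]))//; last by move=> ?; rewrite preimage_nnfun0.
rewrite integral_indic// setIC nuE; [|exact: measurableI|exact: subIsetl].
under [in RHS]eq_integral do rewrite -mulrA EFinM.
rewrite ge0_integralZl//; last 2 first.
- by apply/measurable_EFinP; exact: measurable_funM.
- by move=> x Dx; rewrite lee_fin mulr_ge0 ?g0//.
congr (_ * _).
have -> : D `&` phi @^-1` (E `&` f_ n @^-1` [set k]) = D `&` [set x | f_ n (phi x) = k].
  by apply/seteqP; split => x /= [Dx]; [move=> []|move=> ?; do ?split => //; exact: DE].
rewrite integral_mkcondr; apply: eq_integral => x _; rewrite patchE indicE.
have -> : (x \in [set x | f_ n (phi x) = k]) = (phi x \in f_ n @^-1` [set k]).
  by apply/idP/idP; rewrite !inE.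
by case: ifP => _; rewrite ?mul1r ?mul0r.
Qed.

End density.

(** * Cauchy's projection formula and finiteness of the surface measure *)

Section cauchy.
Context {R : realType}.

Lemma measurable_fun_coord_on d (T : measurableType d) n (D : set T) (f : T -> 'rV[R]_n) :
  measurable D -> (forall i, measurable_fun D (fun x => f x ord0 i)) ->
  measurable_fun D f.
Proof.
move=> mD mf; pose g x : 'rV[R]_n := if x \in D then f x else 0.
apply: (eq_measurable_fun g) => [x xD|]; first by rewrite /g xD.
apply: measurable_funTS; apply: measurable_fun_coordP => i.
have /(measurable_restrictT _ mD) := mf i; apply: eq_measurable_fun => x _.
by rewrite patchE /g; case: ifP => // _; rewrite mxE.
Qed.

Lemma continuous_measurable_rV n (D : set 'rV[R]_n) (f : 'rV[R]_n -> R) :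
  open D -> (forall x, D x -> {for x, continuous f}) -> measurable_fun D f.
Proof.
move=> oD cf; have mD := open_measurable_rV oD.
apply: (measurability _ (RGenOpens.measurableE R)) => //.
move=> _ [_ [a [b ->] <-]]; apply: open_measurable_rV.
rewrite openE => x [Dx fx]; apply: filterI; first exact: open_nbhs_nbhs.
by apply: (cf x Dx); apply: open_nbhs_nbhs; split => //; exact: interval_open.
Qed.

Variables (m : nat) (K : set 'rV[R]_m.+1).
Hypotheses (cK : compact K) (vK : cvx K).
Local Notation M := (frontier K).
Hypotheses (hM : smooth_hypersurface M) (curv : nonvanishing_curvature M).
Variable c : 'rV[R]_m.+1.
Hypothesis Kc : K° c.
Variable sigma : {measure set 'rV[R]_m.+1 -> \bar R}.
Hypothesis hs : @is_surface_measure R m.+1 M sigma.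
Local Notation normal := (normal K).

Lemma measurable_dotv_normal v : measurable_fun setT (fun p => dotv (normal p) v).
Proof.
apply: measurable_dotv; last exact: measurable_cst.
exact: (measurable_normal cK vK hM Kc).
Qed.

Lemma measurable_frontier : measurable M.
Proof. by apply: compact_measurable_rV; exact: compact_frontier. Qed.

(** The chart over the shadow covers exactly the boundary points whose normal has positive product
    with [v]. There the area element is the absolute value of [v ord0 ord0] divided by that product,
    so the integrand cancels to a constant on the shadow. *)
Lemma cauchy_projection (v : 'rV[R]_m.+1) : v ord0 ord0 != 0 ->
  (\int[sigma]_p (Num.max 0 (dotv (normal p) v))%:E =
   `|v ord0 ord0|%:E * lebesgue_rV m (shadow K v))%E.
Proof.
move=> v0; have mn := measurable_dotv_normal v.
pose E := M `&` [set p | 0 < dotv (normal p) v].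
have mE : measurable E.
  apply: measurableI; first exact: measurable_frontier.
  rewrite (_ : mkset _ = (fun p => dotv (normal p) v) @^-1` `]0, +oo[%classic).
    by rewrite -[X in measurable X]setTI; exact: mn.
  by apply/seteqP; split => p /=; rewrite in_itv/= andbT.
transitivity (\int[sigma]_(p in E) (dotv (normal p) v)%:E)%E.
  rewrite [RHS]integral_mkcond; apply: eq_integral => p _; rewrite patchE.
  case: ifPn => [/set_mem[_ /= p0]|]; first by rewrite max_r// ltW.
  rewrite notin_setE => nE; congr EFin; apply/max_l; rewrite leNgt; apply/negP => p0.
  apply: nE; split => //; apply: contrapT => nM; move: p0.
  by rewrite (normal_out nM) /dotv big1 ?ltxx// => i _; rewrite mxE mul0r.
have lp := top_point_parametrization cK vK hM v0.
have mS : measurable (shadow K v) by apply: open_measurable_rV; exact: shadow_open.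
have mt : measurable_fun (shadow K v) (top_point K v).
  apply: measurable_fun_coord_on => // i; apply: continuous_measurable_rV => [|y sy].
    exact: shadow_open.
  apply: (@continuous_comp _ _ _ (top_point K v) (fun z : 'rV[R]_m.+1 => z ord0 i)).
    exact: (top_point_continuous cK vK v0 sy).
  exact: coord_continuous.
have mtn : measurable_fun (shadow K v) (fun y => dotv (normal (top_point K v y)) v).
  exact: (measurableT_comp mn mt).
have pos y : shadow K v y -> 0 < dotv (normal (top_point K v y)) v.
  move=> sy; have [My ty] := top_point_frontier cK v0 sy.
  by have [Sn sup] := normalP cK vK My; exact: topmost_normal ty Sn sup.
have sqE y : shadow K v y -> Num.sqrt (\det (first_form (top_point K v) y)) =
    `|v ord0 ord0| / dotv (normal (top_point K v y)) v.
  move=> sy; rewrite -(sqrt_det_first_form cK vK hM v0 sy) mulfK// gt_eqF//; exact: pos.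
rewrite (@ge0_integral_density R _ _ _ _ (lebesgue_rV m) sigma (shadow K v) E (top_point K v)
  (fun y => Num.sqrt (\det (first_form (top_point K v) y))) (fun p => dotv (normal p) v)) //.
- rewrite -[RHS]integral_cst//; apply: eq_integral => y /[!inE] sy.
  by rewrite mulrC (sqrt_det_first_form cK vK hM v0 sy).
- apply: (eq_measurable_fun (fun y => `|v ord0 ord0| * (dotv (normal (top_point K v y)) v)^-1)).
    by move=> y /[!inE] sy; rewrite sqE.
  apply: measurable_funM => //.
  have mi : measurable_fun (`]0, +oo[%classic : set R) (fun x : R => x^-1).
    apply: open_continuous_measurable_fun; first exact: interval_open.
    move=> x; rewrite inE/= in_itv/= andbT => x0.
    by apply: inv_continuous; rewrite gt_eqF.
  apply: (measurable_comp _ _ mi mtn) => //.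
  by move=> _ [y sy <-]/=; rewrite in_itv/= andbT; exact: pos.
- by move=> y sy; split => /=; [exact: (top_point_frontier cK v0 sy).1|exact: pos].
- move=> A mA AE; apply: (hs.2 _ _ lp) => // p /AE[Mp np].
  have tp := normal_topmost cK vK hM curv Kc v0 Mp np.
  by have [sy <-] := topmost_top_point cK vK v0 Mp tp; exists (proj v p).
- exact: measurable_funTS.
- by move=> p [_ /=]/ltW.
Qed.

Lemma shadow_finite (v : 'rV[R]_m.+1) : v ord0 ord0 != 0 ->
  (lebesgue_rV m (shadow K v) < +oo)%E.
Proof.
move=> v0; have [B B0 KB] : exists2 B : R, 0 <= B & forall x, K x -> `|x| <= B.
  have [B [_ BK]] := compact_bounded cK; exists (Num.max 0 B + 1).
    by rewrite addr_ge0// le_max lexx.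
  by apply: BK; rewrite ltr_pwDr// le_max lexx orbT.
pose C := \sum_j `|v ord0 (lift ord0 j) / v ord0 ord0|.
have C0 : 0 <= C by apply: sumr_ge0.
have sB : shadow K v `<=` @rV_box R m (B * (1 + C)).
  move=> y [t /interior_subset/KB zB] j.
  rewrite -(proj_line v0 y t) projE mulrDr mulr1; apply: le_trans (ler_normB _ _) _.
  apply: lerD; first by apply: le_trans zB; exact: ler_coord_norm.
  rewrite normrM mulrC; apply: ler_pM => //; first by apply: le_trans zB; exact: ler_coord_norm.
  by rewrite /C (bigD1 j)//= lerDl sumr_ge0.
have mS : measurable (shadow K v) by apply: open_measurable_rV; exact: shadow_open.
apply: le_lt_trans (le_measure _ _ _ sB) _; rewrite ?inE//; first exact: measurable_rV_box.
by rewrite [X in (X < _)%E]lebesgue_rV_box ?ltry// mulr_ge0// addr_ge0.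
Qed.

(** If [w s] carries the signs of a unit normal, their product is the sum of the absolute values of
    its coordinates, at least the sum 1 of their squares. So the area is at most the sum over all
    sign vectors of the integrals in Cauchy's formula, each finite because shadows are bounded.
    Finiteness is what allows exchanging integrals over [sigma]. *)
Lemma sigma_frontier_finite : (sigma setT < +oo)%E.
Proof.
pose w (s : {ffun 'I_m.+1 -> bool}) : 'rV[R]_m.+1 := \row_i (-1) ^+ s i.
have mM := measurable_frontier.
have mw s : measurable_fun setT (fun p => (Num.max 0 (dotv (normal p) (w s)))%:E).
  apply/measurable_EFinP; apply: measurable_maxr; first exact: measurable_cst.
  exact: measurable_dotv_normal.
have w0 s (p : 'rV[R]_m.+1) : (0 <= (Num.max 0 (dotv (normal p) (w s)))%:E)%E.
  by rewrite lee_fin le_max lexx.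
have cover p : ((\1_M p)%:E <= \sum_s (Num.max 0 (dotv (normal p) (w s)))%:E)%E.
  rewrite indicE; case: (boolP (p \in M)) => [|_]; last exact: sume_ge0.
  rewrite inE => Mp; pose s := [ffun i => normal p ord0 i < 0].
  rewrite (bigD1 s)//=; apply: (@le_trans _ _ (Num.max 0 (dotv (normal p) (w s)))%:E); last first.
    by rewrite leeDl// sume_ge0.
  rewrite lee_fin le_max; apply/orP; right.
  have [/= S _] := normalP cK vK Mp; rewrite -[X in X%:R]/(1%N) -{1}S.
  apply: ler_sum => i _; rewrite mxE ffunE.
  have n1 : normal p ord0 i ^+ 2 <= 1.
    rewrite -S /dotv (bigD1 i)//= expr2 lerDl.
    by apply: sumr_ge0 => j _; rewrite -expr2 sqr_ge0.
  move: (normal p ord0 i) n1 => x n1; case: ltP => h.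
    have x1 : -1 <= x by rewrite leNgt; apply/negP => ?; nra.
    by rewrite expr1; nra.
  have x1 : x <= 1 by rewrite leNgt; apply/negP => ?; nra.
  by rewrite expr0; nra.
have sM : (sigma M < +oo)%E.
  rewrite measure_integral_indic//.
  apply: (@le_lt_trans _ _ (\int[sigma]_p \sum_s (Num.max 0 (dotv (normal p) (w s)))%:E)%E).
    apply: ge0_le_integral => //.
    - by apply/measurable_EFinP; exact: measurable_indic.
    - by apply: emeasurable_sum => s.
  rewrite ge0_integral_sum//; apply: lte_sum_pinfty => s _.
  have w00 : w s ord0 ord0 != 0 by rewrite mxE signr_eq0.
  by rewrite cauchy_projection// lte_mul_pinfty// ?lee_fin// shadow_finite.
rewrite -(setUv M); apply: le_lt_trans (measureU2 _ _ _) _ => //; first exact: measurableC.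
apply: le_lt_trans (_ : sigma M + 0 < +oo)%E; last by rewrite adde0.
apply: leeD2l; have := lexx (0%E : \bar R); rewrite -{1}hs.1; exact.
Qed.

End cauchy.

(** * Gaussian integrals *)

Section gaussian.
Context {R : realType}.
Local Open Scope ereal_scope.
Local Notation mu := (@lebesgue_measure R).
Local Notation lam n := (@lebesgue_rV R n).

Lemma ge0_integral_opp (f : R -> \bar R) :
  measurable_fun setT f -> (forall x, 0 <= f x) ->
  \int[mu]_x f x = \int[mu]_x f (- x)%R.
Proof.
move=> mf f0.
pose phi : measurableTypeR R -> measurableTypeR R := fun x => (- x)%R.
have mphi : measurable_fun setT phi by exact: measurableT_comp.
transitivity (\int[measure_function_pushforward__canonical__measure_function_Measure mu mphi]_x f x).
  apply: eq_measure_integral => A mA _.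
  apply: (@lebesgue_measure_unique _ (measure_function_pushforward__canonical__measure_function_Measure mu mphi)) => // _ [[a b]] _ <-.
  rewrite [RHS](_ : _ = mu (phi @^-1` `]a, b]))//.
  rewrite (_ : phi @^-1` _ = `[(- b)%R, (- a)%R[%classic); last first.
    by apply/seteqP; split => x /=; rewrite !in_itv/= /phi lerNl ltrNr andbC.
  rewrite !lebesgue_measure_itv/= !lte_fin ltrN2; case: ifPn => // _.
  by rewrite -!EFinB opprK addrC.
by rewrite (@ge0_integral_pushforward _ _ _ _ _ phi)// preimage_setT.
Qed.

Variable a : R.
Hypothesis a0 : (0 < a)%R.

(** The centred Gaussian density of variance [a], whereas a coordinate of one perturbation has
    variance [a / 2]: the difference of two perturbations is meant. *)
Definition gauss (t : R) : R := (Num.sqrt (2 * pi * a))^-1 * expR (- (t ^+ 2 / (2 * a))).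

Lemma gauss_ge0 t : (0 <= gauss t)%R.
Proof. by rewrite mulr_ge0 ?invr_ge0// expR_ge0. Qed.

Lemma measurable_gauss : measurable_fun setT gauss.
Proof.
apply: measurable_funM; first exact: measurable_cst.
apply: measurableT_comp => //; apply: measurableT_comp => //.
by apply: measurable_funM => //; exact: measurable_funX.
Qed.

Lemma gauss_pdf t : gauss t = normal_pdf 0 (Num.sqrt a) t.
Proof.
have h := a0; rewrite normal_pdfE ?gt_eqF ?sqrtr_gt0// /gauss.
rewrite /normal_peak /normal_fun subr0 sqr_sqrtr ?ltW//; congr (_ * expR _)%R.
  by congr (_^-1)%R; congr Num.sqrt; rewrite mulr2n; ring.
by rewrite -mulNr mulr2n; congr (_ / _)%R; ring.
Qed.

Lemma integral_gauss : \int[mu]_t (gauss t)%:E = 1.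
Proof.
rewrite -(integral_normal_pdf 0 (Num.sqrt a)).
by apply: eq_integral => t _; rewrite gauss_pdf.
Qed.

(** The mean of [h (x + s * Z)] for [Z] centred Gaussian of variance [a]. *)
Definition smooth (s : R) (h : R -> R) (x : R) : \bar R :=
  \int[mu]_t (gauss t * h (x + s * t)%R)%:E.

Lemma gaussN t : gauss (- t) = gauss t.
Proof. by rewrite /gauss sqrrN. Qed.

Section smooth.
Variable h : R -> R.
Hypotheses (mh : measurable_fun setT h) (h0 : forall x, (0 <= h x)%R).

Let ms s x : measurable_fun setT (fun t => (gauss t * h (x + s * t)%R)%:E).
Proof.
apply/measurable_EFinP; apply: measurable_funM; first exact: measurable_gauss.
apply: (measurableT_comp mh); apply: measurable_funD => //; exact: measurable_funM.
Qed.

Let s0 s x t : 0 <= (gauss t * h (x + s * t)%R)%:E.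
Proof. by rewrite lee_fin mulr_ge0 ?gauss_ge0. Qed.

Lemma smooth_opp s x : smooth (- s) h x = smooth s h x.
Proof.
rewrite /smooth ge0_integral_opp//; apply: eq_integral => t _.
by rewrite gaussN mulrNN.
Qed.

Lemma smooth0 x : smooth 0 h x = (h x)%:E.
Proof.
rewrite /smooth; under eq_integral do rewrite mul0r addr0 mulrC EFinM.
rewrite ge0_integralZl ?lee_fin//; last 2 first.
- by apply/measurable_EFinP; exact: measurable_gauss.
- by move=> t _; rewrite lee_fin gauss_ge0.
by rewrite integral_gauss mule1.
Qed.

(** A sum of independent Gaussians is Gaussian: the inner variable is replaced by the combined one,
    the integrals are exchanged, and the leftover Gaussian integrates to 1. *)
Lemma smooth_comp (s s' x : R) :
  \int[mu]_t ((gauss t)%:E * smooth s h (x + s' * t)%R) =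
  smooth (Num.sqrt (s ^+ 2 + s' ^+ 2)) h x.
Proof.
wlog sp : s / (0 <= s)%R => [hw|].
  have [|sn] := leP 0%R s; first exact: hw.
  have sn' : (0 <= - s)%R by rewrite oppr_ge0 ltW.
  rewrite -sqrrN -(hw _ sn'); apply: eq_integral => t _.
  by rewrite smooth_opp.
have [->|sN0] := eqVneq s 0%R.
  rewrite expr0n/= add0r sqrtr_sqr.
  under eq_integral do rewrite smooth0 -EFinM.
  by rewrite -/(smooth s' h x); case: (ger0P s') => _ //; rewrite smooth_opp.
have {sN0}sp : (0 < s)%R by rewrite lt_neqAle eq_sym sN0.
set r := Num.sqrt _.
have r2 : (r ^+ 2 = s ^+ 2 + s' ^+ 2)%R by rewrite sqr_sqrtr// addr_ge0// sqr_ge0.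
have rp : (0 < r)%R by rewrite sqrtr_gt0 ltr_pwDl ?exprn_gt0// sqr_ge0.
have rs0 : (0 < r / s)%R by rewrite divr_gt0.
pose G (z : R * R) := (gauss z.1 * (gauss (r / s * z.2 - s' / s * z.1) * h (x + r * z.2)%R))%:E.
have G0 z : 0 <= G z by rewrite lee_fin !mulr_ge0 ?gauss_ge0.
have mpair : measurable_fun setT G.
  apply/measurable_EFinP; apply: measurable_funM.
    by apply: (measurableT_comp measurable_gauss).
  apply: measurable_funM.
    apply: (measurableT_comp measurable_gauss); apply: measurable_funB; apply: measurable_funM => //.
  apply: (measurableT_comp mh); apply: measurable_funD => //; exact: measurable_funM.
transitivity (\int[mu]_u ((r / s)%:E * \int[mu]_t
    (gauss u * (gauss (r / s * t - s' / s * u) * h (x + r * t)%R))%:E)).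
  apply: eq_integral => u _.
  rewrite /smooth (@ge0_integral_affine _ (r / s) (- (s' / s * u)) rs0)//.
  rewrite muleCA; congr (_ * _).
  under [RHS]eq_integral do rewrite EFinM.
  rewrite ge0_integralZl//; last 3 first.
  - apply/measurable_EFinP; apply: measurable_funM.
      apply: (measurableT_comp measurable_gauss); apply: measurable_funB => //; exact: measurable_funM.
    apply: (measurableT_comp mh); apply: measurable_funD => //; exact: measurable_funM.
  - by move=> t _; rewrite lee_fin mulr_ge0 ?gauss_ge0.
  - by rewrite lee_fin gauss_ge0.
  congr (_ * _); apply: eq_integral => t _; congr (_ * h _)%:E.
  by field; rewrite gt_eqF.
rewrite ge0_integralZl//; last 3 first.
- exact: (@measurable_fun_fubini_tonelli_F _ _ _ _ _ mu G mpair G0).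
- by move=> u _; apply: integral_ge0 => t _; rewrite lee_fin !mulr_ge0 ?gauss_ge0.
- by rewrite lee_fin ltW.
rewrite (@fubini_tonelli _ _ _ _ _ mu mu G mpair G0).
rewrite -ge0_integralZl//; last 3 first.
- exact: (@measurable_fun_fubini_tonelli_G _ _ _ _ _ mu G mpair G0).
- by move=> u _; apply: integral_ge0 => t _; rewrite lee_fin !mulr_ge0 ?gauss_ge0.
- by rewrite lee_fin ltW.
rewrite /smooth; apply: eq_integral => t _.
rewrite -[RHS]mule1 -integral_gauss.
have mg2 : measurable_fun setT (fun u => (gauss (r / s * u - s' / s * t))%:E).
  apply/measurable_EFinP; apply: (measurableT_comp measurable_gauss).
  by apply: measurable_funB => //; exact: measurable_funM.
rewrite (@ge0_integral_affine _ (r / s) (- (s' / s * t)) rs0); last 2 first.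
- by apply/measurable_EFinP; exact: measurable_gauss.
- by move=> u; rewrite lee_fin gauss_ge0.
rewrite muleCA; congr (_ * _).
rewrite -ge0_integralZl//; last by move=> u _; rewrite lee_fin gauss_ge0.
apply: eq_integral => u _; rewrite -EFinM; congr EFin.
rewrite /= mulrA [RHS]mulrAC; congr (_ * _)%R.
(* Equality of exponents: as [r ^+ 2 = s ^+ 2 + s' ^+ 2], the form
   [u ^+ 2 + ((r * t - s' * u) / s) ^+ 2] is symmetric in [t] and [u]. *)
rewrite /gauss mulrACA [RHS]mulrACA -!expRD; congr (_ * expR _)%R.
rewrite -!opprD; congr (- _)%R; rewrite -!mulrDl; congr (_ / _)%R.
have s0' : s != 0%R by rewrite gt_eqF.
apply: (mulIf (expf_neq0 2 s0')).
transitivity (r ^+ 2 * u ^+ 2 + r ^+ 2 * t ^+ 2 - 2 * r * s' * t * u)%R.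
  transitivity ((s ^+ 2 + s' ^+ 2) * u ^+ 2 + r ^+ 2 * t ^+ 2 - 2 * r * s' * t * u)%R.
    by field.
  by rewrite r2.
transitivity (r ^+ 2 * u ^+ 2 + (s ^+ 2 + s' ^+ 2) * t ^+ 2 - 2 * r * s' * t * u)%R.
  by rewrite r2.
by field.
Qed.

Definition gaussv n (v : 'rV[R]_n) : R := \prod_i gauss (v ord0 i).

Lemma gaussv_ge0 n (v : 'rV[R]_n) : (0 <= gaussv v)%R.
Proof. by apply: prodr_ge0 => i _; exact: gauss_ge0. Qed.

Lemma measurable_gaussv n : measurable_fun setT (@gaussv n).
Proof.
apply: measurable_prod => i _.
exact: (measurableT_comp measurable_gauss (measurable_coord _)).
Qed.

Lemma gaussv_cons n t (y : 'rV[R]_n) : gaussv (rV_cons (t, y)) = (gauss t * gaussv y)%R.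
Proof.
rewrite /gaussv big_ord_recl rV_cons0; congr (_ * _)%R.
by apply: eq_bigr => i _; rewrite rV_consS.
Qed.

(** Rotation invariance of the Gaussian: only the length of [w] matters. The coordinates are merged
    one at a time by [smooth_comp]. *)
Lemma integral_gaussv n (w : 'rV[R]_n) x :
  \int[lam n]_v (gaussv v * h (x + dotv w v)%R)%:E = smooth (Num.sqrt (dotv w w)) h x.
Proof.
have mgh k (w' : 'rV[R]_k) y :
    measurable_fun setT (fun v => (gaussv v * h (y + dotv w' v)%R)%:E).
  apply/measurable_EFinP; apply: measurable_funM; first exact: measurable_gaussv.
  apply: (measurableT_comp mh); apply: measurable_funD; first exact: measurable_cst.
  by apply: measurable_dotv => //; exact: measurable_cst.
have gh0 k (w' : 'rV[R]_k) y v : 0 <= (gaussv v * h (y + dotv w' v)%R)%:E.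
  by rewrite lee_fin mulr_ge0 ?gaussv_ge0.
elim: n w x => [|n IH] w x.
  rewrite [X in smooth (Num.sqrt X)]/dotv big_ord0 sqrtr0 smooth0.
  rewrite integral_dirac//; last exact: mgh.
  by rewrite diracT mul1e /gaussv /dotv !big_ord0 mul1r addr0.
have [w0 [w' ->]] : exists w0 w', w = rV_cons (w0, w').
  by exists (w ord0 ord0), (\row_i w ord0 (lift ord0 i)); rewrite rV_unconsK.
rewrite (ge0_integral_rV_cons (mgh _ _ _) (gh0 _ _ _)).
transitivity (\int[mu]_t ((gauss t)%:E * smooth (Num.sqrt (dotv w' w')) h (x + w0 * t)%R)).
  apply: eq_integral => t _; rewrite -IH -ge0_integralZl//; last 2 first.
  - exact: mgh.
  - by rewrite lee_fin gauss_ge0.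
  apply: eq_integral => y _; rewrite gaussv_cons dotv_cons rV_cons0 -mulrA EFinM.
  congr (_ * (_ * h _)%:E); rewrite addrA; congr (_ + dotv _ _)%R.
  by apply/rowP => j; rewrite mxE rV_consS.
rewrite smooth_comp sqr_sqrtr ?dotv_ge0//; congr (smooth (Num.sqrt _) h x).
rewrite dotv_cons rV_cons0 addrC expr2; congr (_ + dotv _ _)%R.
by apply/rowP => j; rewrite mxE rV_consS.
Qed.

End smooth.

End gaussian.

Section gaussian_moment.
Context {R : realType}.
Local Open Scope ereal_scope.
Local Notation mu := (@lebesgue_measure R).
Local Notation lam n := (@lebesgue_rV R n).
Variable a : R.
Hypothesis a0 : (0 < a)%R.
Local Notation gauss := (gauss a).
Local Notation gaussv := (@gaussv R a _).

Lemma is_derive_gauss (t : R) : is_derive t (1%R : R) gauss (- (t / a) * gauss t)%R.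
Proof.
have aN0 : a != 0%R by rewrite gt_eqF.
pose q : R -> R := fun t => (- (t ^+ 2 / (2 * a)))%R.
have dq : is_derive t (1%R : R) q (- (t / a))%R.
  rewrite (_ : q = (- (2 * a)^-1)%R \*: (@id R ^+ 2)%R); last first.
    by apply/funext => u; rewrite /q /= -[RHS]/(_ * _)%R mulNr mulrC.
  by apply: is_derive_eq; rewrite /GRing.scale/= expr1; field.
have de : is_derive t (1%R : R) (expR \o q) (expR (q t) * - (t / a))%R.
  exact: (@is_derive1_comp _ expR q t _ _ (is_derive_expR _) dq).
have -> : gauss t = ((Num.sqrt (2 * pi * a))^-1 * expR (q t))%R by [].
rewrite (_ : gauss = (Num.sqrt (2 * pi * a))^-1%R \*: (expR \o q)); last first.
  by apply/funext.
by apply: is_derive_eq; rewrite /GRing.scale/=; ring.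
Qed.

Lemma cvg_gauss : gauss t @[t --> +oo%R] --> 0%R.
Proof.
rewrite -(mulr0 (Num.sqrt (2 * pi * a))^-1%R); apply: cvgMl_tmp.
apply: (cvg_comp (fun t => t ^+ 2 / (2 * a))%R (fun x => expR (- x))); last exact: cvgr_expR.
apply: gt0_cvgMly; last exact: cvgr_expr2.
by rewrite invr_gt0 mulr_gt0.
Qed.

Lemma continuous_gauss : continuous gauss.
Proof.
move=> t; have h := is_derive_gauss t.
exact/differentiable_continuous/derivable1_diffP/(@ex_derive _ _ _ _ _ _ _ h).
Qed.

(** As [t * gauss t] is the derivative of [- a * gauss t], the value is [a * gauss 0]. *)
Lemma gauss_positive_part :
  \int[mu]_t (gauss t * Num.max 0 (0 + 1 * t)%R)%:E = (Num.sqrt (a / (2 * pi)))%:E.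
Proof.
have aN0 : a != 0%R by rewrite gt_eqF.
transitivity (\int[mu]_(t in `[0%R, +oo[) (t * gauss t)%:E).
  rewrite [RHS]integral_mkcond; apply: eq_integral => t _; rewrite patchE mem_setE in_itv/= andbT.
  rewrite add0r mul1r; case: ifPn => [t0|]; first by rewrite max_r// mulrC.
  by rewrite -ltNge => t0; rewrite max_l ?ltW// mulr0.
have dF (t : R) : is_derive t (1%R : R) (fun t => (- a) * gauss t)%R (t * gauss t)%R.
  have h := is_derive_gauss t.
  rewrite (_ : (fun t => (- a) * gauss t)%R = (- a)%R \*: gauss); last by apply/funext.
  by apply: is_derive_eq; rewrite /GRing.scale/=; field.
rewrite (@ge0_continuous_FTC2y _ _ (fun t => (- a) * gauss t)%R 0 0).
- rewrite -EFinB sub0r mulNr opprK; congr EFin.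
  rewrite /gauss expr0n/= mul0r oppr0 expR0 mulr1.
  have p0 := @pi_gt0 R; have h := a0.
  have d0 : (0 < 2 * pi * a)%R by rewrite !mulr_gt0.
  have p20 : (2 * pi != 0 :> R)%R by rewrite mulf_neq0 ?pnatr_eq0// gt_eqF.
  apply/eqP; rewrite -(@eqrXn2 _ 2) ?mulr_ge0 ?invr_ge0 ?sqrtr_ge0 ?ltW//.
  rewrite exprMn exprVn !sqr_sqrtr ?ltW ?divr_gt0 ?mulr_gt0//.
  rewrite eqr_div// ?(lt0r_neq0 d0)//; apply/eqP; ring.
- by move=> t t0; rewrite mulr_ge0 ?gauss_ge0.
- apply: continuous_subspaceT => t; apply: cvgM; [exact: cvg_id|exact: continuous_gauss].
- by rewrite -(mulr0 (- a)%R); apply: cvgMl_tmp; exact: cvg_gauss.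
- by move=> t _; have h := dF t; exact: (@ex_derive _ _ _ _ _ _ _ h).
- apply: cvg_at_right_filter; apply: cvgMl_tmp; exact: continuous_gauss.
- by move=> t _; rewrite derive1E; have h := dF t; exact: derive_val.
Qed.

(** Since [nu] has length 1, [dotv nu v] is distributed like a single coordinate. *)
Lemma gaussv_positive_part n (nu : 'rV[R]_n) : dotv nu nu = 1%R ->
  \int[lam n]_v (gaussv v * Num.max 0 (dotv nu v))%:E = (Num.sqrt (a / (2 * pi)))%:E.
Proof.
move=> nu1; rewrite -gauss_positive_part.
have mm : measurable_fun setT (fun x : R => (Num.max 0 x)%R).
  by apply: measurable_maxr => //; exact: measurable_cst.
have m0 x : (0 <= Num.max 0 x :> R)%R by rewrite le_max lexx.
have := integral_gaussv a0 mm m0 nu 0; rewrite nu1 sqrtr1 /smooth => <-.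
by apply: eq_integral => v _; rewrite add0r.
Qed.

End gaussian_moment.

(** * Flux through the boundary and its Gaussian mean *)

Section gaussian_cauchy.
Context {R : realType}.
Variables (m : nat) (K : set 'rV[R]_m.+1).
Hypotheses (cK : compact K) (vK : cvx K).
Local Notation M := (frontier K).
Hypotheses (hM : smooth_hypersurface M) (curv : nonvanishing_curvature M).
Variable c : 'rV[R]_m.+1.
Hypothesis Kc : K° c.
Variable sigma : {measure set 'rV[R]_m.+1 -> \bar R}.
Hypothesis hs : @is_surface_measure R m.+1 M sigma.
Local Notation normal := (normal K).

Definition flux (v : 'rV[R]_m.+1) : \bar R :=
  (\int[sigma]_p (Num.max 0 (dotv (normal p) v))%:E)%E.

Let fin : (sigma setT < +oo)%E := sigma_frontier_finite cK vK hM curv Kc hs.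

(** The same measure as [sigma], packaged as a finite one for Fubini's theorem. *)
Let s := mfrestr measurableT fin.

Let intE (f : 'rV[R]_m.+1 -> \bar R) : (\int[sigma]_p f p = \int[s]_p f p)%E.
Proof.
apply: eq_measure_integral => A mA _.
by have -> : sigma A = sigma (A `&` setT) by rewrite setIT.
Qed.

Let mmax : measurable_fun setT (fun x : R => Num.max 0 x).
Proof. by apply: measurable_maxr => //; exact: measurable_cst. Qed.

Let mnd : measurable_fun setT (fun z : 'rV[R]_m.+1 * 'rV[R]_m.+1 =>
  Num.max 0 (dotv (normal z.2) z.1)).
Proof.
apply: (measurableT_comp mmax); apply: measurable_dotv; last exact: measurable_fst.
exact: (measurableT_comp (measurable_normal cK vK hM Kc) measurable_snd).
Qed.

Lemma measurable_flux : measurable_fun setT flux.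
Proof.
rewrite (_ : flux = fun v => (\int[s]_p (Num.max 0 (dotv (normal p) v))%:E)%E); last first.
  by apply/funext => v; exact: intE.
apply: (@measurable_fun_fubini_tonelli_F _ _ _ _ _ s
  (fun z => (Num.max 0 (dotv (normal z.2) z.1))%:E)).
  exact/measurable_EFinP.
by move=> z; rewrite lee_fin le_max lexx.
Qed.

Lemma flux_ge0 v : (0 <= flux v)%E.
Proof. by apply: integral_ge0 => p _; rewrite lee_fin le_max lexx. Qed.

(** After exchanging the integrals, each boundary point contributes the same constant; off [M] the
    normal is 0 and contributes nothing, which produces [sigma M]. *)
Lemma integral_gaussian_flux (a : R) : 0 < a ->
  (\int[lebesgue_rV m.+1]_v ((gaussv a v)%:E * flux v) =
   (Num.sqrt (a / (2 * pi)))%:E * sigma M)%E.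
Proof.
move=> a0.
pose f (z : 'rV[R]_m.+1 * 'rV[R]_m.+1) : \bar R :=
  (gaussv a z.1 * Num.max 0 (dotv (normal z.2) z.1))%:E.
have mf : measurable_fun setT f.
  apply/measurable_EFinP; apply: measurable_funM => //.
  exact: (measurableT_comp (@measurable_gaussv _ a _) measurable_fst).
have m0 p v : 0 <= Num.max 0 (dotv (normal p) v) by rewrite le_max lexx.
have f0 z : (0 <= f z)%E by rewrite lee_fin mulr_ge0 ?gaussv_ge0.
transitivity (\int[lebesgue_rV m.+1]_v \int[s]_p f (v, p))%E.
  apply: eq_integral => v _; rewrite /flux intE -ge0_integralZl//.
  - apply/measurable_EFinP; apply: (measurableT_comp mmax).
    exact: (measurable_dotv_normal cK vK hM Kc).
  - by move=> p _; rewrite lee_fin.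
  - by rewrite lee_fin gaussv_ge0.
rewrite (@fubini_tonelli _ _ _ _ _ (lebesgue_rV m.+1) s f mf f0).
transitivity (\int[s]_p ((Num.sqrt (a / (2 * pi)))%:E * (\1_M p)%:E))%E.
  apply: eq_integral => p _; rewrite /f indicE; case: (boolP (p \in M)) => [|nM].
    rewrite inE => Mp; rewrite /= mule1.
    exact: (gaussv_positive_part a0 (normalP cK vK Mp).1).
  rewrite mule0 integral0_eq// => v _.
  rewrite (normal_out (set_mem (_ : p \in ~` M))) ?in_setC// /dotv big1 => [|i _].
    by rewrite maxxx mulr0.
  by rewrite mxE mul0r.
have mM : measurable M := measurable_frontier cK.
rewrite ge0_integralZl//; last by apply/measurable_EFinP; exact: measurable_indic.
by rewrite -intE integral_indic// setIT.
Qed.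

End gaussian_cauchy.

(** * Volume of the escape set *)

Section line_integration.
Context {R : realType}.
Local Open Scope ereal_scope.
Local Notation mu := (@lebesgue_measure R).
Local Notation lam n := (@lebesgue_rV R n).

Lemma ge0_integral_scale (r : R) (f : R -> \bar R) : r != 0%R ->
  measurable_fun setT f -> (forall x, 0 <= f x) ->
  \int[mu]_x f x = `|r|%:E * \int[mu]_x f (x * r)%R.
Proof.
move=> r0 mf f0.
have h (q : R) (g : R -> \bar R) : (0 < q)%R -> measurable_fun setT g -> (forall x, 0 <= g x) ->
    \int[mu]_x g x = q%:E * \int[mu]_x g (x * q)%R.
  move=> q0 mg g0; rewrite (@ge0_integral_affine _ q 0 q0)//; congr (_ * _).
  by apply: eq_integral => x _; rewrite addr0 mulrC.
case: (ltgtP r 0%R) r0 => // rs _.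
  rewrite ltr0_norm// ge0_integral_opp// (h (- r)%R) ?oppr_gt0//; last first.
    by apply: (measurableT_comp mf); exact: oppr_measurable.
  by congr (_ * _); apply: eq_integral => x _; rewrite mulrN opprK.
by rewrite gtr0_norm//; exact: h.
Qed.

Lemma measurable_line m (v : 'rV[R]_m.+1) :
  measurable_fun setT (fun z : 'rV[R]_m * R => line v z.1 z.2).
Proof.
apply: measurable_fun_coordP => j; case: (unliftP ord0 j) => [i ->|->].
  apply: (eq_measurable_fun (fun z : 'rV[R]_m * R =>
      z.1 ord0 i + z.2 * v ord0 (lift ord0 i))%R).
    by move=> z _; rewrite lineS.
  apply: measurable_funD; last exact: measurable_funM.
  exact: (measurableT_comp (measurable_coord i) measurable_fst).
apply: (eq_measurable_fun (fun z : 'rV[R]_m * R => z.2 * v ord0 ord0)%R).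
  by move=> z _; rewrite line0.
exact: measurable_funM.
Qed.

(** Rescaling the first coordinate by [v ord0 ord0] gives the Jacobian; for fixed [t] what remains
    is a translation of [y]. *)
Lemma ge0_integral_line m (v : 'rV[R]_m.+1) (f : 'rV[R]_m.+1 -> \bar R) :
  v ord0 ord0 != 0%R -> measurable_fun setT f -> (forall x, 0 <= f x) ->
  \int[lam m.+1]_z f z = `|v ord0 ord0|%:E * \int[lam m]_y \int[mu]_t f (line v y t).
Proof.
move=> v0 mf f0; rewrite ge0_integral_rV_cons//.
have mfc : measurable_fun setT (fun p => f (@rV_cons R m p)).
  exact: (measurableT_comp mf (@measurable_rV_cons _ _)).
rewrite (ge0_integral_scale v0); last 2 first.
- apply: (@measurable_fun_fubini_tonelli_F _ _ _ _ _ (lam m) (fun p => f (rV_cons p))) => //.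
- by move=> t; exact: integral_ge0.
congr (_ * _).
transitivity (\int[mu]_t \int[lam m]_y f (line v y t)).
  apply: eq_integral => t _.
  rewrite (@ge0_integral_rV_shift _ _ (t *: \row_i v ord0 (lift ord0 i))%R)//; last first.
    by apply: (measurableT_comp mf); exact: measurable_rV_consP.
  apply: eq_integral => y _; congr f; apply/rowP => j.
  case: (unliftP ord0 j) => [i ->|->]; first by rewrite rV_consS lineS !mxE.
  by rewrite rV_cons0 line0.
apply: (@fubini_tonelli _ _ _ _ _ mu (lam m) (fun z => f (line v z.2 z.1))) => //.
apply: (measurableT_comp mf).
apply: (measurableT_comp (@measurable_line m v) (_ : measurable_fun _ (fun z => (z.2, z.1)))).
by apply: measurable_fun_pair; [exact: measurable_snd|exact: measurable_fst].
Qed.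

Variables (m : nat) (K : set 'rV[R]_m.+1).
Hypotheses (cK : compact K) (vK : cvx K).
Hypotheses (strict : forall p q, K p -> K q -> p != q ->
  ~ (forall t : R, (0 <= t)%R -> (t <= 1)%R -> frontier K (p + t *: (q - p))%R)).
Variable v : 'rV[R]_m.+1.
Hypothesis v0 : v ord0 ord0 != 0%R.

Definition escape (u : 'rV[R]_m.+1) := [set z | K z /\ ~ K (z + u)%R].

Lemma measurable_escape u : measurable (escape u).
Proof.
have mK := compact_measurable_rV cK.
rewrite (_ : escape u = K `&` ~` ((fun z => (z + u)%R) @^-1` K)); last first.
  by apply/seteqP; split.
apply: measurableI => //; apply: measurableC.
rewrite -[X in measurable X]setTI; apply: measurable_rVD => //.
Qed.

Definition escape_line y h := [set t : R | escape (h *: v) (line v y t)].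

Lemma escape_lineE y h t : escape_line y h t <-> K (line v y t) /\ ~ K (line v y (t + h)%R).
Proof.
have -> : line v y (t + h)%R = (line v y t + h *: v)%R by rewrite /line scalerDl addrA.
by [].
Qed.

Lemma measurable_escape_line y h : measurable (escape_line y h).
Proof.
rewrite -[X in measurable X]setTI.
have mly : measurable_fun setT (line v y).
  apply: (measurableT_comp (@measurable_line m v) (_ : measurable_fun _ (fun t : R => (y, t)))).
  by apply: measurable_fun_pair; [exact: measurable_cst|].
by apply: mly => //; exact: measurable_escape.
Qed.

Lemma line_cvx y t s u : K (line v y t) -> K (line v y s) -> (t <= u <= s)%R -> K (line v y u).
Proof.
move=> Kt Ks /andP[tu us]; have [ts|ts] := eqVneq t s.
  by have -> : u = t by apply/eqP; rewrite eq_le tu ts us.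
have st : (0 < s - t)%R by rewrite subr_gt0 lt_neqAle ts (le_trans tu us).
have := vK Kt Ks (l := ((u - t) / (s - t))%R).
rewrite line_conv divfK ?gt_eqF// subrKC; apply.
  by apply: divr_ge0; [rewrite subr_ge0|exact: ltW].
by rewrite ler_pdivrMr// mul1r lerB.
Qed.

Lemma escape_line_shadow y h : shadow K v y -> (0 < h)%R ->
  escape_line y h `<=` `](top_height K v y - h)%R, top_height K v y].
Proof.
move=> sy h0 t /escape_lineE[Kt nK]; have [Ktop tmax] := top_heightP cK v0 sy.
rewrite /= in_itv/= tmax// andbT ltNge; apply/negP => th; apply: nK.
by apply: (line_cvx Kt Ktop); apply/andP; split; lra.
Qed.

(** The witness is a depth [s] below the top where the line is still in [K]. For [h <= s], the
    half-open segment of length [h] under the top lies in [K], and its shift by [h] is above the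
    top. *)
Lemma escape_line_eq y : shadow K v y -> exists2 e : R, (0 < e)%R & forall h, (0 < h)%R ->
  (h <= e)%R -> escape_line y h = `](top_height K v y - h)%R, top_height K v y]%classic.
Proof.
move=> sy; have [Ktop tmax] := top_heightP cK v0 sy.
have [_ [s s0 /interior_subset Ks]] := top_point_frontier cK v0 sy.
rewrite line_sub in Ks.
exists s => // h h0 hs; apply/seteqP; split; first exact: escape_line_shadow.
move=> t; rewrite /= in_itv/= => /andP[t1 t2]; apply/escape_lineE; split.
  by apply: (line_cvx Ks Ktop); rewrite t2 andbT; lra.
by move=> /tmax; lra.
Qed.

(** Two points of [K] on the line would have an interior midpoint and put [y] in the shadow; so the
    line meets [K] in at most one point. *)
Lemma escape_line_out y h : ~ shadow K v y -> mu (escape_line y h) = 0.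
Proof.
move=> ny.
have single t s : K (line v y t) -> K (line v y s) -> t = s.
  move=> Kt Ks; apply/eqP; apply: contrapT => /negP ts; apply: ny.
  have nts : line v y t != line v y s.
    apply: contra ts => /eqP/(congr1 (fun z : 'rV[R]_m.+1 => z ord0 ord0)).
    by rewrite !line0 => /(mulIf v0) ->.
  exists (t + 2^-1 * (s - t))%R; rewrite -line_conv.
  exact: (strict_midpoint cK vK strict Kt Ks nts).
have [[t Kt]|nK] := pselect (exists t, K (line v y t)).
  apply: (@subset_measure0 _ _ _ mu _ [set t]) => //.
  - exact: measurable_escape_line.
  - by move=> s /escape_lineE[Ks _]; exact: single.
  - exact: lebesgue_measure_set1.
rewrite (_ : escape_line y h = set0) ?measure0//.
by rewrite -subset0 => t /escape_lineE[Kt _]; apply: nK; exists t.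
Qed.

Lemma escape_integral h : lam m.+1 (escape (h *: v)) =
  `|v ord0 ord0|%:E * \int[lam m]_y mu (escape_line y h).
Proof.
have mE := measurable_escape (h *: v).
rewrite measure_integral_indic//.
have mi : measurable_fun setT (fun z : 'rV[R]_m.+1 => (\1_(escape (h *: v)) z : R)%:E).
  by apply/measurable_EFinP; exact: measurable_indic.
rewrite (ge0_integral_line v0 mi); last by move=> z; rewrite lee_fin.
congr (_ * _); apply: eq_integral => y _.
by rewrite measure_integral_indic//; exact: measurable_escape_line.
Qed.

Lemma escape_line_le y h : (0 < h)%R ->
  mu (escape_line y h) <= (h * \1_(shadow K v) y)%:E.
Proof.
move=> h0; rewrite indicE; case: (boolP (y \in shadow K v)) => [|ny].
  rewrite inE => sy; apply: (@le_trans _ _ (mu `](top_height K v y - h)%R, top_height K v y])).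
    apply: le_measure; rewrite ?inE//; last exact: escape_line_shadow.
    exact: measurable_escape_line.
  by rewrite lebesgue_measure_itv/= lte_fin ltrBlDr ltrDl h0 -EFinB lee_fin mulr1; lra.
by rewrite escape_line_out ?mulr0//; move: ny; rewrite notin_setE.
Qed.

Lemma measurable_escape_line_fun h : measurable_fun setT (fun y => mu (escape_line y h)).
Proof.
pose f (z : 'rV[R]_m * R) : \bar R := (\1_(escape (h *: v)) (line v z.1 z.2) : R)%:E.
have mE := measurable_escape (h *: v).
have mf : measurable_fun setT f.
  apply/measurable_EFinP.
  have m1 : measurable_fun setT (\1_(escape (h *: v)) : 'rV[R]_m.+1 -> R) by exact: measurable_indic.
  exact: (measurableT_comp m1 (@measurable_line m v)).
rewrite (_ : (fun y => _) = fun y => \int[mu]_t f (y, t)).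
  by apply: (@measurable_fun_fubini_tonelli_F _ _ _ _ _ mu f mf) => z; rewrite lee_fin.
by apply/funext => y; rewrite measure_integral_indic//; exact: measurable_escape_line.
Qed.

Lemma escape_le h : (0 < h)%R ->
  lam m.+1 (escape (h *: v)) <= h%:E * (`|v ord0 ord0|%:E * lam m (shadow K v)).
Proof.
move=> h0; rewrite escape_integral muleCA lee_wpmul2l ?lee_fin//.
have mS : measurable (shadow K v) by apply: open_measurable_rV; exact: shadow_open.
have mi : measurable_fun setT (fun y => (\1_(shadow K v) y : R)%:E).
  by apply/measurable_EFinP; exact: measurable_indic.
have h0' := ltW h0; rewrite measure_integral_indic// -ge0_integralZl ?lee_fin//.
apply: ge0_le_integral => //.
- exact: measurable_escape_line_fun.
- by apply/measurable_EFinP; apply: measurable_funM => //; exact: measurable_indic.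
- by move=> y _; exact: escape_line_le.
Qed.

(** Dominated convergence over [y]: on the shadow the escaping part of the line has length exactly
    [h] once [h] is small, off the shadow it is null, and [escape_line_le] dominates the quotient by
    the indicator of the shadow. *)
Lemma escape_cvg (h : R^nat) : (forall n, (0 < h n)%R) -> h n @[n --> \oo] --> (0 : R)%R ->
  (h n)^-1%:E * lam m.+1 (escape (h n *: v)) @[n --> \oo] -->
  `|v ord0 ord0|%:E * lam m (shadow K v).
Proof.
move=> h0 hc.
have mS : measurable (shadow K v) by apply: open_measurable_rV; exact: shadow_open.
under eq_fun => n do rewrite escape_integral muleCA.
have -> : lam m (shadow K v) = \int[lam m]_y (\1_(shadow K v) y)%:E.
  exact: measure_integral_indic.
apply: cvgeZl => //.
under eq_fun => n.
  rewrite -ge0_integralZl//; last 2 first.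
  - exact: measurable_escape_line_fun.
  - by rewrite lee_fin invr_ge0 ltW.
  over.
have [|||||_ _] := @dominated_convergence _ _ _ (lam m) setT measurableT
  (fun n y => (h n)^-1%:E * mu (escape_line y (h n)))
  (fun y => (\1_(shadow K v) y)%:E) (fun y => (\1_(shadow K v) y)%:E); last by [].
- move=> n; apply: emeasurable_funM => //; exact: measurable_escape_line_fun.
- by apply/measurable_EFinP; exact: measurable_indic.
- apply: aeW => y _; rewrite indicE; case: (boolP (y \in shadow K v)) => [|ny].
    rewrite inE => sy; have [e e0 eP] := escape_line_eq sy.
    have hle : \forall n \near \oo, (h n <= e)%R by exact: (cvgr_le _ hc _ e0).
    apply: cvg_near_cst; apply: filterS hle => n hn.
    rewrite eP// lebesgue_measure_itv/= lte_fin ltrBlDr ltrDl h0 -EFinB -EFinM.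
    by rewrite opprB subrKC mulVf ?gt_eqF.
  rewrite notin_setE in ny.
  by apply: cvg_near_cst; apply: nearW => n; rewrite escape_line_out// mule0.
- apply/integrableP; split.
    by apply/measurable_EFinP; exact: measurable_indic.
  under eq_integral => y _ do rewrite gee0_abs ?lee_fin//.
  by rewrite integral_indic// setIT; exact: (shadow_finite cK v0).
- apply: aeW => y n _; have hn0 := ltW (h0 n).
  rewrite gee0_abs; last by rewrite mule_ge0 ?lee_fin ?invr_ge0.
  by rewrite lee_pdivrMl// -EFinM; exact: escape_line_le.
Qed.

End line_integration.

(** * Lattice sums of Gaussians *)

Section lattice_sums.
Context {R : realType}.
Local Open Scope ereal_scope.

Lemma infinite_countable_enum (T : countType) : infinite_set [set: T] ->
  exists e : nat -> T, set_bij [set: nat] [set: T] e.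
Proof.
move=> iT; have : ([set: T] #= [set: nat])%card by apply: eq_card_nat => //; exact: countableP.
move=> /card_set_bijP[f [_ fi fs]].
have /choice[e eP] : forall n, exists t, f t = n by move=> n; have [t _ ft] := fs n I; exists t.
exists e; split => // [m n _ _ emn|t _]; first by rewrite -(eP m) emn eP.
by exists (f t) => //; apply: fi; rewrite ?inE// eP.
Qed.

Lemma infinite_inj (T : choiceType) (f : nat -> T) : injective f -> infinite_set [set: T].
Proof.
move=> fi fT; apply: infinite_nat.
have : finite_set (f @` [set: nat]) by apply: sub_finite_set fT.
by rewrite (eq_finite_set (inj_card_eq _))// => x y _ _; exact: fi.
Qed.

Lemma infinite_int : infinite_set [set: int].
Proof. by apply: (@infinite_inj _ Posz) => x y []. Qed.

Lemma infinite_rV_int n : infinite_set [set: 'rV[int]_n.+1].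
Proof.
apply: (@infinite_inj _ (fun k => const_mx (Posz k))) => x y.
by move=> /(congr1 (fun z : 'rV[int]_n.+1 => z ord0 ord0)); rewrite !mxE => -[].
Qed.

Lemma esum_enum (T : choiceType) (e : nat -> T) (f : T -> \bar R) :
  set_bij [set: nat] [set: T] e -> (forall k, 0 <= f k) ->
  \esum_(k in [set: T]) f k = \sum_(n <oo) f (e n).
Proof.
by move=> be f0; rewrite (@reindex_esum _ _ _ _ _ e _ be) nneseries_esumT.
Qed.

Definition int_cons n (p : int * 'rV[int]_n) : 'rV[int]_n.+1 :=
  row_mx (p.1%:M : 'rV[int]_1) p.2.

Lemma int_cons0 n (p : int * 'rV[int]_n) : int_cons p ord0 ord0 = p.1.
Proof.
have e : ord0 = lshift n (ord0 : 'I_1) :> 'I_(1 + n) by apply: val_inj.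
apply: etrans (congr1 (int_cons p ord0) e) _.
by rewrite /int_cons (row_mxEl (p.1%:M : 'rV[int]_1)) mxE eqxx mulr1n.
Qed.

Lemma int_consS n (p : int * 'rV[int]_n) i : int_cons p ord0 (lift ord0 i) = p.2 ord0 i.
Proof.
have e : lift ord0 i = rshift 1 i :> 'I_(1 + n) by apply: val_inj.
apply: etrans (congr1 (int_cons p ord0) e) _.
by rewrite /int_cons (row_mxEr (p.1%:M : 'rV[int]_1)).
Qed.

Lemma int_cons_bij n : set_bij [set: int * 'rV[int]_n] [set: 'rV[int]_n.+1] (@int_cons n).
Proof.
split => //.
  move=> p q _ _ pq; rewrite [p]surjective_pairing [q]surjective_pairing; congr pair.
    by rewrite -!int_cons0 pq.
  by apply/rowP => i; rewrite -!int_consS pq.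
move=> v _; exists (v ord0 ord0, \row_i v ord0 (lift ord0 i)) => //.
apply/rowP => j; case: (unliftP ord0 j) => [i ->|->]; first by rewrite int_consS mxE.
by rewrite int_cons0.
Qed.

Lemma esum_scalel (T : choiceType) (f : T -> \bar R) (r : R) : (0 <= r)%R -> (forall k, 0 <= f k) ->
  \esum_(k in [set: T]) (r%:E * f k) = r%:E * \esum_(k in [set: T]) f k.
Proof.
move=> r0 f0; apply/eqP; rewrite eq_le; apply/andP; split.
  apply: ub_ereal_sup => _ [X [fX _] <-].
  rewrite -ge0_mule_fsumr//; apply: lee_wpmul2l; rewrite ?lee_fin//.
  by apply: ereal_sup_ubound; exists X.
have [->|rN0] := eqVneq r 0%R; first by rewrite mul0e esum_ge0// => k _; rewrite mul0e.
have rp : (0 < r)%R by rewrite lt_neqAle eq_sym rN0.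
rewrite -lee_pdivlMl//; apply: ub_ereal_sup => _ [X [fX _] <-].
rewrite lee_pdivlMl// ge0_mule_fsumr//.
by apply: ereal_sup_ubound; exists X.
Qed.

(** Induction on the dimension, splitting off the first integer coordinate; nonnegativity allows
    iterated summation. *)
Lemma esum_prod n (f : R -> int -> R) (F : R -> R) (x : 'rV[R]_n) :
  (forall t k, (0 <= f t k)%R) -> (forall t, \esum_(k in [set: int]) (f t k)%:E = (F t)%:E) ->
  \esum_(k in [set: 'rV[int]_n]) (\prod_i f (x ord0 i) (k ord0 i))%:E =
  (\prod_i F (x ord0 i))%:E.
Proof.
move=> f0 fF.
have F0 t : (0 <= F t)%R by rewrite -lee_fin -fF esum_ge0// => k _; rewrite lee_fin.
elim: n x => [|n IH] x.
  rewrite big_ord0 (_ : [set: 'rV[int]_0] = [set 0%R]).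
    by rewrite esum_set1 ?big_ord0.
  by apply/seteqP; split => k //= _; apply/rowP => -[].
rewrite (@reindex_esum _ _ _ _ _ _ _ (@int_cons_bij n)) big_ord_recl.
transitivity (\esum_(p in [set: int] `*`` (fun=> [set: 'rV[int]_n]))
   ((f (x ord0 ord0) p.1)%:E * (\prod_i f (x ord0 (lift ord0 i)) (p.2 ord0 i))%:E)).
  rewrite (_ : _ `*`` _ = setT); last by apply/seteqP; split.
  apply: eq_esum => p _; rewrite big_ord_recl EFinM int_cons0.
  by congr (_ * (_)%:E); apply: eq_bigr => i _; rewrite int_consS.
rewrite -(@esum_esum _ _ _ _ _ (fun k0 (k : 'rV[int]_n) => (f (x ord0 ord0) k0)%:E *
  (\prod_i f (x ord0 (lift ord0 i)) (k ord0 i))%:E)); last first.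
  by move=> i j _ _; rewrite -EFinM lee_fin mulr_ge0// prodr_ge0.
set Q := (\prod_(_ < n) _)%R.
have Q0 : (0 <= Q)%R by apply: prodr_ge0.
transitivity (\esum_(k in [set: int]) (Q%:E * (f (x ord0 ord0) k)%:E)).
  apply: eq_esum => k _; rewrite esum_scalel//; last first.
    by move=> j; rewrite lee_fin prodr_ge0.
  rewrite muleC; congr (_ * _); have := IH (\row_i x ord0 (lift ord0 i)).
  under [in X in X = _]eq_esum => j _ do under eq_bigr do rewrite mxE.
  by move=> ->; congr EFin; apply: eq_bigr => i _; rewrite mxE.
rewrite esum_scalel//; last by move=> k; rewrite lee_fin.
by rewrite fF EFinM muleC.
Qed.

End lattice_sums.

(** * Periodised Gaussians *)

Section gaussian_theta.
Context {R : realType}.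
Local Open Scope ereal_scope.
Local Notation mu := (@lebesgue_measure R).

Definition gexp (c t : R) : R := expR (- (c * t ^+ 2)).

Lemma gexp_ge0 c t : (0 <= gexp c t)%R. Proof. exact: expR_ge0. Qed.

Lemma measurable_gexp c : measurable_fun setT (gexp c).
Proof.
apply: measurableT_comp => //; apply: measurableT_comp => //.
by apply: measurable_funM => //; exact: measurable_funX.
Qed.

Lemma integral_gexp c : (0 < c)%R -> \int[mu]_t (gexp c t)%:E = (Num.sqrt (pi / c))%:E.
Proof.
move=> c0; have a0 : (0 < (2 * c)^-1)%R by rewrite invr_gt0 mulr_gt0.
have p0 : (0 < pi / c)%R by rewrite divr_gt0 ?pi_gt0.
have -> : \int[mu]_t (gexp c t)%:E =
    \int[mu]_t ((Num.sqrt (pi / c))%:E * (gauss (2 * c)^-1 t)%:E).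
  apply: eq_integral => t _; rewrite -EFinM; congr EFin; rewrite /gauss.
  have -> : (2 * pi * (2 * c)^-1 = pi / c)%R by field; rewrite gt_eqF.
  rewrite mulVKf ?gt_eqF ?sqrtr_gt0//; congr (expR (- _))%R.
  by field; rewrite gt_eqF.
rewrite ge0_integralZl ?lee_fin//; last 2 first.
- by apply/measurable_EFinP; exact: measurable_gauss.
- by move=> t _; rewrite lee_fin gauss_ge0.
by rewrite integral_gauss// mule1.
Qed.

(** The integer translates of the half-open unit interval tile the line. *)
Lemma unfold_integral (f : R -> \bar R) :
  measurable_fun setT f -> (forall t, 0 <= f t) ->
  \esum_(k in [set: int]) \int[mu]_(s in `[0%R, 1%R[) f (s - k%:~R)%R = \int[mu]_s f s.
Proof.
move=> mf f0; have [e be] := infinite_countable_enum infinite_int.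
have mfs c : measurable_fun setT (fun s : R => f (s - c)%R).
  by apply: (measurableT_comp mf); exact: measurable_funB.
rewrite (esum_enum be); last by move=> k; exact: integral_ge0.
pose F n : set R := `[(- (e n)%:~R)%R, (- (e n)%:~R + 1)%R[%classic.
have FT : \bigcup_n F n = setT.
  apply/seteqP; split => // x _; have [_ _ es] := be.
  (* The tile of index [k] starts at [- k], because [f] is evaluated at [s - k]; hence the sign. *)
  have [n _ en] := es (- Num.floor x)%R I; exists n => //=.
  rewrite /F/= in_itv/= en mulrNz opprK floor_le_tmp/=.
  by have := floorD1_gt x; rewrite intrD.
rewrite -[in RHS]FT ge0_integral_bigcup//=.
- apply: eq_eseriesr => n _.
  rewrite integral_mkcond [RHS]integral_mkcond.
  rewrite -(integral_shift (e n)%:~R%R); last first.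
    by apply/(measurable_restrictT _ _).1; [exact: measurable_itv|exact: (measurable_funTS (mfs _))].
  apply: eq_integral => s _; rewrite !patchE /F !mem_setE !in_itv/=.
  by rewrite addrK -lerBlDr sub0r -ltrBrDr (addrC 1%R).
- by move=> k; exact: measurable_itv.
- exact: measurable_funTS.
- apply/trivIsetP => i j _ _ ij; rewrite -subset0 => x [/=].
  rewrite /F/= !in_itv/= => /andP[i1 i2] /andP[j1 j2].
  have [_ ei _] := be; move/eqP: ij; apply; apply: ei; rewrite ?inE//.
  have h1 : ((e j)%:~R - (e i)%:~R < 1 :> R)%R by lra.
  have h2 : ((e i)%:~R - (e j)%:~R < 1 :> R)%R by lra.
  move: h1 h2; rewrite -!rmorphB/= -[1%R]/(1%:~R)%R !ltr_int -[1%R]add0r !ltzD1 !subr_le0.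
  by move=> h1 h2; apply/eqP; rewrite eq_le h1 h2.
Qed.

(** Since [(x + s) ^+ 2 <= 2 * x ^+ 2 + 2], a value of the Gaussian is at most [expR c] times the
    mean of a wider one over a unit interval. Summed over integer translates, these means unfold to
    an integral over the line: this is [theta_bound]. *)
Lemma gexp_average c (x : R) : (0 < c)%R ->
  (gexp c x)%:E <= (expR c)%:E * \int[mu]_(s in `[0%R, 1%R[) (gexp (c / 2) (x + s))%:E.
Proof.
move=> c0.
have mg : measurable_fun setT (fun s : R => (gexp (c / 2) (x + s)%R)%:E).
  by apply/measurable_EFinP; apply: (measurableT_comp (measurable_gexp _)); exact: measurable_funD.
rewrite -ge0_integralZl ?lee_fin ?expR_ge0//; last 2 first.
- exact: measurable_funTS.
- by move=> s _; rewrite lee_fin gexp_ge0.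
have -> : (gexp c x)%:E = \int[mu]_(s in `[0%R, 1%R[) (gexp c x)%:E.
  by rewrite integral_cst//= lebesgue_measure_itv/= lte01 -EFinB subr0 mule1.
apply: ge0_le_integral => //.
- by move=> s _; rewrite lee_fin gexp_ge0.
- by apply: emeasurable_funM => //; exact: measurable_funTS.
move=> s; rewrite /= in_itv/= => /andP[s0 s1].
rewrite -EFinM lee_fin /gexp -expRD ler_expR.
have h : ((x + s) ^+ 2 <= 2 * x ^+ 2 + 2)%R by have := sqr_ge0 (x - s); nra.
have : (c / 2 * (x + s) ^+ 2 <= c / 2 * (2 * x ^+ 2 + 2))%R by rewrite ler_wpM2l// divr_ge0// ltW.
lra.
Qed.

Definition theta (c t : R) : R := fine (\esum_(k in [set: int]) (gexp c (t - k%:~R)%R)%:E).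

Lemma theta_bound c (t : R) : (0 < c)%R ->
  \esum_(k in [set: int]) (gexp c (t - k%:~R)%R)%:E <=
  (expR c * Num.sqrt (pi / (c / 2)))%:E.
Proof.
move=> c0; have c20 : (0 < c / 2)%R by rewrite divr_gt0.
have mg : measurable_fun setT (fun s : R => (gexp (c / 2) (s + t)%R)%:E).
  by apply/measurable_EFinP; apply: (measurableT_comp (measurable_gexp _)); exact: measurable_funD.
rewrite EFinM -(integral_gexp c20) -(integral_shift t); last first.
  by apply/measurable_EFinP; exact: measurable_gexp.
rewrite -unfold_integral//; last by move=> s; rewrite lee_fin gexp_ge0.
rewrite -esum_scalel ?expR_ge0//; last first.
  by move=> k; apply: integral_ge0 => s _; rewrite lee_fin gexp_ge0.
apply: le_esum => k _; apply: le_trans (gexp_average _ c0) _.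
rewrite lee_wpmul2l ?lee_fin ?expR_ge0// le_eqVlt; apply/orP; left; apply/eqP.
by apply: eq_integral => s _; congr (gexp _ _)%:E; ring.
Qed.

Lemma thetaE c (t : R) : (0 < c)%R ->
  \esum_(k in [set: int]) (gexp c (t - k%:~R)%R)%:E = (theta c t)%:E.
Proof.
move=> c0; rewrite fineK// ge0_fin_numE ?esum_ge0//.
  by apply: le_lt_trans (theta_bound t c0) _; rewrite ltry.
by move=> k _; rewrite lee_fin gexp_ge0.
Qed.

Lemma theta_ge0 c t : (0 <= theta c t)%R.
Proof. by rewrite fine_ge0// esum_ge0// => k _; rewrite lee_fin gexp_ge0. Qed.

Lemma theta_le c t : (0 < c)%R -> (theta c t <= expR c * Num.sqrt (pi / (c / 2)))%R.
Proof. by move=> c0; rewrite -lee_fin -thetaE// theta_bound. Qed.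

Lemma theta_periodic c t (z : int) : theta c (t + z%:~R) = theta c t.
Proof.
congr fine; rewrite [RHS](@reindex_esum _ _ _ setT setT (fun k => k - z)%R).
  by apply: eq_esum => k _; congr (gexp _ _)%:E; rewrite rmorphB/=; ring.
split => // [x y _ _ /addIr//|k _]; by exists (k + z)%R => //=; rewrite addrK.
Qed.

(** The shift gains a factor at most [expR (2 * c * |x| * |e|)], itself at most
    [1 + |e| * expR (4 * c * |x|)]. The wider Gaussian absorbs the last exponential: [8 * c] comes
    from [c / 2 * (|x| - 4) ^+ 2 >= 0]. *)
Lemma gexp_shift c (x e : R) : (0 < c)%R -> (`|e| <= 1)%R ->
  (gexp c (x + e) <= gexp c x + `|e| * expR (8 * c) * gexp (c / 2) x)%R.
Proof.
move=> c0 e1; pose y := (2 * c * `|x| * `|e|)%R.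
have y0 : (0 <= y)%R by rewrite !mulr_ge0// ltW.
have h1 : (gexp c (x + e) <= gexp c x * expR y)%R.
  rewrite /gexp -expRD ler_expR /y.
  have := ler_norm (- (x * e))%R; rewrite normrN normrM => h; nra.
have h2 : (expR y <= 1 + y * expR y)%R.
  have := expR_ge1Dx (- y)%R => h; have := expR_ge0 y => h'.
  have : (expR y * (1 - y) <= expR y * expR (- y))%R by rewrite ler_wpM2l.
  by rewrite expRxMexpNx_1; lra.
have h3 : (y * expR y <= `|e| * (expR (4 * c * `|x|)))%R.
  have -> : (4 * c * `|x| = 2 * c * `|x| + 2 * c * `|x|)%R by ring.
  rewrite expRD; have -> : (y = `|e| * (2 * c * `|x|))%R by rewrite /y; ring.
  rewrite -[leLHS]mulrA ler_wpM2l//.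
  apply: ler_pM; rewrite ?expR_ge0//; first by rewrite !mulr_ge0// ltW.
    by have := expR_ge1Dx (2 * c * `|x|)%R; lra.
  by rewrite ler_expR ler_piMl// !mulr_ge0// ltW.
have h4 : (gexp c x * expR (4 * c * `|x|) <= expR (8 * c) * gexp (c / 2) x)%R.
  rewrite /gexp -!expRD ler_expR -[(x ^+ 2)%R]real_normK ?num_real//.
  by have := sqr_ge0 (`|x| - 4)%R; nra.
apply: (le_trans h1).
apply: (@le_trans _ _ (gexp c x * (1 + `|e| * expR (4 * c * `|x|)))%R).
  by rewrite ler_wpM2l ?gexp_ge0// (le_trans h2)// lerD2l.
by rewrite mulrDr mulr1 lerD2l mulrCA -[leRHS]mulrA ler_wpM2l.
Qed.

(** The bound [gexp_shift] is summed over the integers, with [theta_le] for the wider Gaussian. It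
    feeds the uniform approximation by trigonometric polynomials. *)
Lemma theta_lipschitz c : (0 < c)%R -> exists2 L : R, (0 < L)%R &
  forall t s, (`|t - s| <= 1)%R -> (`|theta c t - theta c s| <= L * `|t - s|)%R.
Proof.
move=> c0; have c20 : (0 < c / 2)%R by rewrite divr_gt0.
pose B := (expR (c / 2) * Num.sqrt (pi / (c / 2 / 2)))%R.
have B0 : (0 <= B)%R by rewrite mulr_ge0 ?expR_ge0.
exists (expR (8 * c) * B + 1)%R; first by rewrite ltr_wpDl// mulr_ge0 ?expR_ge0.
have half t s : (`|t - s| <= 1)%R -> (theta c t - theta c s <= (expR (8 * c) * B + 1) * `|t - s|)%R.
  move=> ts; have : (theta c t <= theta c s + `|t - s| * expR (8 * c) * theta (c / 2) s)%R.
    rewrite -lee_fin EFinD [X in _ <= _ + X]EFinM -!thetaE//.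
    rewrite -esum_scalel ?mulr_ge0 ?expR_ge0//; last by move=> k; rewrite lee_fin gexp_ge0.
    rewrite -esumD; last 2 first.
    - by move=> k _; rewrite lee_fin gexp_ge0.
    - by move=> k _; rewrite -EFinM lee_fin !mulr_ge0 ?expR_ge0 ?gexp_ge0.
    apply: le_esum => k _; rewrite -EFinM -EFinD lee_fin.
    have := gexp_shift (s - k%:~R)%R c0 ts; congr (gexp _ _ <= _)%R; ring.
  have := theta_le s c20; rewrite -/B => h1 h2.
  have h3 : (`|t - s| * expR (8 * c) * theta (c / 2) s <= `|t - s| * expR (8 * c) * B)%R.
    by rewrite ler_wpM2l// mulr_ge0 ?expR_ge0.
  have := normr_ge0 (t - s)%R; lra.
move=> t s ts; rewrite ler_norml half// andbT lerNl opprB distrC half// distrC//.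
Qed.

Lemma measurable_theta c : (0 < c)%R -> measurable_fun setT (theta c).
Proof.
move=> c0; have [e be] := infinite_countable_enum infinite_int.
apply/measurable_EFinP; rewrite (_ : _ \o _ = fun t => \sum_(n <oo) (gexp c (t - (e n)%:~R)%R)%:E).
  apply: ge0_emeasurable_sum => [n t _ _|n _]; first by rewrite lee_fin gexp_ge0.
  by apply/measurable_EFinP; apply: (measurableT_comp (measurable_gexp _)); exact: measurable_funB.
by apply/funext => t /=; rewrite -thetaE// (esum_enum be)// => k; rewrite lee_fin gexp_ge0.
Qed.

(** Unfolding turns the mean over a period into the Gaussian integral over the line. *)
Lemma integral_theta c : (0 < c)%R ->
  \int[mu]_(t in `[0%R, 1%R]) (theta c t)%:E = (Num.sqrt (pi / c))%:E.
Proof.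
move=> c0; have [e be] := infinite_countable_enum infinite_int.
have mg n : measurable_fun setT (fun t : R => (gexp c (t - (e n)%:~R)%R)%:E).
  by apply/measurable_EFinP; apply: (measurableT_comp (measurable_gexp _)); exact: measurable_funB.
rewrite -integral_itv_bndo_bndc; last first.
  by apply/measurable_EFinP/measurable_funTS; exact: measurable_theta.
rewrite -integral_gexp// -unfold_integral; last 2 first.
- by apply/measurable_EFinP; exact: measurable_gexp.
- by move=> t; rewrite lee_fin gexp_ge0.
rewrite (esum_enum be); last first.
  by move=> k; apply: integral_ge0 => s _; rewrite lee_fin gexp_ge0.
rewrite -integral_nneseries//.
- apply: eq_integral => t _; rewrite -thetaE// (esum_enum be)// => k.
  by rewrite lee_fin gexp_ge0.
- by move=> n; exact: (measurable_funTS (mg n)).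
- by move=> n t _; rewrite lee_fin gexp_ge0.
Qed.

End gaussian_theta.

(** * Trigonometric approximation *)

Section trigonometric_approximation.
Context {R : realType}.
Local Notation mu := (@lebesgue_measure R).
Local Notation I f := (\int[mu]_(s in `[0%R, 1%R]) f s).

Let integ (f : R -> R) : continuous f -> mu.-integrable `[0%R, 1%R] (EFin \o f).
Proof.
move=> cf; apply: continuous_compact_integrable; first exact: segment_compact.
exact: continuous_subspaceT.
Qed.

Let cc (c : R) : continuous (fun _ : R => c).
Proof. exact: cst_continuous. Qed.

Let cD (f g : R -> R) : continuous f -> continuous g -> continuous (fun s : R => f s + g s).
Proof. by move=> cf cg s; apply: continuousD; [exact: cf|exact: cg]. Qed.

Let cB (f g : R -> R) : continuous f -> continuous g -> continuous (fun s : R => f s - g s).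
Proof. by move=> cf cg s; apply: continuousB; [exact: cf|exact: cg]. Qed.

Let cM (f g : R -> R) : continuous f -> continuous g -> continuous (fun s : R => f s * g s).
Proof. by move=> cf cg s; apply: continuousM; [exact: cf|exact: cg]. Qed.

Let ccomp (f g : R -> R) : continuous f -> continuous g -> continuous (fun s : R => f (g s)).
Proof. by move=> cf cg s; apply: (@continuous_comp _ _ _ g f); [exact: cg|exact: cf]. Qed.

Let crefl (t : R) : continuous (fun s : R => t - s).
Proof. by apply: cB; [exact: cc|move=> s A]. Qed.

(* [hide] keeps type class resolution away from the premise when rewriting. *)
Let FTC (F f : R -> R) : (forall x : R, hide (is_derive x (1 : R) F (f x))) -> continuous f ->
  I f = F 1 - F 0.
Proof.
move=> dF cf; have cF (x : R) : {for x, continuous F}.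
  have h : is_derive x (1 : R) F (f x) := dF x.
  exact/differentiable_continuous/derivable1_diffP/(@ex_derive _ _ _ _ _ _ _ h).
rewrite /Rintegral (@continuous_FTC2 _ f F)//.
- exact: continuous_subspaceT.
- split.
  + by move=> x _; have h : is_derive x (1 : R) F (f x) := dF x; exact: (@ex_derive _ _ _ _ _ _ _ h).
  + exact: cvg_at_right_filter (cF 0).
  + exact: cvg_at_left_filter (cF 1).
- by move=> x _; rewrite derive1E; have h : is_derive x (1 : R) F (f x) := dF x; exact: derive_val.
Qed.

(* [trig1 p mu] : p is a trigonometric polynomial of period 1 with mean mu. *)
Inductive trig1 : (R -> R) -> R -> Prop :=
| trig1_cos c (k : int) b :
    trig1 (fun t => c * cos (2 * pi * k%:~R * t + b)) (if k == 0 then c * cos b else 0)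
| trig1_add p q m n : trig1 p m -> trig1 q n -> trig1 (fun t => p t + q t) (m + n).

Lemma trig1_continuous p m : trig1 p m -> continuous p.
Proof.
elim=> [c k b|{}p q {}m n _ cp _ cq]; last exact: cD.
apply: cM; first exact: cc.
apply: (@ccomp cos (fun t => 2 * pi * k%:~R * t + b)); first exact: continuous_cos.
apply: cD; last exact: cc.
by apply: cM; [exact: cc|move=> t A].
Qed.

Lemma trig1_scale r p m : trig1 p m -> trig1 (fun t => r * p t) (r * m).
Proof.
elim=> [c k b|{}p q {}m n _ tp _ tq].
  have := trig1_cos (r * c) k b; under [X in trig1 X]eq_fun do rewrite -mulrA.
  by congr trig1; case: ifP; rewrite ?mulr0 ?mulrA.
have := trig1_add tp tq; rewrite -mulrDr.
by under [X in trig1 X]eq_fun do rewrite -mulrDr.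
Qed.

Lemma trig1_cosM p m : trig1 p m -> exists n, trig1 (fun t => p t * cos (2 * pi * t)) n.
Proof.
elim=> [c k b|{}p q {}m n _ [m' tp] _ [n' tq]]; last first.
  exists (m' + n'); have := trig1_add tp tq.
  by under [X in trig1 X]eq_fun do rewrite -mulrDl.
have t1 := trig1_cos (c / 2) (k + 1) b; have t2 := trig1_cos (c / 2) (k - 1) b.
have := trig1_add t1 t2; set n := (X in trig1 _ X) => tn; exists n.
rewrite (_ : (fun t : R => _) = (fun t : R =>
  c / 2 * cos (2 * pi * (k + 1)%:~R * t + b) + c / 2 * cos (2 * pi * (k - 1)%:~R * t + b)))//.
apply/funext => t; rewrite intrD intrB.
have -> : 2 * pi * (k%:~R + 1%:~R) * t + b = (2 * pi * k%:~R * t + b) + 2 * pi * t :> R by ring.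
have -> : 2 * pi * (k%:~R - 1%:~R) * t + b = (2 * pi * k%:~R * t + b) - 2 * pi * t :> R by ring.
by move: (2 * pi * k%:~R * t + b) => A; rewrite cosD cosB; field.
Qed.

(** The mean is left unspecified: normalising the kernel only asks for its positivity. *)
Lemma trig1_kernel n : exists m, trig1 (fun t => (1 + cos (2 * pi * t)) ^+ n) m.
Proof.
elim: n => [|n [m tn]].
  exists 1; have := trig1_cos 1 0 0; rewrite eqxx cos0 mulr1.
  by under [X in trig1 X]eq_fun do rewrite mulr0 mul0r add0r cos0 mulr1.
have [m' tm] := trig1_cosM tn; exists (m + m'); have := trig1_add tn tm.
by under [X in trig1 X]eq_fun do rewrite -{1}[(1 + _) ^+ n]mulr1 -mulrDr -exprSr.
Qed.

Let is_derive_cosl (k b t : R) :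
  is_derive t (1 : R) (fun t => cos (k * t + b)) (- sin (k * t + b) * k).
Proof.
have dq : is_derive t (1 : R) (fun t => k * t + b) k.
  rewrite (_ : (fun t => _) = (k \*: @id R) + cst b); last by apply/funext.
  by apply: is_derive_eq; rewrite /GRing.scale/= mulr1 addr0.
exact: (@is_derive1_comp _ cos (fun t => k * t + b) t _ _ (is_derive_cos _) dq).
Qed.

Let is_derive_sinl (k b t : R) :
  is_derive t (1 : R) (fun t => sin (k * t + b)) (cos (k * t + b) * k).
Proof.
have dq : is_derive t (1 : R) (fun t => k * t + b) k.
  rewrite (_ : (fun t => _) = (k \*: @id R) + cst b); last by apply/funext.
  by apply: is_derive_eq; rewrite /GRing.scale/= mulr1 addr0.
exact: (@is_derive1_comp _ sin (fun t => k * t + b) t _ _ (is_derive_sin _) dq).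
Qed.

Let continuous_cosl (k b : R) : continuous (fun t => cos (k * t + b)).
Proof.
move=> t; have h := is_derive_cosl k b t.
exact/differentiable_continuous/derivable1_diffP/(@ex_derive _ _ _ _ _ _ _ h).
Qed.

Lemma cos_int_shift (k : int) (x : R) : cos (x + 2 * pi * k%:~R) = cos x.
Proof.
have h (n : nat) y : cos (y + 2 * pi * n%:R) = cos y :> R.
  have -> : y + 2 * pi * n%:R = y + (pi *+ 2) *+ n :> R by rewrite -mulr_natr mulr2n; ring.
  exact: periodicn (@cosD2pi R) n y.
case: k => n; first exact: h.
by rewrite NegzE mulrNz -pmulrn mulrN -[LHS](h n.+1) subrK.
Qed.

Lemma sin_int_shift (k : int) (x : R) : sin (x + 2 * pi * k%:~R) = sin x.
Proof.
have E y : sin y = cos (y - pi / 2) :> R by rewrite cosB cos_pihalf sin_pihalf; ring.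
by rewrite !E addrAC cos_int_shift.
Qed.

(** A nonzero frequency has an antiderivative of period 1, so only frequency 0 contributes, whatever
    the offset [t]. *)
Lemma trig1_mean p m t : trig1 p m -> I (fun s => p (t - s)) = m.
Proof.
elim=> [c k b|{}p q {}m n tp Ip tq Iq]; last first.
  have ct f m' : trig1 f m' -> continuous (fun s : R => f (t - s)).
    by move=> tf; have cf := trig1_continuous tf; have H := @ccomp f (fun s : R => t - s) cf (@crefl t).
  by rewrite RintegralD ?Ip ?Iq//; apply: integ; apply: ct; eassumption.
have [->|k0] := eqVneq k 0.
  under eq_Rintegral do rewrite mulr0 mul0r add0r.
  have m1 : lebesgue_measure (`[0%R, 1%R]%classic : set R) = 1%E.
    by rewrite lebesgue_measure_itv/= lte01 -EFinB subr0.
  by rewrite Rintegral_cst//= [fine _](_ : _ = 1) ?mulr1//= m1.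
have w0 : 2 * pi * k%:~R != 0 :> R by rewrite mulf_neq0 ?intr_eq0// mulf_neq0 ?pnatr_eq0// gt_eqF// pi_gt0.
set w := 2 * pi * k%:~R in w0 *.
have E s : c * cos (w * (t - s) + b) = c * cos ((- w) * s + (w * t + b)).
  by congr (_ * cos _); ring.
under eq_Rintegral do rewrite E.
rewrite (FTC (F := fun s => - (c / w) * sin ((- w) * s + (w * t + b)))).
- rewrite mulr1 mulr0 add0r.
  have -> : sin (w * t + b) = sin (- w + (w * t + b)).
    by rewrite -[RHS](sin_int_shift k) -/w; congr sin; ring.
  by rewrite subrr.
- move=> s; rewrite /hide; have h := is_derive_sinl (- w) (w * t + b) s.
  rewrite (_ : (fun s => _) = (- (c / w)) \*: (fun s => sin ((- w) * s + (w * t + b)))); last by apply/funext.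
  by apply: is_derive_eq; rewrite /GRing.scale/=; field.
- by apply: cM; [exact: cc|exact: continuous_cosl].
Qed.

(** The addition formula separates [t] from [s], so each frequency is kept; at frequency 0 the
    coefficient is the mean of [f] times that of [p]. *)
Lemma trig1_convolution (f : R -> R) p m : continuous f -> trig1 p m ->
  trig1 (fun t => I (fun s => f s * p (t - s))) (I f * m).
Proof.
move=> cf; elim=> [c k b|{}p q {}m n tp Ip tq Iq]; last first.
  rewrite mulrDr (_ : (fun t => _) = (fun t => I (fun s => f s * p (t - s)) + I (fun s => f s * q (t - s)))).
    exact: trig1_add.
  apply/funext => t; under eq_Rintegral do rewrite mulrDr.
  have ct g m' : trig1 g m' -> continuous (fun s : R => f s * g (t - s)).
    by move=> tg; have cg := trig1_continuous tg; have H := @ccomp g (fun s : R => t - s) cg (@crefl t); apply: cM.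
  by rewrite RintegralD//; apply: integ; apply: ct; eassumption.
set w := 2 * pi * k%:~R.
pose A := I (fun s => f s * cos (- w * s + b)).
pose B := I (fun s => f s * cos (- w * s + (b - pi / 2))).
have cA b' : continuous (fun s : R => f s * cos (- w * s + b')).
  by apply: cM => //; exact: continuous_cosl.
have sinE x : cos (x - pi / 2) = sin x :> R by rewrite cosB cos_pihalf sin_pihalf; ring.
have E t : I (fun s => f s * (c * cos (w * (t - s) + b))) =
    c * A * cos (w * t) - c * B * sin (w * t).
  transitivity (I (fun s => c * cos (w * t) * (f s * cos (- w * s + b)) +
     (- (c * sin (w * t))) * (f s * cos (- w * s + (b - pi / 2))))).
    apply: eq_Rintegral => s _.
    have -> : w * (t - s) + b = w * t + (- w * s + b) by ring.
    by rewrite cosD addrA sinE; ring.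
  rewrite RintegralD//; [|by apply: integ; apply: cM; [exact: cc|exact: cA]..].
  rewrite !RintegralZl//; [|by apply: integ; exact: cA..].
  by rewrite -/A -/B; ring.
rewrite (_ : (fun t => _) = (fun t => c * A * cos (w * t + 0) + c * B * cos (w * t + pi / 2))); last first.
  apply/funext => t; rewrite E addr0 cosD cos_pihalf sin_pihalf; ring.
have := trig1_add (trig1_cos (c * A) k 0) (trig1_cos (c * B) k (pi / 2)); congr trig1.
rewrite cos0 cos_pihalf; case: eqP => [k0|_]; last by rewrite mulr0 addr0.
rewrite mulr1 mulr0 addr0 /A /w k0 mulr0 oppr0.
under eq_Rintegral do rewrite mul0r add0r mulrC.
by rewrite RintegralZl ?integ//; ring.
Qed.

(* The kernel (1 + cos)^n concentrates at 0: differentiating (1 + cos)^n sin shows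
   that the mean of 1 - cos against it is 1 / (n + 1). *)
Lemma kernel_moment n (t : R) :
  n.+2%:R * I (fun s => (1 + cos (2 * pi * (t - s))) ^+ n.+1 * (1 - cos (2 * pi * (t - s)))) =
  I (fun s => (1 + cos (2 * pi * (t - s))) ^+ n.+1).
Proof.
pose w : R := 2 * pi; pose b := w * t.
pose C s := cos (- w * s + b); pose S s := sin (- w * s + b).
have EC s : cos (2 * pi * (t - s)) = C s by congr cos; rewrite /b /w; ring.
under eq_Rintegral do rewrite EC; under [RHS]eq_Rintegral do rewrite EC.
have cC : continuous C by exact: continuous_cosl.
have c1C k : continuous (fun s : R => (1 + C s) ^+ k).
  apply: (@ccomp (fun x => x ^+ k) (fun s => 1 + C s)); first exact: exprn_continuous.
  by apply: cD => //; exact: cc.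
have cm : continuous (fun s : R => (1 + C s) ^+ n.+1 * (1 - C s)).
  by apply: cM; [exact: c1C|apply: cB => //; exact: cc].
have w0 : w != 0 by rewrite mulf_neq0 ?pnatr_eq0// gt_eqF// pi_gt0.
apply/eqP; rewrite -subr_eq0 -RintegralZl ?integ// -RintegralB ?integ//; last first.
  by apply: cM => //; exact: cc.
apply/eqP; rewrite (FTC (F := fun s => w^-1 * ((1 + C s) ^+ n.+1 * S s))).
- have -> : C 1 = C 0.
    by rewrite /C mulr0 mulr1 add0r -[RHS](cos_int_shift (-1)); congr cos; rewrite /w /=; ring.
  have -> : S 1 = S 0.
    by rewrite /S mulr0 mulr1 add0r -[RHS](sin_int_shift (-1)); congr sin; rewrite /w /=; ring.
  by rewrite subrr.
- move=> s; rewrite /hide; have hC := is_derive_cosl (- w) b s; have hS := is_derive_sinl (- w) b s.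
  rewrite (_ : (fun s => _) = w^-1 \*: (((cst 1 + C) ^+ n.+1) * S)); last first.
    by apply/funext => u /=; rewrite exprfctE.
  apply: is_derive_eq; rewrite /GRing.scale/= -/(C s) -/(S s) add0r.
  have S2 : S s ^+ 2 = (1 + C s) * (1 - C s) by rewrite /S sin2cos2; rewrite -/(C s); ring.
  rewrite !fctE /= exprS -[n.+2]addn1 -[n.+1 in RHS]addn1 !natrD.
  have : S s * S s = (1 + C s) * (1 - C s) by rewrite -expr2.
  move: (S s) (C s) => x y xy; set z := (1 + y) ^+ n.
  transitivity ((1 + n%:R) * z * (x * x) - z * (1 + y) * y); first by field.
  rewrite xy; ring.
- by apply: cB; [apply: cM => //; exact: cc|exact: c1C].
Qed.

(** Convolution with [(1 + cos) ^+ n.+1] divided by its mean, which preserves the mean of [f]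
    exactly. By [key], [f] varies by at most [e / 2] plus [M] times [1 - cos], and [kernel_moment]
    gives [1 - cos] the kernel average [1 / n.+2]. *)
Lemma trig1_approx (f : R -> R) (L B : R) : (forall t (z : int), f (t + z%:~R) = f t) ->
  (forall t, `|f t| <= B) -> 0 < L ->
  (forall t s, `|t - s| <= 1 -> `|f t - f s| <= L * `|t - s|) ->
  forall e : R, 0 < e -> exists2 p, trig1 p (I f) & forall t, `|p t - f t| <= e.
Proof.
move=> fper fB L0 fL e e0.
have B0 : 0 <= B by apply: le_trans (fB 0).
have cf : continuous f.
  move=> t; apply/cvgrPdist_le => r r0; near=> s.
  have ts1 : `|t - s| <= 1 by near: s; apply: cvgr_dist_le.
  apply: (le_trans (fL t s ts1)); rewrite -ler_pdivlMl// mulrC.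
  by near: s; apply: cvgr_dist_le => //; rewrite divr_gt0.
(* Within [d] the Lipschitz bound gives [e / 2]; the cap keeps [2 * pi * d] in the range where the
   cosine decreases. *)
pose d := Num.min (4^-1) (e / 2 / L).
have d0 : 0 < d by rewrite lt_min invr_gt0 ltr0n/= !divr_gt0.
have d4 : d <= 4^-1 by rewrite ge_min lexx.
have dL : L * d <= e / 2.
  by rewrite -ler_pdivlMl// mulrC ge_min lexx orbT.
have p0 := @pi_gt0 R.
have mem (x : R) : 0 <= x -> x <= pi -> x \in `[0, pi] by move=> x0 xp; rewrite in_itv/= x0.
have dp0 : 0 < 2 * pi * d by rewrite !mulr_gt0.
have half_turn (x : R) : x <= 1 / 2 -> 2 * pi * x <= pi by nra.
have dpi : 2 * pi * d <= pi by apply: half_turn; lra.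
have q0 : 0 < 1 - cos (2 * pi * d).
  by rewrite subr_gt0 -[X in _ < X]cos0 ltr_cos ?mem// ltW.
(* Beyond distance [d] from the integers, [M * (1 - cos)] is at least [2 * B], the largest possible
   variation of [f]. *)
pose M := 2 * B / (1 - cos (2 * pi * d)).
have M0 : 0 <= M by apply: divr_ge0; [rewrite mulr_ge0|exact: ltW].
have key t s : `|f s - f t| <= e / 2 + M * (1 - cos (2 * pi * (t - s))).
  have c1 := cos_le1 (2 * pi * (t - s)).
  pose z := Num.floor (t - s + 1 / 2); pose u := t - s - z%:~R.
  have /andP[u1 u2] : - (1 / 2) <= u < 1 / 2.
    have := floor_itv (t - s + 1 / 2); rewrite -/z intrD => /andP[h1 h2].
    by rewrite /u; apply/andP; split; lra.
  have fu : f t = f (s + u) by rewrite -(fper (s + u) z) /u; congr f; ring.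
  have cu : cos (2 * pi * (t - s)) = cos (2 * pi * u).
    by rewrite -[RHS](cos_int_shift z) /u; congr cos; ring.
  have au : `|u| <= 1 / 2 by rewrite ler_norml u1 ltW.
  have [ud|ud] := leP `|u| d.
    have : `|f s - f (s + u)| <= L * `|u|.
      have -> : `|u| = `|s - (s + u)| by rewrite opprD addrA subrr sub0r normrN.
      by apply: fL; rewrite opprD addrA subrr sub0r normrN; lra.
    rewrite -fu => h; have h2 : L * `|u| <= L * d by rewrite ler_wpM2l// ltW.
    have h3 : 0 <= M * (1 - cos (2 * pi * (t - s))) by rewrite mulr_ge0// subr_ge0.
    lra.
  have hc : cos (2 * pi * (t - s)) <= cos (2 * pi * d).
    have -> : cos (2 * pi * (t - s)) = cos (2 * pi * `|u|).
      rewrite cu; case: (ger0P u) => _ //; by rewrite mulrN cosN.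
    have up : 2 * pi * `|u| <= pi by exact: half_turn.
    have u0 : 0 <= 2 * pi * `|u| by rewrite !mulr_ge0// ltW.
    by apply: ltW; rewrite ltr_cos ?mem ?(ltW dp0)// ltr_pM2l ?mulr_gt0.
  have h1 : `|f s - f t| <= 2 * B.
    apply: (le_trans (ler_normB _ _)); have := fB s; have := fB t; lra.
  have h2 : 2 * B = M * (1 - cos (2 * pi * d)) by rewrite /M divfK// gt_eqF.
  have h3 : M * (1 - cos (2 * pi * d)) <= M * (1 - cos (2 * pi * (t - s))).
    by rewrite ler_wpM2l// lerB.
  lra.
(* Large enough for [M / n.+2] to be at most [e / 2]. *)
pose n := Num.truncn (2 * M / e).
have nM : M / n.+2%:R <= e / 2.
  have h : 2 * M / e < n.+1%:R by exact: truncnS_gt.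
  have n2 : 0 < n.+2%:R :> R by rewrite ltr0n.
  have h' : n.+1%:R <= n.+2%:R :> R by rewrite ler_nat.
  rewrite ler_pdivrMr// -ler_pdivrMl ?divr_gt0//.
  have -> : (e / 2)^-1 * M = 2 * M / e by field; rewrite gt_eqF.
  lra.
have [m tK] := trig1_kernel n.+1.
pose k (t s : R) := (1 + cos (2 * pi * (t - s))) ^+ n.+1.
have ck t : continuous (k t).
  exact: (@ccomp _ (fun s : R => t - s) (trig1_continuous tK) (@crefl t)).
have k0 t s : 0 <= k t s by rewrite exprn_ge0//; have := cos_geN1 (2 * pi * (t - s)); lra.
have Ik t : I (k t) = m by exact: trig1_mean tK.
(* Bernoulli's inequality bounds the kernel below by [1 + n.+1 * cos], a trigonometric polynomial of
   mean 1. *)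
have m0 : 0 < m.
  have bern (x : R) j : -1 <= x -> 1 + j%:R * x <= (1 + x) ^+ j.
    move=> x1; elim: j => [|j IH]; first by rewrite mul0r addr0 expr0.
    rewrite exprSr; apply: (@le_trans _ _ ((1 + j%:R * x) * (1 + x))).
      by rewrite -natr1; have := sqr_ge0 x; have : 0 <= j%:R :> R by []; nra.
    by rewrite ler_wpM2r//; lra.
  have tb := trig1_add (trig1_cos 1 0 0) (trig1_cos n.+1%:R 1 0).
  rewrite /= cos0 mulr1 addr0 in tb.
  rewrite -(Ik 0); apply: (@lt_le_trans _ _ 1) => //.
  have hb := trig1_mean 0 tb; rewrite -[leLHS]hb.
  apply: le_Rintegral => //.
  - apply: integ; exact: (@ccomp _ (fun s : R => 0 - s) (trig1_continuous tb) (@crefl 0)).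
  - exact: integ.
  - move=> s _; rewrite mulr0 mul0r add0r cos0 mulr1 addr0 mulr1.
    by apply: bern; exact: cos_geN1.
exists (fun t => m^-1 * I (fun s => f s * k t s)).
  have := trig1_scale m^-1 (trig1_convolution cf tK).
  by rewrite mulrCA mulVf ?gt_eqF// mulr1.
move=> t; rewrite -(ler_pM2l m0) -[X in X * `|_| <= _](gtr0_norm m0) -normrM mulrBr mulrA.
rewrite mulfV ?gt_eqF// mul1r.
have cfk : continuous (fun s : R => f s * k t s) by apply: cM => //; exact: ck.
have cfk' : continuous (fun s : R => f t * k t s).
  by apply: cM; [exact: cc|exact: ck].
rewrite -{1}(Ik t) (mulrC _ (f t)) -RintegralZl ?integ// -RintegralB ?integ//.
have cd : continuous (fun s : R => f s * k t s - f t * k t s).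
  exact: cB.
apply: (le_trans (le_normr_Rintegral _ (integ cd))) => //.
pose g s := e / 2 * k t s + M * (k t s * (1 - cos (2 * pi * (t - s)))).
have cg1 : continuous (fun s : R => k t s * (1 - cos (2 * pi * (t - s)))).
  apply: cM; first exact: ck.
  apply: cB; first exact: cc.
  apply: (@ccomp cos (fun s => 2 * pi * (t - s))); first exact: continuous_cos.
  by apply: cM; [exact: cc|exact: crefl].
have ce : continuous (fun s : R => e / 2 * k t s).
  by apply: cM; [exact: cc|exact: ck].
have cMk : continuous (fun s : R => M * (k t s * (1 - cos (2 * pi * (t - s))))).
  by apply: cM => //; exact: cc.
have cg : continuous g by exact: cD.
apply: (@le_trans _ _ (I g)).
  apply: le_Rintegral => //.
  - by apply: integ => s; apply: (continuous_comp (cd s)); exact: norm_continuous.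
  - exact: integ.
  - move=> s _; rewrite -mulrBl normrM (ger0_norm (k0 t s)) /g.
    by have := key t s; have := k0 t s; nra.
rewrite /g RintegralD ?integ// !RintegralZl ?integ// Ik.
have Jm : n.+2%:R * I (fun s => k t s * (1 - cos (2 * pi * (t - s)))) = m.
  by rewrite -(Ik t); exact: kernel_moment.
set J := \int[mu]_(s in `[0%R, 1%R]) (k t s * (1 - cos (2 * pi * (t - s)))) in Jm *.
have n2 : 0 < n.+2%:R :> R by rewrite ltr0n.
have JE : J = m / n.+2%:R by rewrite -Jm mulrAC mulfV ?gt_eqF// mul1r.
rewrite JE; have -> : M * (m / n.+2%:R) = M / n.+2%:R * m by ring.
apply: (@le_trans _ _ (e / 2 * m + e / 2 * m)); first by rewrite lerD2l ler_wpM2r// ltW.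
by rewrite -mulrDl -splitr mulrC.
Unshelve. all: by end_near. Qed.

End trigonometric_approximation.

(** * Trigonometric polynomials in several variables *)

Section equidistribution.
Context {R : realType}.
Local Notation mu := (@lebesgue_measure R).
Local Notation lam n := (@lebesgue_rV R n).

Inductive trig n : ('rV[R]_n -> R) -> R -> Prop :=
| trig_cos c (k : 'rV[int]_n) b :
    trig (fun x => c * cos (2 * pi * dotv (map_mx intr k) x + b))
         (if k == 0 then c * cos b else 0)
| trig_add f g m m' : trig f m -> trig g m' -> trig (fun x => f x + g x) (m + m').

Lemma trig_eq n (f g : 'rV[R]_n -> R) m m' : trig f m -> f =1 g -> m = m' -> trig g m'.
Proof. by move=> tf fg <-; have <- : f = g by apply/funext. Qed.

Lemma dotv_int_cons n k0 (k : 'rV[int]_n) (x : 'rV[R]_n.+1) :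
  dotv (map_mx intr (int_cons (k0, k))) x =
  k0%:~R * x ord0 ord0 + dotv (map_mx intr k) (\row_i x ord0 (lift ord0 i)).
Proof.
rewrite /dotv big_ord_recl mxE int_cons0; congr (_ + _).
by apply: eq_bigr => i _; rewrite mxE int_consS !mxE.
Qed.

Lemma int_cons_eq0 n k0 (k : 'rV[int]_n) : (int_cons (k0, k) == 0) = (k0 == 0) && (k == 0).
Proof.
apply/eqP/andP => [h|[/eqP-> /eqP->]].
  split; apply/eqP.
    by have := congr1 (fun v : 'rV[int]_n.+1 => v ord0 ord0) h; rewrite int_cons0 mxE.
  apply/rowP => i; have := congr1 (fun v : 'rV[int]_n.+1 => v ord0 (lift ord0 i)) h.
  by rewrite int_consS !mxE.
apply/rowP => j; rewrite [RHS]mxE; case: (unliftP ord0 j) => [i ->|->].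
  by rewrite int_consS mxE.
by rewrite int_cons0.
Qed.

(** Product-to-sum formula: the frequencies [(k0, k)] and [(k0, - k)] appear with half weight each,
    and their parts at frequency 0 add up to the product of the means. *)
Lemma trig_cons n p mp (f : 'rV[R]_n -> R) m : trig1 p mp -> trig f m ->
  trig (fun x : 'rV[R]_n.+1 => p (x ord0 ord0) * f (\row_i x ord0 (lift ord0 i))) (mp * m).
Proof.
move=> tp; elim=> {f m} [c k b|f g m m' _ IHf _ IHg]; last first.
  by apply: trig_eq (trig_add IHf IHg) _ _ => [x|]; rewrite mulrDr.
elim: tp => {p mp} [c0 k0 b0|p q mp mq _ IHp _ IHq]; last first.
  apply: trig_eq (trig_add IHp IHq) _ _ => [x|].
    by rewrite [RHS]mulrDl.
  by rewrite [RHS]mulrDl.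
have t1 := trig_cos (c0 * c / 2) (int_cons (k0, k)) (b0 + b).
have t2 := trig_cos (c0 * c / 2) (int_cons (k0, - k)) (b0 - b).
apply: trig_eq (trig_add t1 t2) _ _ => [x|].
  rewrite !dotv_int_cons.
  have -> : map_mx intr (- k) = - map_mx intr k :> 'rV[R]_n by rewrite map_mxN.
  rewrite [dotv (- _) _]dotvC dotvNr [dotv (\row__ _) _]dotvC; set A := dotv _ _; set y := x ord0 ord0.
  have -> : 2 * pi * (k0%:~R * y + A) + (b0 + b) = (2 * pi * k0%:~R * y + b0) + (2 * pi * A + b) by ring.
  have -> : 2 * pi * (k0%:~R * y - A) + (b0 - b) = (2 * pi * k0%:~R * y + b0) - (2 * pi * A + b) by ring.
  move: (2 * pi * k0%:~R * y + b0) (2 * pi * A + b) => u w.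
  by rewrite cosD cosB; field.
rewrite !int_cons_eq0 oppr_eq0; case: (k0 == 0); case: (k == 0) => /=; rewrite ?mulr0 ?mul0r ?addr0//.
by rewrite cosD cosB; field.
Qed.

(** Induction on the dimension. The error splits as [p * (g - P) + (p - f) * P], and [e1], [e2]
    grant each term [e / 2] against a bound of the other factor. The mean stays exactly
    [mf ^+ n]. *)
Lemma trig_product_approx (f : R -> R) (mf B : R) n : (forall t, `|f t| <= B) ->
  (forall e : R, 0 < e -> exists2 p, trig1 p mf & forall t, `|p t - f t| <= e) ->
  forall e : R, 0 < e -> exists2 g, @trig n g (mf ^+ n) &
    forall x : 'rV[R]_n, `|g x - \prod_i f (x ord0 i)| <= e.
Proof.
move=> fB fapp; have B0 : 0 <= B by apply: le_trans (fB 0).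
have pB k (x : 'rV[R]_k) : `|\prod_i f (x ord0 i)| <= B ^+ k.
  rewrite normr_prod -[k in _ ^+ k]card_ord -prodr_const.
  by apply: ler_prod => i _; rewrite normr_ge0 fB.
elim: n => [|n IH] e e0.
  exists (fun=> 1); last by move=> x; rewrite big_ord0 subrr normr0 ltW.
  apply: trig_eq (trig_cos 1 0 0) _ _ => [x|]; last by rewrite eqxx cos0 mulr1 expr0.
  by rewrite /dotv big_ord0 mulr0 addr0 cos0 mulr1.
have BB0 : 0 <= B ^+ n by rewrite exprn_ge0.
pose e1 := e / (2 * (B ^+ n + 1)).
have e10 : 0 < e1 by rewrite divr_gt0// mulr_gt0// ltr_wpDl.
have [p tp pf] := fapp _ e10.
pose e2 := e / (2 * (B + e1 + 1)).
have e20 : 0 < e2 by rewrite divr_gt0// mulr_gt0// ltr_wpDl// addr_ge0// ltW.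
have [g tg gf] := IH _ e20.
exists (fun x => p (x ord0 ord0) * g (\row_i x ord0 (lift ord0 i))).
  by rewrite exprS; exact: trig_cons.
move=> x; rewrite big_ord_recl.
have -> : \prod_(i < n) f (x ord0 (lift ord0 i)) =
    \prod_(i < n) f ((\row_i x ord0 (lift ord0 i)) ord0 i) by apply: eq_bigr => i _; rewrite mxE.
move: (\row_i _) (x ord0 ord0) => y t; have h1 := pf t; have h2 := gf y; have h3 := pB n y.
set P := \prod_(i < n) _ in h2 h3 *.
have h4 := fB t.
have -> : p t * g y - f t * P = p t * (g y - P) + (p t - f t) * P by ring.
apply: (le_trans (ler_normD _ _)); rewrite !normrM.
have pt : `|p t| <= B + e1.
  have -> : p t = f t + (p t - f t) by ring.
  by apply: (le_trans (ler_normD _ _)); rewrite lerD.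
have a1 : `|p t| * `|g y - P| <= (B + e1) * e2 by apply: ler_pM.
have a2 : `|p t - f t| * `|P| <= e1 * B ^+ n by apply: ler_pM.
have b1 : (B + e1) * e2 <= e / 2.
  have h : 0 < 2 * (B + e1 + 1) by rewrite mulr_gt0// ltr_wpDl// addr_ge0// ltW.
  by rewrite /e2 mulrA ler_pdivrMr//; nra.
have b2 : e1 * B ^+ n <= e / 2.
  have h : 0 < 2 * (B ^+ n + 1) by rewrite mulr_gt0// ltr_wpDl.
  by rewrite /e1 mulrAC ler_pdivrMr//; nra.
lra.
Qed.

End equidistribution.

(** * Equidistribution *)

Section dilation.
Context {R : realType}.
Local Notation lam n := (@lebesgue_rV R n).
Variables (n : nat) (K : set 'rV[R]_n.+2).
Hypotheses (cK : compact K) (vK : cvx K).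
Hypotheses (strict : forall p q, K p -> K q -> p != q ->
  ~ (forall t : R, 0 <= t -> t <= 1 -> frontier K (p + t *: (q - p)))).

Lemma measurable_cos_dotv m (k : 'rV[R]_m) (b : R) :
  measurable_fun setT (fun z : 'rV[R]_m => cos (dotv k z + b)).
Proof.
have m1 : measurable_fun setT (fun z : 'rV[R]_m => dotv k z + b).
  apply: measurable_funD; last exact: measurable_cst.
  by apply: measurable_dotv => //; exact: measurable_cst.
exact: (measurableT_comp (continuous_measurable_fun (@continuous_cos R)) m1).
Qed.

Lemma dilateP (r : R) z : 0 < r -> dilate r K z <-> K (r^-1 *: z).
Proof.
move=> r0; split => [[x Kx <-]|Kz].
  by rewrite scalerA mulVf ?gt_eqF// scale1r.
by exists (r^-1 *: z) => //; rewrite scalerA mulfV ?gt_eqF// scale1r.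
Qed.

Lemma compact_dilate (r : R) : compact (dilate r K).
Proof.
apply: continuous_compact => //; apply: continuous_subspaceT => z.
exact: scaler_continuous.
Qed.

Lemma cvx_dilate (r : R) : cvx (dilate r K).
Proof.
move=> _ _ l [x Kx <-] [y Ky <-] l0 l1; exists (x + l *: (y - x)); first exact: vK.
by apply/rowP => j; rewrite !mxE; ring.
Qed.

Lemma lebesgue_escape_dilate (r : R) v : 0 < r ->
  (lam n.+2 (escape (dilate r K) v) =
   (r ^+ n.+2)%:E * lam n.+2 (escape K (r^-1 *: v)))%E.
Proof.
move=> r0; have m1 := measurable_escape cK (r^-1 *: v).
have m2 : measurable (escape (dilate r K) v) by apply: measurable_escape; exact: compact_dilate.
rewrite (measure_integral_indic _ m1) (measure_integral_indic _ m2).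
rewrite (@ge0_integral_rV_affine _ _ r 0)//; last first.
  by apply/measurable_EFinP; exact: measurable_indic.
congr (_ * _)%E; apply: eq_integral => z _; rewrite !indicE addr0.
congr (_%:R)%:E; congr nat_of_bool; apply/idP/idP; rewrite !inE /escape/=.
  move=> [/(dilateP _ r0) h1 h2]; move: h1; rewrite scalerA mulVf ?gt_eqF// scale1r => Kz.
  split => // h; apply: h2; apply/dilateP => //.
  by rewrite scalerDr scalerA mulVf ?gt_eqF// scale1r.
move=> [Kz h2]; split; first by exists z.
move=> /(dilateP _ r0); rewrite scalerDr scalerA mulVf ?gt_eqF// scale1r; exact: h2.
Qed.

(** The escape set is [C1] minus [C2], where [C2] is [C1] cut with its translate by [- v]. Both are
    convex with the roundness of [K] scaled by [r], because translations respect midpoints;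
    [oscillation_convex] bounds both integrals. *)
Lemma escape_oscillation (k v : 'rV[R]_n.+2) (i : 'I_n.+2) (b e : R) :
  k ord0 i != 0 -> 0 < e -> exists2 r0 : R, 0 < r0 & forall r, r0 <= r ->
  `|\int[lam n.+2]_(z in escape (dilate r K) v) cos (dotv k z + b)| <= e * r ^+ n.+1.
Proof.
move=> ki e0; have p0 := @pi_gt0 R.
have [M M0 KM] : exists2 M : R, 0 <= M & forall x, K x -> `|x| <= M.
  have [B [_ BK]] := compact_bounded cK; exists (Num.max 0 B + 1).
    by rewrite addr_ge0// le_max lexx.
  by apply: BK; rewrite ltr_pwDr// le_max lexx orbT.
have k0 : 0 < `|k ord0 i| by rewrite normr_gt0.
pose W := pi / `|k ord0 i|; have W0 : 0 < W by rewrite divr_gt0.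
have P0 : 0 <= (2 * M) ^+ n by rewrite exprn_ge0// mulr_ge0.
(* Each of the two convex sets costs [4 * (W * (s * r)) * (2 * M * r) ^+ n]; together this is at
   most [e * r ^+ n.+1]. *)
pose s := e / (8 * W * ((2 * M) ^+ n + 1)).
have P1 : 0 < (2 * M) ^+ n + 1 by rewrite ltr_wpDl.
have W8 : 0 < 8 * W by rewrite mulr_gt0.
have D0 : 0 < 8 * W * ((2 * M) ^+ n + 1) by rewrite mulr_gt0.
have s0 : 0 < s by rewrite divr_gt0.
have [dl dl0 round] := uniformly_round cK vK strict s0.
(* From here on a full period [2 * W] fits into the margin [dl * r] of the dilated body. *)
exists (2 * W / dl); first by rewrite divr_gt0// mulr_gt0.
move=> r rr; have r0 : 0 < r by apply: lt_le_trans rr; rewrite divr_gt0// mulr_gt0.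
pose C1 := dilate r K; pose C2 := C1 `&` ((fun z => z + v) @^-1` C1).
have cC1 : compact C1 by exact: compact_dilate.
have cC2 : compact C2.
  apply: compact_closedI => //; apply: preimage_closed; last exact: compact_closed_rV cC1.
  move=> z _.
  have cz : {for z, continuous (fun z : 'rV[R]_n.+2 => z + v)}.
    by apply: continuousD; [move=> A|exact: cst_continuous].
  exact: cz.
have vC1 : cvx C1 by exact: cvx_dilate.
have vC2 : cvx C2.
  move=> x y l [x1 x2] [y1 y2] l0 l1; split; first exact: vC1.
  have := vC1 _ _ _ x2 y2 l0 l1; rewrite /preimage/=; congr C1.
  by apply/rowP => j; rewrite !mxE; ring.
have M1 : forall x, C1 x -> `|x| <= M * r.
  by move=> _ [x Kx <-]; rewrite normrZ gtr0_norm// mulrC ler_wpM2r ?KM// ltW.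
have rnd1 (p q u : 'rV[R]_n.+2) : C1 p -> C1 q -> s * r <= `|p - q| -> `|u| <= dl * r ->
    C1 (p + 2^-1 *: (q - p) + u).
  move=> /(dilateP _ r0) Kp /(dilateP _ r0) Kq pq ur; apply/dilateP => //.
  have := round _ _ (r^-1 *: u) Kp Kq; rewrite -scalerBr !normrZ gtr0_norm ?invr_gt0//.
  rewrite ler_pdivlMl// ler_pdivrMl// (mulrC r s) (mulrC r dl) => /(_ pq ur).
  by congr K; apply/rowP => j; rewrite !mxE; ring.
have rnd2 (p q u : 'rV[R]_n.+2) : C2 p -> C2 q -> s * r <= `|p - q| -> `|u| <= dl * r ->
    C2 (p + 2^-1 *: (q - p) + u).
  move=> [p1 p2] [q1 q2] pq ur; split; first exact: rnd1.
  have pq' : s * r <= `|(p + v) - (q + v)| by rewrite opprD addrACA subrr addr0.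
  have := rnd1 _ _ u p2 q2 pq' ur; rewrite /preimage/=; congr C1.
  by apply/rowP => j; rewrite !mxE; ring.
have wr : 2 * (pi / `|k ord0 i|) <= dl * r by rewrite -ler_pdivrMl// mulrC.
have Mr0 : 0 <= M * r by rewrite mulr_ge0// ltW.
have sr0 : 0 < s * r by rewrite mulr_gt0.
have I1 := oscillation_convex b cC1 vC1 M1 Mr0 ki sr0 rnd1 wr.
have I2 := oscillation_convex b cC2 vC2 (fun x (h : C2 x) => M1 x h.1) Mr0 ki sr0 rnd2 wr.
have mE : measurable (escape C1 v) by exact: measurable_escape.
have mC2 : measurable C2 by exact: compact_measurable_rV.
have C1E : C1 = escape C1 v `|` C2.
  apply/seteqP; split => z; last by move=> [[]|[]].
  by move=> Cz; have [h|h] := pselect (C1 (z + v)); [right|left].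
have disj : [disjoint escape C1 v & C2] by apply/disj_setPS => z [[_ h] [_ /= h']].
have intc : (lam n.+2).-integrable C1 (EFin \o (fun z => cos (dotv k z + b))).
  apply: measurable_bounded_integrable => //.
  - exact: compact_measurable_rV.
  - apply: (@le_lt_trans _ _ (lam n.+2 (@rV_box R n.+2 (M * r)))).
      apply: le_measure; rewrite ?inE; [exact: compact_measurable_rV|exact: measurable_rV_box|].
      by move=> x /M1 h j; apply: le_trans h; exact: ler_coord_norm.
    by rewrite [X in (X < _)%E]lebesgue_rV_box ?ltry.
  - by apply: measurable_funTS; exact: measurable_cos_dotv.
  - exists 1; split; first exact: num_real.
    by move=> x x1 z _; apply: le_trans (ltW x1); exact: cos_max.
have := I1; rewrite {1}C1E Rintegral_setU -?C1E// => I12.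
set J := Rintegral _ _ _; set J2 := Rintegral _ C2 _ in I2 I12.
have -> : J = (J + J2) - J2 by rewrite addrK.
apply: (le_trans (ler_normB _ _)); apply: (le_trans (lerD I12 I2)).
have -> : 2 * (M * r) = (2 * M) * r by ring.
rewrite exprMn exprS -/W.
have -> : 4 * (W * (s * r)) * ((2 * M) ^+ n * r ^+ n) + 4 * (W * (s * r)) * ((2 * M) ^+ n * r ^+ n) =
  (8 * W * (2 * M) ^+ n * s) * (r * r ^+ n) by ring.
rewrite ler_wpM2r//; first by rewrite mulr_ge0 ?exprn_ge0// ltW.
rewrite /s mulrA ler_pdivrMr//; have : 0 < e * (8 * W) by rewrite mulr_gt0.
nra.
Qed.

End dilation.

Section equidistribution_escape.
Context {R : realType}.
Local Notation lam n := (@lebesgue_rV R n).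
Variables (n : nat) (K : set 'rV[R]_n.+2).
Hypotheses (cK : compact K) (vK : cvx K).
Hypotheses (strict : forall p q, K p -> K q -> p != q ->
  ~ (forall t : R, 0 <= t -> t <= 1 -> frontier K (p + t *: (q - p)))).
Variable v : 'rV[R]_n.+2.
Hypothesis v0 : v ord0 ord0 != 0.

Local Notation A r := (escape (dilate r K) v).
Let L := `|v ord0 ord0| * fine (lam n.+1 (shadow K v)).

Let LE : (L%:E = `|v ord0 ord0|%:E * lam n.+1 (shadow K v))%E.
Proof.
by rewrite /L EFinM fineK// ge0_fin_numE//; exact: (shadow_finite cK v0).
Qed.

Let L0 : 0 <= L.
Proof. by rewrite mulr_ge0// fine_ge0. Qed.

Let mA r : measurable (A r).
Proof. by apply: measurable_escape; exact: compact_dilate. Qed.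

Let volE r : 0 < r ->
  ((r ^+ n.+1)^-1%:E * lam n.+2 (A r) = r%:E * lam n.+2 (escape K (r^-1 *: v)))%E.
Proof.
move=> r0; rewrite (lebesgue_escape_dilate cK v r0) muleA -EFinM; congr (_%:E * _)%E.
by rewrite (exprSr r n.+1) mulrA mulVf ?mul1r// expf_neq0// gt_eqF.
Qed.

Let vol_le r : 0 < r -> ((r ^+ n.+1)^-1%:E * lam n.+2 (A r) <= L%:E)%E.
Proof.
move=> r0; have ri : 0 < r^-1 by rewrite invr_gt0.
rewrite volE// LE; have := escape_le cK vK strict v0 ri.
by rewrite -lee_pdivrMl ?invr_gt0// invrK.
Qed.

Let fin r : 0 < r -> (lam n.+2 (A r) < +oo)%E.
Proof.
move=> r0; have := vol_le r0; rewrite lee_pdivrMl ?exprn_gt0// -EFinM => h.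
by apply: le_lt_trans h _; rewrite ltry.
Qed.

Let vol_fine_le r : 0 < r -> (r ^+ n.+1)^-1 * fine (lam n.+2 (A r)) <= L.
Proof.
move=> r0; rewrite -lee_fin EFinM fineK ?vol_le// ge0_fin_numE//; exact: fin.
Qed.

Let integrable_bounded (f : 'rV[R]_n.+2 -> R) (B : R) r : 0 < r ->
  measurable_fun setT f -> (forall z, `|f z| <= B) ->
  (lam n.+2).-integrable (A r) (EFin \o f).
Proof.
move=> r0 mf fB; apply: measurable_bounded_integrable => //.
- exact: fin.
- exact: measurable_funTS.
- exists B; split; first exact: num_real.
  by move=> x Bx z _; apply: le_trans (fB z) (ltW Bx).
Qed.

Let N (f : 'rV[R]_n.+2 -> R) r := (r ^+ n.+1)^-1 * \int[lam n.+2]_(z in A r) f z.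

Let N_le (f : 'rV[R]_n.+2 -> R) (B : R) r : 0 < r ->
  measurable_fun setT f -> (forall z, `|f z| <= B) -> `|N f r| <= B * L.
Proof.
move=> r0 mf fB; have B0 : 0 <= B by apply: le_trans (fB 0).
have rn0 : 0 <= (r ^+ n.+1)^-1 by rewrite invr_ge0 exprn_ge0// ltW.
rewrite /N normrM (ger0_norm rn0).
have ib := integrable_bounded r0 mf fB.
apply: (@le_trans _ _ ((r ^+ n.+1)^-1 * (B * fine (lam n.+2 (A r))))).
  rewrite ler_wpM2l//; apply: (le_trans (le_normr_Rintegral (mA r) ib)).
  rewrite -Rintegral_cst//; apply: le_Rintegral => //.
  - apply: (@integrable_bounded (fun z => `|f z|) B) => //.
      by apply: measurableT_comp mf.
    by move=> z; rewrite normr_id.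
  - apply: (@integrable_bounded (fun=> B) B) => // z; by rewrite ger0_norm.
by rewrite mulrCA ler_wpM2l// vol_fine_le.
Qed.

Variable r : R^nat.
Hypotheses (r0 : forall j, 0 < r j) (rc : r j @[j --> \oo] --> +oo).

Let vol_cvg : (r j ^+ n.+1)^-1 * fine (lam n.+2 (A (r j))) @[j --> \oo] --> L.
Proof.
have h0 j : 0 < (r j)^-1 by rewrite invr_gt0.
have hc : (r j)^-1 @[j --> \oo] --> (0 : R).
  by apply/gtr0_cvgV0 => //; apply: nearW.
have := escape_cvg cK vK strict v0 h0 hc; rewrite -LE => /fine_cvg.
apply: cvg_trans; apply: near_eq_cvg; apply: nearW => j /=.
rewrite invrK -volE// fineM//; rewrite ge0_fin_numE//; exact: fin.
Qed.

Let trig_bounded (F : 'rV[R]_n.+2 -> R) M : trig F M ->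
  exists2 B, measurable_fun setT F & forall z, `|F z| <= B.
Proof.
elim=> {F M} [c k b|f g m m' _ [B mf fB] _ [B' mg gB]]; last first.
  exists (B + B'); first exact: measurable_funD.
  by move=> z; apply: (le_trans (ler_normD _ _)); rewrite lerD.
exists `|c|; last by move=> z; rewrite normrM ler_piMr// cos_max.
apply: measurable_funM; first exact: measurable_cst.
have := measurable_cos_dotv ((2 * pi) *: map_mx intr k) b.
by apply: eq_measurable_fun => z _; rewrite dotvZl.
Qed.

(** The shift by [w] only changes phases. Frequency 0 leaves the normalised volume of the escape
    set, with limit [L]; the other frequencies vanish by [escape_oscillation]. *)
Lemma trig_equidistribution (F : 'rV[R]_n.+2 -> R) (M : R) (w : 'rV[R]_n.+2) :
  trig F M -> N (fun z => F (z + w)) (r j) @[j --> \oo] --> M * L.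
Proof.
have shift (f : 'rV[R]_n.+2 -> R) : measurable_fun setT f ->
    measurable_fun setT (fun z : 'rV[R]_n.+2 => f (z + w)).
  by move=> mf; apply: (measurableT_comp mf); apply: measurable_rVD => //; exact: measurable_cst.
elim=> {F M} [c k b|f g m m' tf Nf tg Ng]; last first.
  have [B mf fB] := trig_bounded tf; have [B' mg gB] := trig_bounded tg.
  rewrite mulrDl (_ : (fun j => _) =
      (fun j => N (fun z => f (z + w)) (r j) + N (fun z => g (z + w)) (r j))); first exact: cvgD.
  apply/funext => j; rewrite /N -mulrDr -RintegralD//.
  - by apply: (integrable_bounded (B := B)) => //; exact: shift.
  - by apply: (integrable_bounded (B := B')) => //; exact: shift.
have [->|/eqP kN0] := eqVneq k 0.
  have E z : c * cos (2 * pi * dotv (map_mx intr (0 : 'rV[int]_n.+2)) z + b) = c * cos b.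
    by rewrite /dotv big1 ?mulr0 ?add0r// => i _; rewrite !mxE mul0r.
  rewrite (_ : (fun j => _) = (fun j => c * cos b * ((r j ^+ n.+1)^-1 * fine (lam n.+2 (A (r j)))))).
    by apply: cvgZl_tmp; exact: vol_cvg.
  apply/funext => j; rewrite /N; under eq_Rintegral do rewrite E.
  by rewrite Rintegral_cst//; ring.
have [i ki] : exists i, k ord0 i != 0.
  apply: contrapT => h; apply: kN0; apply/rowP => i; rewrite mxE.
  by apply: contrapT => /eqP ki; apply: h; exists i.
pose q : 'rV[R]_n.+2 := (2 * pi) *: map_mx intr k.
have qi : q ord0 i != 0.
  by rewrite !mxE mulf_neq0 ?intr_eq0// mulf_neq0 ?pnatr_eq0// gt_eqF// pi_gt0.
rewrite mul0r; apply/cvgrPdist_le => e e0.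
pose e1 := e / (`|c| + 1).
have e10 : 0 < e1 by rewrite divr_gt0// ltr_wpDl.
have [rho rho0 osc] := escape_oscillation cK vK strict v (b + dotv q w) qi e10.
have /cvgryPge/(_ rho) hr := rc.
apply: filterS hr => j hj; rewrite sub0r normrN /N.
have E z : c * cos (2 * pi * dotv (map_mx intr k) (z + w) + b) =
    c * cos (dotv q z + (b + dotv q w)).
  congr (c * cos _); rewrite dotvDr /q !dotvZl; ring.
under eq_Rintegral do rewrite E.
rewrite RintegralZl//; last first.
  apply: (integrable_bounded (B := 1)) => //; last by move=> z; exact: cos_max.
  exact: measurable_cos_dotv.
have rn0 : 0 < r j ^+ n.+1 by rewrite exprn_gt0.
rewrite !normrM normfV (gtr0_norm rn0) ler_pdivrMl//.
apply: (le_trans (ler_wpM2l (normr_ge0 c) (osc _ hj))).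
have rn0' := ltW rn0; have c1 : 0 < `|c| + 1 by rewrite ltr_wpDl.
rewrite mulrA [leRHS]mulrC ler_wpM2r// /e1 mulrA ler_pdivrMr//.
by have := normr_ge0 c; nra.
Qed.

(** A uniform error [e1] costs at most [e1 * L], since the normalised volume never exceeds [L]. The
    same bound gives the second conclusion, which serves as domination in the integral over [v]. *)
Lemma periodic_equidistribution (F : 'rV[R]_n.+2 -> R) (M B : R) (w : 'rV[R]_n.+2) :
  measurable_fun setT F -> (forall z, 0 <= F z <= B) ->
  (forall e : R, 0 < e -> exists2 g, trig g M & forall x, `|g x - F x| <= e) ->
  ((r j ^+ n.+1)^-1%:E * \int[lam n.+2]_(z in A (r j)) (F (z + w))%:E @[j --> \oo] -->
    M%:E * (`|v ord0 ord0|%:E * lam n.+1 (shadow K v)))%E /\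
  forall j, ((r j ^+ n.+1)^-1%:E * \int[lam n.+2]_(z in A (r j)) (F (z + w))%:E <=
    B%:E * (`|v ord0 ord0|%:E * lam n.+1 (shadow K v)))%E.
Proof.
move=> mF FB Fapp.
have mFw : measurable_fun setT (fun z : 'rV[R]_n.+2 => F (z + w)).
  by apply: (measurableT_comp mF); apply: measurable_rVD => //; exact: measurable_cst.
have FBw z : `|F (z + w)| <= B by have /andP[h1 h2] := FB (z + w); rewrite ger0_norm.
have NE j : ((r j ^+ n.+1)^-1%:E * \int[lam n.+2]_(z in A (r j)) (F (z + w))%:E =
    (N (fun z => F (z + w)) (r j))%:E)%E.
  rewrite /N EFinM /Rintegral fineK//; apply: integrable_fin_num => //.
  exact: (integrable_bounded (r0 j) mFw FBw).
rewrite -!LE; split; last first.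
  move=> j; rewrite NE -EFinM lee_fin.
  exact: le_trans (ler_norm _) (N_le (r0 j) mFw FBw).
under eq_fun do rewrite NE.
rewrite -EFinM; apply: cvg_EFin; first exact: nearW.
apply/cvgrPdist_le => e e0.
pose e1 := e / (2 * (L + 1)).
have e10 : 0 < e1 by rewrite divr_gt0// mulr_gt0// ltr_wpDl.
have [g tg gF] := Fapp _ e10.
have := trig_equidistribution w tg => /cvgrPdist_le/(_ (e / 2)).
rewrite divr_gt0// => /(_ isT); apply: filterS => j hj /=.
have gw : measurable_fun setT (fun z : 'rV[R]_n.+2 => g (z + w)) /\
    forall z, `|g (z + w)| <= B + e1.
  have [_ mg _] := trig_bounded tg; split.
    by apply: (measurableT_comp mg); apply: measurable_rVD => //; exact: measurable_cst.
  move=> z; have -> : g (z + w) = F (z + w) + (g (z + w) - F (z + w)) by ring.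
  by apply: (le_trans (ler_normD _ _)); rewrite lerD.
have mD : measurable_fun setT (fun z : 'rV[R]_n.+2 => F (z + w) - g (z + w)) by exact: measurable_funB gw.1.
have DB z : `|F (z + w) - g (z + w)| <= e1 by rewrite distrC.
have hN := N_le (r0 j) mD DB.
have Ndiff : N (fun z => F (z + w) - g (z + w)) (r j) =
    N (fun z => F (z + w)) (r j) - N (fun z => g (z + w)) (r j).
  rewrite /N -mulrBr RintegralB//.
  - exact: (integrable_bounded (r0 j) mFw FBw).
  - exact: (integrable_bounded (r0 j) gw.1 gw.2).
have e1L : e1 * L <= e / 2.
  by rewrite /e1 mulrAC ler_pdivrMr ?mulr_gt0 ?ltr_wpDl//; nra.
rewrite Ndiff in hN.
move: (N (fun z => F (z + w)) (r j)) (N (fun z => g (z + w)) (r j)) hj hN => x y hj hN.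
have -> : M * L - x = (M * L - y) - (x - y) by ring.
apply: (le_trans (ler_normB _ _)); lra.
Qed.

End equidistribution_escape.

(** * Variance of the number of points *)

Section counting_variance.
Context {R : realType} d (T : measurableType d) (P : probability T R).
Local Open Scope ereal_scope.
Variable A : nat -> set T.
Hypothesis mA : forall i, measurable (A i).
Hypothesis indep : forall i j, i != j -> P (A i `&` A j) = P (A i) * P (A j).
Hypothesis summable : \sum_(i <oo) P (A i) < +oo.

Let f w : \bar R := \sum_(i <oo) (\1_(A i) w)%:E.
Let S w : R := fine (f w).
Let p i : R := fine (P (A i)).
Let F N w : R := (\sum_(i < N) \1_(A i) w)%R.

Let pE i : P (A i) = (p i)%:E.
Proof. by rewrite fineK// fin_num_measure. Qed.

Let p0 i : (0 <= p i)%R. Proof. by rewrite fine_ge0. Qed.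

Let p1 i : (p i <= 1)%R. Proof. by rewrite -lee_fin -pE probability_le1. Qed.

Let mi i : measurable_fun setT (fun w => (\1_(A i) w : R)%:E).
Proof. by apply/measurable_EFinP; exact: measurable_indic. Qed.

Let mf : measurable_fun setT f.
Proof. by apply: ge0_emeasurable_sum => [i w _ _|i _]; [rewrite lee_fin|exact: mi]. Qed.

Let f0 w : 0 <= f w.
Proof. by apply: nneseries_ge0 => i _ _; rewrite lee_fin. Qed.

Let intf : \int[P]_w f w = \sum_(i <oo) P (A i).
Proof.
rewrite integral_nneseries//.
by apply: eq_eseriesr => i _; rewrite integral_indic// setIT.
Qed.

Let fint : P.-integrable setT f.
Proof.
apply/integrableP; split => //.
by under eq_integral => w _ do rewrite gee0_abs//; rewrite intf.
Qed.

Let s : R := fine (\sum_(i <oo) P (A i)).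

Let sE : \sum_(i <oo) P (A i) = s%:E.
Proof.
by rewrite fineK// ge0_fin_numE// nneseries_ge0.
Qed.

Let ffin : {ae P, forall w, f w = (S w)%:E}.
Proof.
have := integrable_ae measurableT fint; apply: filterS => w /(_ I) fw.
by rewrite /S fineK.
Qed.

Let mS : measurable_fun setT S.
Proof. exact: measurableT_comp mf. Qed.

Let FE N w : (F N w)%:E = \sum_(0 <= i < N) (\1_(A i) w)%:E.
Proof. by rewrite big_mkord sumEFin. Qed.

Let Fcvg w : f w = (S w)%:E -> F N w @[N --> \oo] --> S w.
Proof.
move=> fw; have : (F N w)%:E @[N --> \oo] --> (S w)%:E.
  under eq_fun do rewrite FE.
  rewrite -fw; apply: is_cvg_nneseries => i _ _; by rewrite lee_fin.
by move=> /fine_cvg.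
Qed.

Let q i : R := (p i * (1 - p i))%R.

Let q0 i : (0 <= q i)%R.
Proof. by rewrite mulr_ge0// subr_ge0. Qed.

(** Pairwise independence gives [p i * p j] off the diagonal; on it, [p i = p i ^+ 2 + q i]. *)
Let F2E N : \int[P]_w ((F N w ^+ 2)%R)%:E =
  ((\sum_(i < N) p i) ^+ 2 + \sum_(i < N) q i)%R%:E.
Proof.
transitivity (\int[P]_w \sum_(i < N) \sum_(j < N) (\1_(A i `&` A j) w : R)%:E).
  apply: eq_integral => w _; rewrite /F expr2 mulr_suml -sumEFin.
  apply: eq_bigr => i _; rewrite mulr_sumr -sumEFin; apply: eq_bigr => j _.
  by rewrite indicI.
have mij (i j : nat) : measurable (A i `&` A j) by exact: measurableI.
have mij' (i j : nat) : measurable_fun setT (fun w => (\1_(A i `&` A j) w : R)%:E).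
  by apply/measurable_EFinP; exact: measurable_indic.
rewrite ge0_integral_sum//; last 2 first.
- by move=> i; apply: emeasurable_sum => j.
- by move=> i w _; apply: sume_ge0 => j _; rewrite lee_fin.
transitivity (\sum_(i < N) \sum_(j < N) (p i * p j + (if i == j then q i else 0))%R%:E).
  apply: eq_bigr => i _; rewrite ge0_integral_sum//.
  apply: eq_bigr => j _; rewrite integral_indic// setIT; case: eqVneq => [->|ij].
    transitivity (p j)%:E; first by rewrite setIid; exact: pE.
    congr EFin; rewrite /q; ring.
  by rewrite addr0 EFinM -!pE; apply: indep.
transitivity ((\sum_(i < N) \sum_(j < N) (p i * p j + (if i == j then q i else 0)))%R%:E).
  by rewrite -sumEFin; apply: eq_bigr => i _; rewrite sumEFin.
congr EFin; rewrite expr2 mulr_suml -big_split; apply: eq_bigr => i _ /=.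
rewrite big_split/= mulr_sumr; congr (_ + _)%R.
by rewrite (bigD1 i)//= eqxx big1 ?addr0// => j /negbTE; rewrite eq_sym => ->.
Qed.

(** Squares of partial sums increase, so their means [F2E] converge to the second moment
    [s ^+ 2 + v], from which the squared mean is subtracted. The series is finite only almost
    surely, so [S] agrees with it off a null set. *)
Lemma variance_count :
  'V_P[S] = \sum_(i <oo) (P (A i) * P (~` A i)).
Proof.
have sp : (\sum_(i < N) p i)%R @[N --> \oo] --> s.
  have : ((\sum_(i < N) p i)%R)%:E @[N --> \oo] --> s%:E.
    under eq_fun do rewrite -sumEFin -(big_mkord xpredT (fun i => (p i)%:E)).
    rewrite -sE (eq_eseriesr (g := fun i => (p i)%:E)); last by move=> i _; exact: pE.
    by apply: is_cvg_nneseries => i _ _; rewrite lee_fin.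
  by move=> /fine_cvg.
have -> : \sum_(i <oo) (P (A i) * P (~` A i)) = \sum_(i <oo) (q i)%:E.
  by apply: eq_eseriesr => i _; rewrite probability_setC// pE -EFinB -EFinM.
have qs : \sum_(i <oo) (q i)%:E <= s%:E.
  rewrite -sE; apply: lee_nneseries => i _; rewrite ?lee_fin// pE lee_fin.
  by have := p0 i; have := p1 i; rewrite /q; nra.
pose v := fine (\sum_(i <oo) (q i)%:E).
have vE : \sum_(i <oo) (q i)%:E = v%:E.
  rewrite fineK// ge0_fin_numE ?nneseries_ge0//; last by move=> i _ _; rewrite lee_fin.
  by apply: le_lt_trans qs _; rewrite ltry.
have vq : (\sum_(i < N) q i)%R @[N --> \oo] --> v.
  have : ((\sum_(i < N) q i)%R)%:E @[N --> \oo] --> v%:E.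
    under eq_fun do rewrite -sumEFin -(big_mkord xpredT (fun i => (q i)%:E)).
    by rewrite -vE; apply: is_cvg_nneseries => i _ _; rewrite lee_fin.
  by move=> /fine_cvg.
have ES : \int[P]_w (S w)%:E = s%:E.
  rewrite -sE -intf; apply/esym/ae_eq_integral => //; first exact/measurable_EFinP.
  by apply: filterS ffin => w fw _.
have intS : P.-integrable setT (EFin \o S).
  apply/integrableP; split; first exact/measurable_EFinP.
  under eq_integral => w _ do rewrite gee0_abs ?lee_fin ?fine_ge0//.
  by rewrite ES ltry.
have ES2 : \int[P]_w ((S w ^+ 2)%R)%:E = (s ^+ 2 + v)%R%:E.
  have mF N : measurable_fun setT (fun w => ((F N w ^+ 2)%R)%:E).
    apply/measurable_EFinP; apply: measurable_funX; apply: measurable_sum => i.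
    exact: measurable_indic.
  have F0 N w : (0 <= F N w)%R by apply: sumr_ge0.
  have Fnd w : {homo (fun N => ((F N w ^+ 2)%R)%:E) : a b / (a <= b)%N >-> a <= b}.
    move=> a b ab; rewrite lee_fin lerXn2r ?nnegrE// /F -!(big_mkord xpredT (fun i => \1_(A i) w)).
    by rewrite [leRHS](big_cat_nat (leq0n a) ab)/= lerDl sumr_ge0.
  have mono := @cvg_monotone_convergence _ _ _ P setT measurableT
    (fun N w => ((F N w ^+ 2)%R)%:E) mF (fun N w _ => sqr_ge0 (F N w)) (fun w _ => Fnd w).
  have lim2 : \int[P]_w limn (fun N => ((F N w ^+ 2)%R)%:E) = \int[P]_w ((S w ^+ 2)%R)%:E.
    apply: ae_eq_integral => //.
    - apply: emeasurable_fun_cvg mF _ => w _.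
      by apply: ereal_nondecreasing_is_cvgn; exact: Fnd.
    - by apply/measurable_EFinP; exact: measurable_funX.
    apply: filterS ffin => w /Fcvg Fw _; apply/cvg_lim => //.
    by apply: cvg_EFin; [exact: nearW|rewrite expr2; apply: cvgM].
  have H : \int[P]_w ((F N w ^+ 2)%R)%:E @[N --> \oo] --> ((s ^+ 2 + v)%R)%:E.
    rewrite (_ : (fun N => _) = (fun N => ((\sum_(i < N) p i) ^+ 2 + \sum_(i < N) q i)%R%:E)).
      apply: cvg_EFin; first exact: nearW.
      by rewrite !expr2; apply: cvgD => //; apply: cvgM.
    by apply/funext => N; exact: F2E.
  by rewrite -lim2; exact: (cvg_unique _ mono H).
have intS2 : P.-integrable setT (EFin \o (S * S)%R).
  apply/integrableP; split; first by apply/measurable_EFinP; exact: measurable_funM.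
  under eq_integral => w _ do rewrite gee0_abs ?lee_fin ?mulr_ge0 ?fine_ge0// -expr2.
  by rewrite ES2 ltry.
rewrite /variance covarianceE; [|exact/Lfun1_integrable..].
rewrite vE !unlock ES -EFinM.
under eq_integral => w _ do rewrite -expr2.
by rewrite ES2 -EFinB; congr EFin; ring.
Qed.

End counting_variance.

(** * Lattice sums for the variance *)

Section lattice_variance.
Context {R : realType}.
Local Open Scope ereal_scope.
Local Notation lam n := (@lebesgue_rV R n).
Variables (a : R) (n : nat).
Hypothesis a0 : (0 < a)%R.
Local Notation V := 'rV[R]_n.
Local Notation phi := (@gaussian_density R n a).
Local Notation C := ((a * pi) `^ (- (n%:R / 2)))%R.

Lemma gexp_dotv c (y : V) : (\prod_i gexp c (y ord0 i) = expR (- (c * dotv y y)))%R.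
Proof.
rewrite -(big_morph _ (@expRD R) (@expR0 R)) /dotv mulr_sumr -sumrN.
by congr expR; apply: eq_bigr => i _; rewrite expr2.
Qed.

Lemma gaussian_densityE (y : V) : phi y = (C * \prod_i gexp a^-1 (y ord0 i))%R.
Proof. by rewrite gexp_dotv /gaussian_density (mulrC a^-1)%R. Qed.

Lemma gaussian_density_ge0 y : (0 <= phi y)%R.
Proof. by rewrite mulr_ge0 ?powR_ge0 ?expR_ge0. Qed.

Lemma measurable_gaussian_density : measurable_fun setT phi.
Proof.
apply: measurable_funM => //; apply: measurableT_comp => //; apply: measurableT_comp => //.
by apply: measurable_funM => //; exact: measurable_dotv.
Qed.

Definition Theta c (x : V) : R := (\prod_i theta c (x ord0 i))%R.

Lemma Theta_ge0 c x : (0 <= Theta c x)%R.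
Proof. by apply: prodr_ge0 => i _; exact: theta_ge0. Qed.

Lemma measurable_Theta c : (0 < c)%R -> measurable_fun setT (Theta c).
Proof.
move=> c0; apply: measurable_prod => i _.
exact: (measurableT_comp (measurable_theta c0) (measurable_coord _)).
Qed.

Lemma Theta_bounded c : (0 < c)%R -> exists B : R, forall x, (0 <= Theta c x <= B)%R.
Proof.
move=> c0; exists ((expR c * Num.sqrt (pi / (c / 2))) ^+ n)%R => x; rewrite Theta_ge0/=.
rewrite -[n in (_ ^+ n)%R]card_ord -prodr_const.
by apply: ler_prod => i _; rewrite theta_ge0 theta_le.
Qed.

Lemma esum_Theta c (x : V) : (0 < c)%R ->
  \esum_(k in [set: 'rV[int]_n]) (\prod_i gexp c ((x - map_mx intr k)%R ord0 i))%:E = (Theta c x)%:E.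
Proof.
move=> c0; rewrite -(@esum_prod _ _ (fun t k => gexp c (t - k%:~R)%R) (theta c) x).
- by apply: eq_esum => k _; congr EFin; apply: eq_bigr => i _; rewrite !mxE.
- by move=> t k; exact: gexp_ge0.
- by move=> t; exact: thetaE.
Qed.

Definition kappa (v : V) : R := (C ^+ 2 * expR (- (dotv v v / (2 * a))))%R.

Lemma kappa_ge0 v : (0 <= kappa v)%R.
Proof. by rewrite mulr_ge0 ?sqr_ge0 ?expR_ge0. Qed.

(** The identity [|x|^2 + |x + v|^2 = 2 |x + v/2|^2 + |v|^2 / 2] for Euclidean lengths separates the
    midpoint from the displacement; it is the origin of the parameter [2 / a] and of [kappa]. *)
Lemma gaussian_density_pair (x v : V) :
  (phi x * phi (x + v) = kappa v * \prod_i gexp (2 / a) ((x + 2^-1 *: v) ord0 i))%R.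
Proof.
rewrite gexp_dotv /gaussian_density /kappa mulrACA expr2 -[RHS]mulrA -!expRD.
congr (_ * expR _)%R; rewrite !dotvDl !dotvDr !dotvZl !dotvZr (dotvC v x).
by field; rewrite gt_eqF.
Qed.

Lemma integral_density_shift (B : set V) (k : V) : measurable B ->
  \int[lam n]_(x in (fun x => (k + x)%R) @^-1` B) (phi x)%:E =
  \int[lam n]_z (\1_B z * phi (z - k))%:E.
Proof.
move=> mB.
rewrite [RHS](@ge0_integral_rV_shift _ _ k); last 2 first.
- apply/measurable_EFinP; apply: measurable_funM; first exact: measurable_indic.
  apply: (measurableT_comp measurable_gaussian_density).
  by apply: measurable_rVB => //; exact: measurable_cst.
- by move=> z; rewrite lee_fin mulr_ge0 ?gaussian_density_ge0.
rewrite integral_mkcond; apply: eq_integral => z _; rewrite patchE indicE addrK.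
have -> : (z \in (fun x => (k + x)%R) @^-1` B) = ((z + k)%R \in B).
  by apply/idP/idP; rewrite !inE /preimage/= addrC.
by case: ifP => _; rewrite ?mul1r ?mul0r.
Qed.

Variable e : nat -> 'rV[int]_n.
Hypothesis be : set_bij [set: nat] [set: 'rV[int]_n] e.
Local Notation tr j := (map_mx intr (e j) : V).

Variable B : set V.
Hypothesis mB : measurable B.

(** The integrand of [p_j * (1 - p_j)] at the pair [z], [z + v], recentred so that the indicators do
    not depend on [j]. *)
Let h j (z v : V) : R :=
  (\1_B z * phi (z - tr j) * (\1_(~` B) (z + v) * phi (z + v - tr j)))%R.

Let h0 j z v : 0 <= (h j z v)%:E.
Proof.
rewrite lee_fin; apply: mulr_ge0; apply: mulr_ge0 => //; exact: gaussian_density_ge0.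
Qed.

Let mcB : measurable (~` B). Proof. exact: measurableC. Qed.

Let mh j : measurable_fun setT (fun p : V * V => (h j p.1 p.2)%:E).
Proof.
have mphi (f : V * V -> V) : measurable_fun setT f ->
    measurable_fun setT (fun p => phi (f p - tr j)).
  move=> mf; apply: (measurableT_comp measurable_gaussian_density).
  by apply: measurable_rVB => //; exact: measurable_cst.
have mi (f : V * V -> V) (D : set V) : measurable D -> measurable_fun setT f ->
    measurable_fun setT (fun p => \1_D (f p) : R).
  move=> mD mf; have m1 : measurable_fun setT (\1_D : V -> R) by exact: measurable_indic.
  exact: (measurableT_comp m1 mf).
have mD : measurable_fun setT (fun p : V * V => (p.1 + p.2)%R) by exact: measurable_rVD.
apply/measurable_EFinP; apply: measurable_funM.
  by apply: measurable_funM; [exact: mi|exact: mphi].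
by apply: measurable_funM; [exact: mi|exact: mphi].
Qed.

(** Only the Gaussian at the midpoint depends on [j], and its lattice sum is [Theta]. *)
Let hsum z v : \sum_(j <oo) (h j z v)%:E =
  (\1_B z * \1_(~` B) (z + v) * (kappa v * Theta (2 / a) (z + 2^-1 *: v)))%R%:E.
Proof.
have c0 : (0 < 2 / a)%R by rewrite divr_gt0.
pose r := (\1_B z * \1_(~` B) (z + v) * kappa v)%R.
have r0 : (0 <= r)%R.
  by apply: mulr_ge0; [exact: mulr_ge0|exact: kappa_ge0].
rewrite mulrA EFinM -esum_Theta// -esum_scalel//; last first.
  by move=> k; rewrite lee_fin prodr_ge0// => i _; exact: gexp_ge0.
rewrite (esum_enum be); last first.
  by move=> k; rewrite -EFinM lee_fin mulr_ge0// prodr_ge0// => i _; exact: gexp_ge0.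
apply: eq_eseriesr => j _; rewrite -EFinM; congr EFin.
rewrite /h mulrACA -/r.
have -> : (z + v - tr j = (z - tr j) + v)%R by rewrite addrAC.
rewrite gaussian_density_pair mulrA -/r; congr (_ * _)%R.
by rewrite addrAC.
Qed.

Lemma lattice_variance :
  \sum_(j <oo) (\int[lam n]_(x in (fun x => (tr j + x)%R) @^-1` B) (phi x)%:E *
               \int[lam n]_(x in ~` ((fun x => (tr j + x)%R) @^-1` B)) (phi x)%:E) =
  \int[lam n]_v ((kappa v)%:E *
    \int[lam n]_(z in [set z | B z /\ ~ B (z + v)%R]) (Theta (2 / a) (z + 2^-1 *: v)%R)%:E).
Proof.
have c0 : (0 < 2 / a)%R by rewrite divr_gt0.
have mtail D j : measurable D -> measurable_fun setT (fun z : V => (\1_D z * phi (z - tr j))%R%:E).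
  move=> mD; apply/measurable_EFinP; apply: measurable_funM; first exact: measurable_indic.
  apply: (measurableT_comp measurable_gaussian_density).
  by apply: measurable_rVB => //; exact: measurable_cst.
have t0 D j (z : V) : 0 <= (\1_D z * phi (z - tr j))%R%:E.
  by rewrite lee_fin mulr_ge0 ?gaussian_density_ge0.
transitivity (\sum_(j <oo) \int[lam n]_z \int[lam n]_v (h j z v)%:E).
  apply: eq_eseriesr => j _.
  rewrite integral_density_shift// preimage_setC integral_density_shift//.
  rewrite -ge0_integralZr//; [|exact: mtail|by apply: integral_ge0 => z _].
  apply: eq_integral => z _.
  have m2 := mtail _ j mcB.
  have E : \int[lam n]_v (\1_(~` B) v * phi (v - tr j))%R%:E =
      \int[lam n]_v (\1_(~` B) (v + z) * phi (v + z - tr j))%R%:E.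
    exact: (ge0_integral_rV_shift z m2 (t0 _ j)).
  have m3 : measurable_fun setT (fun v : V => (\1_(~` B) (v + z) * phi (v + z - tr j))%R%:E).
    have ms : measurable_fun setT (fun v : V => (v + z)%R).
      by apply: measurable_rVD; [exact: measurable_id|exact: measurable_cst].
    exact: (measurableT_comp m2 ms).
  have pos : 0 <= (\1_B z * phi (z - tr j))%R%:E by exact: t0.
  rewrite E -(ge0_integralZl (lam n) measurableT m3 (fun v _ => t0 _ j (v + z)%R) pos).
  by apply: eq_integral => v _; rewrite -EFinM /h (addrC v z).
pose H (p : V * V) := (\1_B p.1 * \1_(~` B) (p.1 + p.2) *
  (kappa p.2 * Theta (2 / a) (p.1 + 2^-1 *: p.2)))%R%:E.
have H0 p : 0 <= H p.
  rewrite lee_fin; apply: mulr_ge0; first exact: mulr_ge0.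
  by apply: mulr_ge0; [exact: kappa_ge0|exact: Theta_ge0].
have mH : measurable_fun setT H.
  rewrite (_ : H = fun p => \sum_(j <oo) (h j p.1 p.2)%:E).
    by apply: ge0_emeasurable_sum => [j p _ _|j _]; [exact: h0|exact: mh].
  by apply/funext => p; rewrite hsum.
transitivity (\int[lam n]_z \int[lam n]_v H (z, v)).
  rewrite -integral_nneseries//; last 2 first.
  - move=> j; exact: (@measurable_fun_fubini_tonelli_F _ _ _ _ _ (lam n) _ (mh j) (fun p => h0 j p.1 p.2)).
  - by move=> j z _; apply: integral_ge0 => v _.
  apply: eq_integral => z _; rewrite -integral_nneseries//.
    by apply: eq_integral => v _; rewrite hsum.
  move=> j; apply: (measurableT_comp (mh j) (_ : measurable_fun setT (fun v : V => (z, v)))).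
  by apply: measurable_fun_pair; [exact: measurable_cst|].
rewrite (@fubini_tonelli _ _ _ _ _ (lam n) (lam n) H mH H0).
apply: eq_integral => v _.
pose E := [set z | B z /\ ~ B (z + v)%R].
have mE : measurable E.
  rewrite (_ : E = B `&` (fun z => (z + v)%R) @^-1` (~` B)); last by apply/seteqP; split.
  apply: measurableI => //; rewrite -[X in measurable X]setTI.
  by apply: measurable_rVD => //; exact: measurable_cst.
rewrite -/E [X in _ * X]integral_mkcond -ge0_integralZl//; last 3 first.
- apply/(measurable_restrictT _ _).1 => //; apply: measurable_funTS.
  apply/measurable_EFinP; apply: (measurableT_comp (measurable_Theta c0)).
  by apply: measurable_rVD => //; exact: measurable_cst.
- by move=> z _; apply: erestrict_ge0 => y _; rewrite lee_fin Theta_ge0.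
- by rewrite lee_fin kappa_ge0.
apply: eq_integral => z _; rewrite patchE /H/= !indicE.
have -> : (z \in E) = (z \in B) && ((z + v)%R \in ~` B).
  by apply/idP/andP; rewrite !inE.
case: (z \in B); case: (_ \in _) => /=; rewrite ?mulr1 ?mul1r ?mulr0 ?mul0r ?mule0//.
Qed.

(** The densities centred at all lattice points sum to a bounded periodic function, so the expected
    count is at most a multiple of the volume of [B]. *)
Lemma summable_density : (lam n B < +oo) ->
  \sum_(j <oo) \int[lam n]_(x in (fun x => (tr j + x)%R) @^-1` B) (phi x)%:E < +oo.
Proof.
move=> Bfin; have c0 : (0 < a^-1)%R by rewrite invr_gt0.
have mtail j : measurable_fun setT (fun z : V => (\1_B z * phi (z - tr j))%R%:E).
  apply/measurable_EFinP; apply: measurable_funM; first exact: measurable_indic.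
  apply: (measurableT_comp measurable_gaussian_density).
  by apply: measurable_rVB => //; exact: measurable_cst.
under eq_eseriesr => j _ do rewrite integral_density_shift//.
rewrite -integral_nneseries//; last first.
  by move=> j z _; rewrite lee_fin mulr_ge0 ?gaussian_density_ge0.
have [M MB] := Theta_bounded c0.
have CM : (0 <= C * M)%R.
  by rewrite mulr_ge0 ?powR_ge0//; have /andP[] := MB 0%R; exact: le_trans.
apply: (@le_lt_trans _ _ (\int[lam n]_z ((C * M)%:E * (\1_B z)%:E))).
  apply: ge0_le_integral => //.
  - by move=> z _; apply: nneseries_ge0 => j _ _; rewrite lee_fin mulr_ge0 ?gaussian_density_ge0.
  - apply: ge0_emeasurable_sum => [j z _ _|j _]; last exact: mtail.
    by rewrite lee_fin mulr_ge0 ?gaussian_density_ge0.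
  - by apply: emeasurable_funM => //; apply/measurable_EFinP; exact: measurable_indic.
  move=> z _; rewrite -EFinM mulrC.
  apply: (@le_trans _ _ ((\1_B z * C)%R%:E * (Theta a^-1 z)%:E)); last first.
    rewrite -EFinM lee_fin -mulrA ler_wpM2l// ler_wpM2l ?powR_ge0//.
    by have /andP[] := MB z.
  rewrite -esum_Theta// -esum_scalel ?mulr_ge0 ?powR_ge0//; last first.
    by move=> k; rewrite lee_fin prodr_ge0// => i _; exact: gexp_ge0.
  rewrite (esum_enum be); last first.
    by move=> k; rewrite -EFinM lee_fin !mulr_ge0 ?powR_ge0// prodr_ge0// => i _; exact: gexp_ge0.
  rewrite le_eqVlt; apply/orP; left; apply/eqP; apply: eq_eseriesr => j _.
  by rewrite gaussian_densityE -EFinM mulrA.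
rewrite ge0_integralZl//; last by apply/measurable_EFinP; exact: measurable_indic.
by rewrite integral_indic// setIT lte_mul_pinfty// lee_fin.
Qed.

End lattice_variance.

(** * Dominated convergence in the displacement *)

Section assembly.
Context {R : realType}.
Local Open Scope ereal_scope.
Local Notation lam n := (@lebesgue_rV R n).

(** Passage to sequences, along which dominated convergence works: a neighbourhood missed at
    arbitrarily large arguments is missed along some sequence. *)
Lemma cvg_pinfty_seq (f : R -> \bar R) (l : \bar R) :
  (forall u : R^nat, (forall j, (0 < u j)%R) -> u j @[j --> \oo] --> +oo%R ->
    f (u j) @[j --> \oo] --> l) ->
  f x @[x --> +oo%R] --> l.
Proof.
move=> H A nA; apply: contrapT => nf.
have /choice[u uP] : forall j : nat, exists x : R, (j%:R < x)%R /\ ~ A (f x).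
  move=> j; apply: contrapT => ne; apply: nf; exists j%:R; split; first exact: num_real.
  by move=> x jx; apply: contrapT => nA'; apply: ne; exists x.
have u0 j : (0 < u j)%R by apply: le_lt_trans (uP j).1.
have uc : u j @[j --> \oo] --> +oo%R.
  apply/cvgryPge => r; near=> j; apply: le_trans (ltW (uP j).1).
  by near: j; exact: nbhs_infty_ger.
have [N _ NA] := H u u0 uc A nA.
by have [_] := uP N; apply; apply: (NA N) => /=.
Unshelve. all: by end_near. Qed.

(** The power is the mean of [Theta] over a unit cell; the product is the density of the difference
    of two independent perturbations. *)
Lemma kappa_gaussv (a : R) n (v : 'rV[R]_n) : (0 < a)%R ->
  (kappa a v * Num.sqrt (pi / (2 / a)) ^+ n = gaussv a v)%R.
Proof.
move=> a0; have p0 := @pi_gt0 R; have ap : (0 < a * pi)%R by rewrite mulr_gt0.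
rewrite /gaussv /gauss big_split/= prodr_const card_ord.
rewrite -(big_morph _ (@expRD R) (@expR0 R)) sumrN -mulr_suml /kappa.
have -> : (\sum_i v ord0 i ^+ 2 = dotv v v)%R by apply: eq_bigr => i _; rewrite expr2.
rewrite mulrAC; congr (_ * _)%R.
have -> : (((a * pi) `^ (- (n%:R / 2))) ^+ 2 = (a * pi)^-1 ^+ n)%R.
  rewrite expr2 -powRD; last by rewrite (gt_eqF ap) implybT.
  have -> : (- (n%:R / 2) + - (n%:R / 2) = - n%:R :> R)%R by field.
  by rewrite powRN powR_mulrn ?ltW// exprVn.
rewrite -exprMn; congr (_ ^+ _)%R.
have s1 : (0 < 2 * pi * a)%R by rewrite mulr_gt0// mulr_gt0.
have E : (Num.sqrt (pi / (2 / a)) * Num.sqrt (2 * pi * a) = a * pi)%R.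
  rewrite -sqrtrM; last by rewrite ltW// divr_gt0// divr_gt0.
  have -> : (pi / (2 / a) * (2 * pi * a) = (a * pi) ^+ 2)%R by field; rewrite gt_eqF.
  by rewrite sqrtr_sqr gtr0_norm.
have s2 : (Num.sqrt (2 * pi * a) != 0)%R by rewrite gt_eqF// sqrtr_gt0.
by apply: (mulIf s2); rewrite mulVf// -[LHS]mulrA E mulVf// gt_eqF.
Qed.

(** Shadows are cast on the hyperplane of the last coordinates, which excludes these
    displacements. *)
Lemma coord0_null n : lam n.+1 [set v | v ord0 ord0 = 0%R] = 0.
Proof.
have mN : measurable [set v : 'rV[R]_n.+1 | v ord0 ord0 = 0%R].
  rewrite (_ : mkset _ = (fun v : 'rV[R]_n.+1 => v ord0 ord0) @^-1` [set 0%R])//.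
  by rewrite -[X in measurable X]setTI; exact: measurable_coord.
have mi : measurable_fun setT (fun v : 'rV[R]_n.+1 => (\1_[set v | v ord0 ord0 = 0%R] v : R)%:E).
  by apply/measurable_EFinP; exact: measurable_indic.
rewrite (measure_integral_indic _ mN) (ge0_integral_rV_consC mi); last first.
  by move=> v; rewrite lee_fin.
rewrite integral0_eq// => y _.
transitivity (\int[@lebesgue_measure R]_t (\1_[set 0%R] t)%:E).
  apply: eq_integral => t _; rewrite !indicE; congr (_%:R)%:E; congr nat_of_bool.
  by apply/idP/idP; rewrite !inE/= rV_cons0.
by rewrite integral_indic// setIT; exact: lebesgue_measure_set1.
Qed.

Variables (a : R) (n : nat) (K : set 'rV[R]_n.+2).
Hypothesis a0 : (0 < a)%R.
Hypotheses (cK : compact K) (vK : cvx K).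
Local Notation M := (frontier K).
Hypotheses (hM : smooth_hypersurface M) (curv : nonvanishing_curvature M).
Variable c : 'rV[R]_n.+2.
Hypothesis Kc : K° c.
Variable sigma : {measure set 'rV[R]_n.+2 -> \bar R}.
Hypothesis hs : @is_surface_measure R n.+2 M sigma.

Let strict p q : K p -> K q -> p != q ->
  ~ (forall t : R, (0 <= t)%R -> (t <= 1)%R -> M (p + t *: (q - p))%R).
Proof. by move=> Kp Kq pq; exact: (@no_segment R n.+1 K cK vK hM curv p q Kp Kq pq). Qed.

Let inner (r : R) (v : 'rV[R]_n.+2) :=
  \int[lam n.+2]_(z in escape (dilate r K) v) (Theta (2 / a) (z + 2^-1 *: v)%R)%:E.

Let measurable_inner r : measurable_fun setT (inner r).
Proof.
have c0 : (0 < 2 / a)%R by rewrite divr_gt0.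
have mB : measurable (dilate r K) by apply: compact_measurable_rV; exact: compact_dilate.
pose H (p : 'rV[R]_n.+2 * 'rV[R]_n.+2) : \bar R :=
  (\1_(dilate r K) p.2 * \1_(~` dilate r K) (p.2 + p.1) * Theta (2 / a) (p.2 + 2^-1 *: p.1))%R%:E.
have mi (f : 'rV[R]_n.+2 * 'rV[R]_n.+2 -> 'rV[R]_n.+2) (D : set 'rV[R]_n.+2) :
    measurable D -> measurable_fun setT f -> measurable_fun setT (fun p => \1_D (f p) : R).
  move=> mD mf; have m1 : measurable_fun setT (\1_D : 'rV[R]_n.+2 -> R) by exact: measurable_indic.
  exact: (measurableT_comp m1 mf).
have mH : measurable_fun setT H.
  apply/measurable_EFinP; apply: measurable_funM.
    apply: measurable_funM; first exact: mi.
    by apply: mi; [exact: measurableC|exact: measurable_rVD].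
  apply: (measurableT_comp (measurable_Theta c0)); apply: measurable_rVD => //.
  exact: measurable_rVZ.
have H0 p : 0 <= H p.
  by rewrite lee_fin; apply: mulr_ge0; [exact: mulr_ge0|exact: Theta_ge0].
rewrite (_ : inner r = fun v => \int[lam n.+2]_z H (v, z)).
  exact: (@measurable_fun_fubini_tonelli_F _ _ _ _ _ (lam n.+2) H mH H0).
apply/funext => v; rewrite /inner integral_mkcond; apply: eq_integral => z _.
rewrite patchE /H/= !indicE.
have -> : (z \in escape (dilate r K) v) = (z \in dilate r K) && ((z + v)%R \in ~` dilate r K).
  by apply/idP/andP; rewrite !inE.
by case: (z \in _); case: (_ \in _) => /=; rewrite ?mulr1 ?mul1r ?mulr0 ?mul0r.
Qed.

(** For [v ord0 ord0 != 0], the normalised inner integral tends to the mean [th ^+ n.+2] of [Theta]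
    times the flux of [v], and is at most [B] times that flux. Together [kappa] and the mean make
    [gaussv], whose integral against the flux is known and finite. *)
Lemma lattice_variance_cvg (r : R^nat) : (forall j, (0 < r j)%R) ->
  r j @[j --> \oo] --> +oo%R ->
  (r j ^+ n.+1)^-1%:E * \int[lam n.+2]_v ((kappa a v)%:E * inner (r j) v) @[j --> \oo] -->
  (Num.sqrt (a / (2 * pi)))%:E * sigma M.
Proof.
move=> r0 rc; have c0 : (0 < 2 / a)%R by rewrite divr_gt0.
pose th := Num.sqrt (pi / (2 / a)).
have th0 : (0 < th)%R by rewrite sqrtr_gt0 divr_gt0// pi_gt0.
have [B BT] := @Theta_bounded R n.+2 _ c0.
have B0 : (0 <= B)%R by have /andP[h1 h2] := BT 0%R; exact: le_trans h1 h2.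
have [Lp Lp0 thL] := theta_lipschitz c0.
have mthE : (\int[lebesgue_measure]_(t in `[0%R, 1%R]) theta (2 / a) t = th)%R.
  by rewrite /Rintegral integral_theta.
have thB t : (`|theta (2 / a) t| <= expR (2 / a) * Num.sqrt (pi / (2 / a / 2)))%R.
  by rewrite ger0_norm ?theta_ge0// theta_le.
have app1 := trig1_approx (@theta_periodic R (2 / a)) thB Lp0 thL.
rewrite mthE in app1.
have app := @trig_product_approx R _ _ _ n.+2 thB app1.
have key (v : 'rV[R]_n.+2) : (v ord0 ord0 != 0)%R ->
    (((r j ^+ n.+1)^-1%:E * inner (r j) v @[j --> \oo] --> (th ^+ n.+2)%:E * flux K sigma v) /\
    forall j, (r j ^+ n.+1)^-1%:E * inner (r j) v <= B%:E * flux K sigma v).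
  move=> v0; rewrite /flux (cauchy_projection cK vK hM curv Kc hs v0).
  exact: (periodic_equidistribution cK vK strict v0 r0 rc (2^-1 *: v)%R
    (@measurable_Theta R n.+2 _ c0) BT app).
have mfl : measurable_fun setT (flux K sigma) := measurable_flux cK vK hM curv Kc hs.
have fl0 v : 0 <= flux K sigma v by exact: flux_ge0.
have mk : measurable_fun setT (fun v : 'rV[R]_n.+2 => (kappa a v)%:E).
  apply/measurable_EFinP; apply: measurable_funM => //; apply: measurableT_comp => //.
  by apply: measurableT_comp => //; apply: measurable_funM => //; exact: measurable_dotv.
have mg : measurable_fun setT (fun v : 'rV[R]_n.+2 => (gaussv a v)%:E).
  by apply/measurable_EFinP; exact: measurable_gaussv.
have total := integral_gaussian_flux cK vK hM curv Kc hs a0.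
have sM : sigma M < +oo.
  apply: le_lt_trans (sigma_frontier_finite cK vK hM curv Kc hs).
  by apply: le_measure; rewrite ?inE//; exact: measurable_frontier cK.
have kth (v : 'rV[R]_n.+2) : (kappa a v)%:E = ((th ^+ n.+2)^-1)%:E * (gaussv a v)%:E.
  have thn : (th ^+ n.+2 != 0)%R by rewrite expf_neq0// gt_eqF.
  rewrite -EFinM -(kappa_gaussv v a0) -/th; congr EFin.
  by rewrite [RHS]mulrCA (mulVf thn) mulr1.
(* The dominating function is [kappa] times [B] times the flux, with [kappa] rewritten as [gaussv]
   over [th ^+ n.+2]. *)
pose Bt := (B / th ^+ n.+2)%R.
have Bt0 : (0 <= Bt)%R by rewrite divr_ge0// exprn_ge0// ltW.
rewrite -total.
have rn0 j : (0 <= (r j ^+ n.+1)^-1)%R by rewrite invr_ge0 exprn_ge0// ltW.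
have in0 j v : 0 <= inner (r j) v.
  by apply: integral_ge0 => z _; rewrite lee_fin Theta_ge0.
rewrite (_ : (fun j => _) = (fun j => \int[lam n.+2]_v
    ((kappa a v)%:E * ((r j ^+ n.+1)^-1%:E * inner (r j) v)))); last first.
  apply/funext => j; rewrite -ge0_integralZl//.
  - by apply: eq_integral => v _; rewrite muleCA.
  - by apply: emeasurable_funM => //; exact: measurable_inner.
  - by move=> v _; rewrite mule_ge0// lee_fin kappa_ge0.
  - by rewrite lee_fin.
have ae0 : {ae lam n.+2, forall v : 'rV[R]_n.+2, (v ord0 ord0 != 0)%R}.
  exists [set v : 'rV[R]_n.+2 | v ord0 ord0 = 0%R]; split.
  - rewrite (_ : mkset _ = (fun v : 'rV[R]_n.+2 => v ord0 ord0) @^-1` [set 0%R])//.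
    by rewrite -[X in measurable X]setTI; exact: measurable_coord.
  - exact: coord0_null.
  - by move=> v /= /negP; rewrite negbK => /eqP.
have [|||||_ _] := @dominated_convergence _ _ _ (lam n.+2) setT measurableT
  (fun j v => (kappa a v)%:E * ((r j ^+ n.+1)^-1%:E * inner (r j) v))
  (fun v => (gaussv a v)%:E * flux K sigma v)
  (fun v => Bt%:E * ((gaussv a v)%:E * flux K sigma v)); last by [].
- by move=> j; apply: emeasurable_funM => //; apply: emeasurable_funM.
- exact: emeasurable_funM.
- apply: filterS ae0 => v v0 _; have [lim _] := key v v0.
  have -> : (gaussv a v)%:E * flux K sigma v =
      (kappa a v)%:E * ((th ^+ n.+2)%:E * flux K sigma v).
    by rewrite muleA -EFinM (kappa_gaussv (v : 'rV[R]_n.+2) a0).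
  by apply: cvgeZl.
- apply/integrableP; split; first by apply: emeasurable_funM => //; exact: emeasurable_funM.
  under eq_integral => v _.
    rewrite gee0_abs; last by rewrite !mule_ge0 ?lee_fin ?gaussv_ge0.
    over.
  rewrite ge0_integralZl//; last 2 first.
  + exact: emeasurable_funM.
  + by move=> v _; rewrite mule_ge0// lee_fin gaussv_ge0.
  by rewrite total muleA -EFinM lte_mul_pinfty// lee_fin mulr_ge0.
- apply: filterS ae0 => v v0 j _; have [_ bnd] := key v v0.
  rewrite gee0_abs; last by rewrite mule_ge0 ?lee_fin ?kappa_ge0// mule_ge0 ?lee_fin.
  apply: (@le_trans _ _ ((kappa a v)%:E * (B%:E * flux K sigma v))).
    by rewrite lee_wpmul2l ?lee_fin ?kappa_ge0.
  rewrite kth !muleA -!EFinM le_eqVlt; apply/orP; left; apply/eqP; congr (_%:E * _).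
  by rewrite /Bt; ring.
Qed.

End assembly.

Section count.
Context {R : realType} d (T : measurableType d) (P : probability T R).
Local Open Scope ereal_scope.
Local Notation lam n := (@lebesgue_rV R n).
Variables (a : R) (n : nat) (xi : 'rV[int]_n.+1 -> {RV P >-> 'rV[R]_n.+1}).
Hypothesis a0 : (0 < a)%R.
Hypothesis indep : mutually_independent xi.
Hypothesis dens : forall k, has_density (xi k) (gaussian_density a).

Lemma variance_number_of_points (B : set 'rV[R]_n.+1) : measurable B -> lam n.+1 B < +oo ->
  'V_P[number_of_points xi B] = \int[lam n.+1]_v ((kappa a v)%:E *
    \int[lam n.+1]_(z in [set z | B z /\ ~ B (z + v)%R]) (Theta (2 / a) (z + 2^-1 *: v)%R)%:E).
Proof.
move=> mB Bfin.
(* In positive dimension the lattice is infinite, so the unordered sum over it becomes a series over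
   the naturals. *)
have [e be] := infinite_countable_enum (@infinite_rV_int n).
pose tr j : 'rV[R]_n.+1 := map_mx intr (e j).
pose E j := (fun x : 'rV[R]_n.+1 => (tr j + x)%R) @^-1` B.
have mtr (k : 'rV[R]_n.+1) : measurable_fun setT (fun x : 'rV[R]_n.+1 => (k + x)%R).
  by apply: measurable_rVD => //; exact: measurable_cst.
have mE j : measurable (E j) by rewrite -[X in measurable X]setTI; exact: mtr.
pose A j := xi (e j) @^-1` E j.
have mA j : measurable (A j).
  rewrite -[X in measurable X]setTI; exact: (measurable_funP (xi (e j))).
have PA j : P (A j) = \int[lam n.+1]_(x in E j) (gaussian_density a x)%:E.
  by rewrite -(dens (e j) (mE j)).
have PAc j : P (~` A j) = \int[lam n.+1]_(x in ~` E j) (gaussian_density a x)%:E.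
  by rewrite -(dens (e j) (measurableC (mE j))).
have ind i j : i != j -> P (A i `&` A j) = P (A i) * P (A j).
  move=> ij; have eij : e i != e j.
    apply: contra ij => /eqP eij; apply/eqP; have [_ ei _] := be.
    by apply: ei => //; rewrite inE.
  (* Independence is stated for sets indexed by lattice points; the finite family is the pair [e i],
     [e j]. *)
  pose D k := (fun x : 'rV[R]_n.+1 => (map_mx intr k + x)%R) @^-1` B.
  have mD k : measurable (D k) by rewrite -[X in measurable X]setTI; exact: mtr.
  have := indep [fset e i; e j]%fset mD.
  rewrite big_fsetU1 ?inE//= big_seq_fset1 => <-; congr (P _).
  apply/seteqP; split => w.
    by move=> [wi wj] k /=; rewrite !inE => /orP[/eqP->|/eqP->].
  by move=> h; split; apply: h => /=; rewrite !inE eqxx ?orbT.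
have sumA : \sum_(j <oo) P (A j) < +oo.
  under eq_eseriesr => j _ do rewrite PA.
  exact: (summable_density a0 be mB Bfin).
have -> : number_of_points xi B = (fun w => fine (\sum_(j <oo) (\1_(A j) w)%:E)).
  apply/funext => w; rewrite /number_of_points /point_process; congr fine.
  rewrite (esum_enum be) => [|k]; last by rewrite diracE lee_fin ler0n.
  apply: eq_eseriesr => j _; rewrite diracE indicE.
  have -> : (map_mx intr (e j) + xi (e j) w \in B)%R = (w \in A j).
    by apply/idP/idP; rewrite !inE.
  by [].
rewrite (variance_count mA ind sumA) -(lattice_variance a0 be mB).
by apply: eq_eseriesr => j _; rewrite PA PAc.
Qed.

End count.

Lemma lebesgue_rV_compact_lty (R : realType) n (C : set 'rV[R]_n) :
  compact C -> (lebesgue_rV n C < +oo)%E.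
Proof.
move=> cC; have [B [_ CB]] := compact_bounded cC.
pose M := Num.max 0 B + 1.
have M0 : 0 <= M by rewrite addr_ge0// le_max lexx.
apply: (@le_lt_trans _ _ (lebesgue_rV n (@rV_box R n M))).
  apply: le_measure; rewrite ?inE; [exact: compact_measurable_rV|exact: measurable_rV_box|].
  move=> x Cx j; apply: le_trans (ler_coord_norm _ _) _; apply: CB => //.
  by rewrite ltr_pwDr// le_max lexx orbT.
by rewrite [X in (X < _)%E]lebesgue_rV_box ?ltry.
Qed.

Lemma convex_set_cvx (R : realType) n (K : set 'rV[R]_n) :
  convex_set (K : set (convex_lmodType 'rV[R]_n)) -> cvx K.
Proof.
move=> cK x y l Kx Ky l0 l1.
have lP : Itv.spec (@Itv.num_sem R) (Itv.Real `[0%Z, 1%Z]) l.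
  by rewrite /Itv.spec/=/Itv.num_sem /= in_itv/= l0 l1 num_real.
(* The coefficient weighs the first argument, hence the exchange of [x] and [y]. *)
have := cK y x (Itv01 l0 l1); rewrite !inE => /(_ Ky Kx).
congr K; rewrite /conv/= /unstable.onem.
by apply/rowP => j; rewrite !mxE; ring.
Qed.

(** Without interior, [K] would coincide with its frontier. A chart around a point has an open
    domain of positive dimension, so it provides a second boundary point, and the midpoint of the
    two is interior by strict convexity. *)
Lemma interior_nonempty (R : realType) n (K : set 'rV[R]_n.+2) : compact K -> cvx K ->
  smooth_hypersurface (frontier K) -> nonvanishing_curvature (frontier K) ->
  K !=set0 -> exists c, K° c.
Proof.
move=> cK vK hM curv [p Kp]; apply: contrapT => nint.
have nI x : ~ K° x by move=> Kx; apply: nint; exists x.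
have Mp : frontier K p by apply/frontierP.
have [U [X [lp [u Uu Xu]]]] : exists (U : set 'rV[R]_n.+1) (X : 'rV[R]_n.+1 -> 'rV[R]_n.+2),
    @local_parametrization R n.+2 (frontier K) U X /\ (X @` U) p := hM p Mp.
have [oU _ _ inj _] := lp.
have [e e0 eU] : exists2 e : R, 0 < e & ball u e `<=` U.
  by have /(nbhs_ballP _ _)[e e0 eU] := open_nbhs_nbhs (conj oU Uu); exists e.
pose w := u + const_mx (e / 2).
have uw : u != w.
  rewrite -subr_eq0 /w opprD addrA subrr sub0r oppr_eq0; apply/eqP => /rowP/(_ ord0).
  by rewrite !mxE => /eqP; rewrite mulf_eq0 invr_eq0 pnatr_eq0 orbF gt_eqF.
have Uw : U w.
  apply: eU; rewrite -ball_normE /ball_/= /w opprD addrA subrr sub0r normrN.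
  apply: (@le_lt_trans _ _ (e / 2)); last by rewrite ltr_pdivrMr// ltr_pMr// ltr1n.
  by apply: ler_norm_rV => [|j]; rewrite ?mxE ?ger0_norm ?divr_ge0// ltW.
have KX y : U y -> K (X y).
  move=> Uy; have sub := parametrization_sub lp.
  by apply: (frontier_sub cK); exact: sub.
have XX : X u != X w by apply: contra uw => /eqP h; apply/eqP; apply: inj; rewrite ?inE.
have strict p' q : K p' -> K q -> p' != q ->
    ~ (forall t : R, 0 <= t -> t <= 1 -> frontier K (p' + t *: (q - p'))).
  by move=> Kp' Kq pq; exact: (@no_segment R n.+1 K cK vK hM curv p' q Kp' Kq pq).
exact: nI (strict_midpoint cK vK strict (KX u Uu) (KX w Uw) XX).
Qed.

Theorem theorem5 (R : realType) (d : nat) (a : R)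
    (disp : measure_display) (T : measurableType disp) (P : probability T R)
    (xi : 'rV[int]_d -> {RV P >-> 'rV[R]_d})
    (K : set 'rV[R]_d) (sigma : {measure set 'rV[R]_d -> \bar R}) :
  (2 <= d)%N -> 0 < a ->
  mutually_independent xi ->
  (forall n, has_density (xi n) (gaussian_density a)) ->
  compact K ->
  convex_set (K : set (convex_lmodType 'rV[R]_d)) ->
  smooth_closed_hypersurface (frontier K) ->
  nonvanishing_curvature (frontier K) ->
  is_surface_measure (frontier K) sigma ->
  ('V_P[number_of_points xi (dilate r K)] / (r ^+ d.-1)%:E)%E @[r --> +oo%R]
    --> ((Num.sqrt (a / (2 * pi)))%:E * sigma (frontier K))%E.
Proof.
case: d xi K sigma => [|[|n]] xi K sigma // _ a0 indep dens cK conv [_ hM] curv hs.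
have vK := convex_set_cvx conv.
(* The empty set satisfies the hypotheses; both sides are then 0. *)
have [K0|/set0P[p Kp]] := eqVneq K set0.
  have -> : frontier K = set0 by rewrite K0 /frontier closure0 set0D.
  rewrite measure0 mule0 (_ : (fun r => _) = cst 0%E); first exact: cvg_cst.
  apply/funext => r /=.
  have -> : number_of_points xi (dilate r K) = cst 0.
    apply/funext => w; rewrite K0 /dilate image_set0 /number_of_points /point_process.
    by rewrite esum1// => k _; rewrite dirac0.
  by rewrite variance_cst mul0e.
have [c Kc] := interior_nonempty cK vK hM curv (ex_intro _ p Kp).
apply: cvg_pinfty_seq => r r0 rc.
rewrite (_ : (fun j => _) = (fun j => (r j ^+ n.+1)^-1%:E *
    \int[lebesgue_rV n.+2]_v ((kappa a v)%:E *
      \int[lebesgue_rV n.+2]_(z in escape (dilate (r j) K) v)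
        (Theta (2 / a) (z + 2^-1 *: v)%R)%:E))%E).
  exact: (lattice_variance_cvg a0 cK vK hM curv Kc hs r0 rc).
apply/funext => j.
have cD : compact (dilate (r j) K) by exact: compact_dilate.
rewrite (variance_number_of_points a0 indep dens (compact_measurable_rV cD) (lebesgue_rV_compact_lty cD)).
by rewrite [LHS]muleC inver expf_eq0/= gt_eqF.
Qed.
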